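(* Let $b>1$ be an integer, $A\subset\{0,1,\dots,b-1\}$, $N=\#A$, $A_1=A\setminus\{0\}$, $N_1=\#A_1$, and assume $1<N<b$. Let $K(s)$ be the (meromorphically continued) restricted Dirichlet series and $\gamma_j=\sum_{a\in A}a^j$. The sequence $(K(-m))_{m\ge0}$ consists of rational numbers verifying $K(0)=-N_1/(N-1)$ and, for every $m\ge1$, $$(b^{-m}-N)K(-m)=\frac{\gamma_m}{b^m}+\sum_{j=1}^m\binom mj\frac{\gamma_j}{b^j}K(-m+j).$$ If $0\in A$, i.e. if $K(0)=-1$, then $K(-m)=0$ for every $m\ge1$. If $0\notin A$, i.e. if $N_1=N$, equivalently if $K(0)<-1$, the exponential generating function $C(t)=\sum_{m=0}^\infty K(-m)\frac{t^m}{m!}$ verifies the functional equation $$C(b^{-1}t)=\alpha_A(b^{-1}t)+\alpha_A(b^{-1}t)\,C(t),\qquad\text{where }\alpha_A(t)=\sum_{a\in A}e^{at};$$ it has a positive radius of convergence and is (extends to) a meromorphic function in the entire complex plane, given by $$C(t)=-1-\sum_{k=1}^\infty\frac1{\prod_{j=1}^k\alpha_A(b^{-j}t)},$$ where, at every $t\in\mathbb{C}$ not belonging to $\{b^jz:\ j\ge1,\ \alpha_A(z)=0\}$, the series on the right-hand side converges geometrically.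
   Context: An integer $n>0$ is admissible if all digits of its (minimal) base-$b$ representation belong to $A$. $K(s)=\sum'n^{-s}$ (sum over admissible $n>0$) converges for $\Re s>\log_bN$ and extends to a meromorphic function on $\mathbb{C}$, still denoted $K(s)$, whose poles are among the points $\log_bN-m+k\frac{2\pi i}{\log b}$, $m\in\{0,1,2,\dots\}$, $k\in\mathbb{Z}$; for $1<N<b$ the integers are therefore not poles. Convention: $0^0=1$, so $\gamma_0=N$. *)

(* Defs.v *)
From Stdlib Require Export Arith Factorial Reals List ClassicalEpsilon.
From Coquelicot Require Export Coquelicot.
Open Scope C_scope.

Definition Cexp (z : C) : C :=
  (exp (Re z) * cos (Im z), exp (Re z) * sin (Im z))%R.

Definition C_is_series (u : nat -> C) (l : C) : Prop :=
  is_series (K := C_AbsRing) (V := C_NormedModule) u l.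

Definition C_is_pseries (a : nat -> C) (x l : C) : Prop :=
  is_pseries (K := C_AbsRing) (V := C_NormedModule) a x l.

Definition C_radius (a : nat -> C) : Rbar := CV_radius (fun m => Cmod (a m)).

Definition analytic_at (f : C -> C) (z : C) : Prop :=
  exists (a : nat -> C) (r : R), (0 < r)%R /\
    forall w : C, (Cmod (w - z) < r)%R -> C_is_pseries a (w - z) (f w).

(* Laurent expansion with finite principal part on a punctured disc; the value
   of [f] at [z] itself is irrelevant. *)
Definition meromorphic_at (f : C -> C) (z : C) : Prop :=
  exists (k : nat) (a : nat -> C) (r : R), (0 < r)%R /\
    forall w : C, (0 < Cmod (w - z) < r)%R ->
      C_is_pseries a (w - z) (Cpow (w - z) k * f w).

(* [f] is meromorphic on the whole plane, with all its poles in [P].  The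
   values of the total function [f] are meaningful outside of [P]. *)
Definition meromorphic_with_poles_in (f : C -> C) (P : C -> Prop) : Prop :=
  (forall z : C, meromorphic_at f z) /\
  (forall z : C, ~ P z -> analytic_at f z).

(* The speed is measured by the error of the partial sums, which amounts to a
   geometric bound on the terms. *)
Definition converges_geometrically (u : nat -> C) (l : C) : Prop :=
  C_is_series u l /\
  exists M q : R, (0 <= q < 1)%R /\
    forall n : nat,
      (Cmod (sum_n (G := C_AbelianGroup) u n - l) <= M * q ^ n)%R.

(* Without duplicates, the cardinality of the set of digits is [length A]. *)
Definition digit_set (b : nat) (A : list nat) : Prop :=
  NoDup A /\ forall a : nat, In a A -> (a < b)%nat.

Definition nonzero_digits (A : list nat) : list nat :=
  filter (fun a => negb (Nat.eqb a 0)) A.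

(* The positions of the digits in the minimal representation of [n > 0] are
   exactly the [k] such that [b ^ k <= n]. *)
Definition admissible (b : nat) (A : list nat) (n : nat) : Prop :=
  (0 < n)%nat /\
  forall k : nat, (b ^ k <= n)%nat -> In ((n / b ^ k) mod b)%nat A.

(* [n^(-s)] if [n] is admissible, and 0 otherwise. *)
Definition dirichlet_term (b : nat) (A : list nat) (s : C) (n : nat) : C :=
  if excluded_middle_informative (admissible b A n)
  then Cexp (- s * RtoC (ln (INR n)))
  else 0.

Definition log_base (b : nat) (x : R) : R := (ln x / ln (INR b))%R.

Definition candidate_pole (b : nat) (A : list nat) (s : C) : Prop :=
  exists (m : nat) (k : Z),
    s = RtoC (log_base b (INR (length A)) - INR m)
        + RtoC (IZR k) * (RtoC (2 * PI) * Ci / RtoC (ln (INR b))).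

Definition restricted_dirichlet (b : nat) (A : list nat) (K : C -> C) : Prop :=
  meromorphic_with_poles_in K (candidate_pole b A) /\
  forall s : C, (log_base b (INR (length A)) < Re s)%R ->
    C_is_series (dirichlet_term b A s) (K s).

Definition gamma (A : list nat) (j : nat) : nat :=
  list_sum (map (fun a => (a ^ j)%nat) A).

Definition alpha (A : list nat) (t : C) : C :=
  fold_right Cplus 0 (map (fun a => Cexp (RtoC (INR a) * t)) A).

Definition bpow (b j : nat) : C := RtoC (INR b ^ j).

Definition alpha_prod (b : nat) (A : list nat) (t : C) (k : nat) : C :=
  fold_right Cmult 1 (map (fun j => alpha A (t / bpow b j)) (seq 1 k)).

Definition alpha_singular (b : nat) (A : list nat) (t : C) : Prop :=
  exists (j : nat) (z : C), (1 <= j)%nat /\ alpha A z = 0 /\ t = bpow b j * z.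

Definition egf_coeff (K : C -> C) (m : nat) : C :=
  K (RtoC (- INR m)) / RtoC (INR (fact m)).

(* Main.v *)
Require Import Defs.
From Stdlib Require Import Lra Lia Psatz Permutation.

(** Writing an admissible [n >= b] as [b q + a] and expanding [(1 + a/(b q))^(-s)]
    gives, for [Re s > log_b N],
      [b^s (K(s) - sum_(a in A_1) a^(-s)) = sum_k binom(-s, k) gamma_k b^(-k) K(s + k)].
    The part [k > m] of the right-hand side is analytic for [Re s > log_b N - m - 1],
    so both sides can be compared along a segment that joins the half-plane of
    convergence to [-m] and avoids the candidate poles; at [s = -m] the part
    [k > m] vanishes, which leaves the recurrence.

    The recurrence bounds the coefficients of [C] geometrically and, when [0] is
    not a digit, amounts to [C(t/b) = alpha(t/b) (1 + C(t))] on the disc of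
    convergence.  Read as [C(t) = -1 + C(t/b) / alpha(t/b)], it extends [C] to the
    plane one dilation at a time; iterating it [k] times, the partial sum of the
    series differs from its limit by [(1 + C(t/b^k)) / prod_(j <= k) alpha(t/b^j)],
    which decays geometrically because [alpha(0) = N >= 2]. *)

(** * Complex series *)

(** [K] is known only through its Dirichlet series in a half-plane and its possible poles, so its
    values at [-m] must be reached by uniqueness of analytic continuation. The function theory rests
    on power series alone: under the weighted l1 norm of the coefficients on a closed disc,
    products, normally convergent series and reciprocals (Neumann series) all follow from norm
    estimates.

    The candidate poles have imaginary parts in (2 pi / log b) Z. A slanted segment whose imaginary
    part stays strictly between 0 and 2 pi / log b before it ends at [-m] can meet them only at its
    end, and there 0 < log_b N < 1 excludes them.

    The continued generating function is a total function, whose values are meaningless where the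
    division by [alpha] is a division by zero. Outside the disc of convergence its functional
    equation is therefore carried under the condition that alpha(t/b) is nonzero. *)

Local Notation csum_n := (sum_n (G := C_AbelianGroup)).
Local Notation csum_n_m := (sum_n_m (G := C_AbelianGroup)).

Ltac cring := match goal with |- @eq _ ?x ?y => change (@eq C x y); ring end.

Ltac cfield := match goal with |- @eq _ ?x ?y => change (@eq C x y); field end.

Ltac rring := match goal with |- @eq _ ?x ?y => change (@eq R x y); ring end.

Lemma choice_fun {T U : Type} (P : T -> U -> Prop) :
  (forall x, exists y, P x y) -> exists f, forall x, P x (f x).
Proof.
intros H. exists (fun x => proj1_sig (constructive_indefinite_description _ (H x))).
intros x. exact (proj2_sig (constructive_indefinite_description _ (H x))).
Qed.

Lemma Re_sum_n (u : nat -> C) n :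
  Re (csum_n u n) = sum_n (fun k => Re (u k)) n.
Proof.
induction n as [|n IH]; [rewrite !sum_O; reflexivity|].
rewrite !sum_Sn, <- IH. reflexivity.
Qed.

Lemma Im_sum_n (u : nat -> C) n :
  Im (csum_n u n) = sum_n (fun k => Im (u k)) n.
Proof.
induction n as [|n IH]; [rewrite !sum_O; reflexivity|].
rewrite !sum_Sn, <- IH. reflexivity.
Qed.

(** This gives access to the real theorems on comparison and on Cauchy products. *)
Lemma C_is_series_Re_Im u l :
  C_is_series u l <->
  is_series (fun n => Re (u n)) (Re l) /\ is_series (fun n => Im (u n)) (Im l).
Proof.
unfold C_is_series, is_series. split.
- intros H.
  assert (H' := proj1 (filterlim_locally (U := C_UniformSpace) _ _) H).
  split; apply filterlim_locally; intros eps; generalize (H' eps); apply filter_imp;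
    intros n [H1 H2].
  + rewrite <- Re_sum_n. exact H1.
  + rewrite <- Im_sum_n. exact H2.
- intros [H1 H2].
  apply (proj2 (filterlim_locally (U := C_UniformSpace) _ _)). intros eps.
  generalize (filter_and _ _ (proj1 (filterlim_locally _ _) H1 eps)
    (proj1 (filterlim_locally _ _) H2 eps)). apply filter_imp.
  intros n [h1 h2]. rewrite <- Re_sum_n in h1. rewrite <- Im_sum_n in h2.
  split; assumption.
Qed.

Lemma Cmod_le_Re_Im z : (Cmod z <= Rabs (Re z) + Rabs (Im z))%R.
Proof.
replace z with (RtoC (Re z) + RtoC (Im z) * Ci) at 1
  by (destruct z as [x y]; unfold Re, Im; cbn; apply injective_projections; cbn; ring).
eapply Rle_trans; [apply Cmod_triangle|].
rewrite Cmod_mult, !Cmod_R, Cmod_Ci. lra.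
Qed.

Lemma im_le_Cmod z : (Rabs (Im z) <= Cmod z)%R.
Proof.
eapply Rle_trans; [|apply Rmax_Cmod]. apply Rmax_r.
Qed.

Lemma is_lim_eps (u : nat -> R) (l : R) :
  is_lim_seq u l <->
  forall eps, (0 < eps)%R -> exists N, forall n, (N <= n)%nat -> (Rabs (u n - l) < eps)%R.
Proof.
rewrite <- (is_lim_seq_spec u l). split; intros H eps.
- intros Heps. destruct (H (mkposreal eps Heps)) as [N HN]. exists N. exact HN.
- destruct (H eps (cond_pos eps)) as [N HN]. exists N. exact HN.
Qed.

Lemma C_is_series_eps u l :
  C_is_series u l <->
  forall eps, (0 < eps)%R -> exists N, forall n, (N <= n)%nat ->
    (Cmod (csum_n u n - l) < eps)%R.
Proof.
rewrite C_is_series_Re_Im. split.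
- intros [H1 H2] eps Heps.
  destruct (proj1 (is_lim_eps (sum_n (fun n => Re (u n))) (Re l)) H1 (eps/2)%R) as [N1 h1]; [lra|].
  destruct (proj1 (is_lim_eps (sum_n (fun n => Im (u n))) (Im l)) H2 (eps/2)%R) as [N2 h2]; [lra|].
  exists (max N1 N2). intros n Hn.
  eapply Rle_lt_trans; [apply Cmod_le_Re_Im|].
  specialize (h1 n ltac:(lia)). specialize (h2 n ltac:(lia)).
  rewrite <- Re_sum_n in h1. rewrite <- Im_sum_n in h2.
  change (Re (sum_n u n - l)) with (Re (csum_n u n) - Re l)%R.
  change (Im (sum_n u n - l)) with (Im (csum_n u n) - Im l)%R.
  lra.
- intros H. split.
  + apply (is_lim_eps (sum_n (fun n => Re (u n))) (Re l)). intros eps Heps.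
    destruct (H eps Heps) as [N HN]. exists N. intros n Hn.
    rewrite <- Re_sum_n. eapply Rle_lt_trans; [|apply (HN n Hn)].
    apply (re_le_Cmod (csum_n u n - l)).
  + apply (is_lim_eps (sum_n (fun n => Im (u n))) (Im l)). intros eps Heps.
    destruct (H eps Heps) as [N HN]. exists N. intros n Hn.
    rewrite <- Im_sum_n. eapply Rle_lt_trans; [|apply (HN n Hn)].
    apply (im_le_Cmod (csum_n u n - l)).
Qed.

Lemma C_is_series_unique u l l' : C_is_series u l -> C_is_series u l' -> l = l'.
Proof.
rewrite !C_is_series_Re_Im. intros [h1 h2] [h3 h4].
apply is_series_unique in h1, h2, h3, h4.
destruct l, l'; cbn in *. congruence.
Qed.

Lemma C_is_series_ext (u v : nat -> C) (l : C) :
  (forall n, u n = v n) -> C_is_series u l -> C_is_series v l.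
Proof. apply is_series_ext. Qed.

Lemma C_is_series_plus u v l l' :
  C_is_series u l -> C_is_series v l' -> C_is_series (fun n => u n + v n) (l + l').
Proof. apply (is_series_plus (K := C_AbsRing) (V := C_NormedModule)). Qed.

Lemma C_is_series_scal c u l :
  C_is_series u l -> C_is_series (fun n => c * u n) (c * l).
Proof. apply (is_series_scal (K := C_AbsRing) (V := C_NormedModule) c u l). Qed.

Lemma C_is_series_0 : C_is_series (fun _ => 0) 0.
Proof.
apply C_is_series_eps. intros eps Heps. exists 0%nat. intros n _.
replace (csum_n (fun _ => RtoC 0) n) with (RtoC 0).
- unfold Cminus. rewrite Cplus_opp_r, Cmod_0. exact Heps.
- induction n as [|n IH]; [rewrite sum_O; reflexivity|].
  rewrite sum_Sn, <- IH. symmetry. apply (Cplus_0_l 0).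
Qed.

Lemma C_is_series_S u l :
  C_is_series (fun n => u (S n)) l <-> C_is_series u (u 0%nat + l).
Proof.
split; intros H.
- apply (is_series_decr_1 (K := C_AbsRing) (V := C_NormedModule) u).
  change (C_is_series (fun n => u (S n)) (u 0%nat + l - u 0%nat)).
  replace (u 0%nat + l - u 0%nat) with l by ring. exact H.
- apply (is_series_incr_1 (K := C_AbsRing) (V := C_NormedModule) u).
  change (C_is_series u (l + u 0%nat)). rewrite Cplus_comm. exact H.
Qed.

(* Junk value on divergent series. *)
Definition Csum (u : nat -> C) : C :=
  (Series (fun n => Re (u n)), Series (fun n => Im (u n))).

Lemma Csum_unique u l : C_is_series u l -> Csum u = l.
Proof.
rewrite C_is_series_Re_Im. intros [h1 h2].
unfold Csum. rewrite (is_series_unique _ _ h1), (is_series_unique _ _ h2).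
destruct l; reflexivity.
Qed.

Lemma Cmod_sum_n_le (u : nat -> C) n :
  (Cmod (csum_n u n) <= sum_n (fun k => Cmod (u k)) n)%R.
Proof.
induction n as [|n IH]; [rewrite !sum_O; lra|].
rewrite !sum_Sn. eapply Rle_trans; [apply Cmod_triangle|].
apply Rplus_le_compat_r. exact IH.
Qed.

Lemma sum_n_le_series (M : nat -> R) T n :
  (forall k, (0 <= M k)%R) -> is_series M T -> (sum_n M n <= T)%R.
Proof.
intros HM HT.
apply (is_lim_seq_incr_compare (sum_n M) T HT).
intros k. rewrite sum_Sn. specialize (HM (S k)). unfold plus; cbn. lra.
Qed.

(** Only late partial sums are constrained, because in Tannery's theorem the bound is available only
    beyond the cut between head and tail. *)
Lemma C_is_series_Cmod_le u l B N :
  C_is_series u l ->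
  (forall n, (N <= n)%nat -> (Cmod (csum_n u n) <= B)%R) ->
  (Cmod l <= B)%R.
Proof.
rewrite C_is_series_eps. intros H HB.
apply le_epsilon. intros eps Heps.
destruct (H eps Heps) as [N' HN].
specialize (HN (max N N') ltac:(lia)). specialize (HB (max N N') ltac:(lia)).
replace l with (csum_n u (max N N') - (csum_n u (max N N') - l)) by ring.
eapply Rle_trans; [apply Cmod_triangle|]. rewrite Cmod_opp. lra.
Qed.

(** Weierstrass's M-test; it certifies that the value of [Csum] is a true sum. *)
Lemma C_is_series_dominated u M S :
  (forall n, (Cmod (u n) <= M n)%R) -> is_series M S ->
  C_is_series u (Csum u) /\ (Cmod (Csum u) <= S)%R.
Proof.
intros Hu HM.
assert (H : C_is_series u (Csum u)).
{ apply C_is_series_Re_Im. split; apply Series_correct.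
  - apply (ex_series_le (V := R_CompleteNormedModule) _ M); [|exists S; exact HM].
    intros n. eapply Rle_trans; [apply re_le_Cmod | apply Hu].
  - apply (ex_series_le (V := R_CompleteNormedModule) _ M); [|exists S; exact HM].
    intros n. eapply Rle_trans; [apply im_le_Cmod | apply Hu]. }
split; [exact H|].
apply (C_is_series_Cmod_le u _ S 0 H). intros n _.
eapply Rle_trans; [apply Cmod_sum_n_le|].
eapply Rle_trans; [|apply (sum_n_le_series M S n)].
- apply sum_n_m_le. intros k. apply Hu.
- intros k. eapply Rle_trans; [apply Cmod_ge_0 | apply Hu].
- exact HM.
Qed.

Lemma sum_n_scal_C c (u : nat -> C) n :
  csum_n (fun k => c * u k) n = c * csum_n u n.
Proof.
induction n as [|n IH]; [rewrite !sum_O; reflexivity|].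
rewrite !sum_Sn, IH. unfold plus; cbn. ring.
Qed.

Lemma sum_n_eps (d : nat -> nat -> C) N :
  (forall n eps, (0 < eps)%R -> exists m0, forall m, (m0 <= m)%nat -> (Cmod (d m n) < eps)%R) ->
  forall eps, (0 < eps)%R -> exists m0, forall m, (m0 <= m)%nat ->
   (Cmod (csum_n (d m) N) < eps)%R.
Proof.
intros Hd. induction N as [|N IH]; intros eps Heps.
- destruct (Hd 0%nat eps Heps) as [m0 H]. exists m0. intros m Hm. rewrite sum_O. apply H, Hm.
- destruct (Hd (S N) (eps/2)%R) as [m1 H1]; [lra|].
  destruct (IH (eps/2)%R) as [m2 H2]; [lra|].
  exists (max m1 m2). intros m Hm. rewrite sum_Sn.
  eapply Rle_lt_trans; [apply Cmod_triangle|].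
  specialize (H1 m ltac:(lia)). specialize (H2 m ltac:(lia)). lra.
Qed.

Lemma Cmod_sum_n_tail (u : nat -> C) (B : nat -> R) N n :
  (forall k, (Cmod (u k) <= B k)%R) -> (N <= n)%nat ->
  (Cmod (csum_n u n - csum_n u N)
   <= sum_n B n - sum_n B N)%R.
Proof.
intros Hu Hn. induction Hn as [|n Hn IH].
- unfold Cminus. rewrite Cplus_opp_r, Cmod_0. lra.
- rewrite !sum_Sn.
  change (plus (sum_n B n) (B (S n))) with (sum_n B n + B (S n))%R.
  change (plus (csum_n u n) (u (S n)))
    with (csum_n u n + u (S n)).
  replace (csum_n u n + u (S n) - csum_n u N)
    with (csum_n u n - csum_n u N + u (S n)) by ring.
  eapply Rle_trans; [apply Cmod_triangle|]. specialize (Hu (S n)). lra.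
Qed.

(* Tannery's theorem. *)
Lemma dominated_sum (v : nat -> nat -> C) (R0 : nat -> C) (V : nat -> C) l M S :
  (forall m n, (Cmod (v m n) <= M n)%R) -> is_series M S ->
  (forall n eps, (0 < eps)%R ->
     exists m0, forall m, (m0 <= m)%nat -> (Cmod (v m n - R0 n) < eps)%R) ->
  (forall m, C_is_series (v m) (V m)) -> C_is_series R0 l ->
  forall eps, (0 < eps)%R -> exists m0, forall m, (m0 <= m)%nat -> (Cmod (V m - l) < eps)%R.
Proof.
intros Hv HM HR HV Hl eps Heps.
assert (HM0 : forall n, (0 <= M n)%R)
  by (intros n; eapply Rle_trans; [apply Cmod_ge_0 | apply (Hv 0%nat n)]).
assert (HRM : forall n, (Cmod (R0 n) <= M n)%R).
{ intros n. apply le_epsilon. intros e He. destruct (HR n e He) as [m0 H].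
  specialize (H m0 (Nat.le_refl _)). specialize (Hv m0 n).
  replace (R0 n) with (v m0 n - (v m0 n - R0 n)) by ring.
  eapply Rle_trans; [apply Cmod_triangle|]. rewrite Cmod_opp. lra. }
(* The head will contribute less than eps/4, and the tail at most twice the remainder of [M], hence
   less than eps/2. The total 3/4 eps leaves room for a strict inequality. *)
destruct (proj1 (is_lim_eps (sum_n M) S) HM (eps/4)%R) as [N HN]; [lra|].
specialize (HN N (Nat.le_refl _)). apply Rabs_def2 in HN.
destruct (sum_n_eps (fun m n => v m n - R0 n) N HR (eps/4)%R) as [m0 Hm0]; [lra|].
exists m0. intros m Hm. specialize (Hm0 m Hm).
assert (HD : C_is_series (fun n => v m n - R0 n) (V m - l)).
{ apply (C_is_series_ext (fun n => v m n + (-1) * R0 n)); [intros n; ring|].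
  replace (V m - l) with (V m + (-1) * l) by ring.
  apply C_is_series_plus; [apply HV | apply C_is_series_scal, Hl]. }
apply Rle_lt_trans with (eps * (3/4))%R; [|lra].
apply (C_is_series_Cmod_le _ _ _ N HD). intros n Hn.
assert (Ht := Cmod_sum_n_tail (fun n => v m n - R0 n) (fun n => 2 * M n)%R N n).
cbv beta in Ht.
rewrite 2!(sum_n_mult_l (K := R_Ring)) in Ht. unfold mult in Ht; cbn in Ht.
assert (Hle : (sum_n M n <= S)%R) by (apply sum_n_le_series; assumption).
set (D := fun n => v m n - R0 n) in *.
replace (csum_n D n) with
 (csum_n D N + (csum_n D n - csum_n D N)) by ring.
eapply Rle_trans; [apply Cmod_triangle|].
assert (Cmod (csum_n D n - csum_n D N)
  <= 2 * sum_n M n - 2 * sum_n M N)%R.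
{ apply Ht; [|exact Hn]. intros k. unfold D.
  eapply Rle_trans; [apply Cmod_triangle|]. rewrite Cmod_opp.
  specialize (Hv m k). specialize (HRM k). lra. }
lra.
Qed.

Lemma C_is_series_sum_n (u : nat -> nat -> C) (S : nat -> C) m :
  (forall k, C_is_series (fun n => u n k) (S k)) ->
  C_is_series (fun n => csum_n (u n) m) (csum_n S m).
Proof.
intros H. induction m as [|m IH].
- rewrite sum_O. apply (C_is_series_ext (fun n => u n 0%nat)); [intros n; rewrite sum_O; reflexivity | apply H].
- rewrite sum_Sn.
  apply (C_is_series_ext (fun n => csum_n (u n) m + u n (Datatypes.S m)));
    [intros n; rewrite sum_Sn; reflexivity|].
  apply C_is_series_plus; [exact IH | apply H].
Qed.

(** Tannery's theorem applied to truncated rows: the partial sum of [cols] up to [m] is the sum over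
    [n] of the row [n] truncated at [m], which is dominated by [M n] and tends to [rows n]. *)
Lemma C_series_fubini (u : nat -> nat -> C) (B : nat -> nat -> R) (M : nat -> R) (T : R)
    (rows cols : nat -> C) :
  (forall n k, (Cmod (u n k) <= B n k)%R) ->
  (forall n, is_series (B n) (M n)) -> is_series M T ->
  (forall n, C_is_series (u n) (rows n)) ->
  (forall k, C_is_series (fun n => u n k) (cols k)) ->
  exists l, C_is_series rows l /\ C_is_series cols l.
Proof.
intros Hu HB HM Hr Hc.
assert (HB0 : forall n k, (0 <= B n k)%R)
  by (intros n k; eapply Rle_trans; [apply Cmod_ge_0 | apply Hu]).
assert (Hpart : forall n m, (Cmod (csum_n (u n) m) <= M n)%R).
{ intros n m. eapply Rle_trans; [apply Cmod_sum_n_le|].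
  eapply Rle_trans; [|apply (sum_n_le_series (B n) (M n) m (HB0 n) (HB n))].
  apply sum_n_m_le. intros k. apply Hu. }
exists (Csum rows).
assert (Hrows : C_is_series rows (Csum rows)).
{ apply (C_is_series_dominated rows M T); [|exact HM].
  intros n. apply (C_is_series_Cmod_le _ _ _ 0 (Hr n)). intros m _. apply Hpart. }
split; [exact Hrows|].
apply C_is_series_eps.
apply (dominated_sum (fun m n => csum_n (u n) m) rows _ _ M T).
- intros m n. apply Hpart.
- exact HM.
- intros n. exact (proj1 (C_is_series_eps _ _) (Hr n)).
- intros m. apply C_is_series_sum_n. exact Hc.
- exact Hrows.
Qed.

(** Convergence of the columns comes for free, since a single entry of row [n] is at most [M n]. *)
Lemma C_series_fubini_rows (u : nat -> nat -> C) (B : nat -> nat -> R) (M : nat -> R) (T : R)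
    (rows : nat -> C) (l : C) :
  (forall n k, (Cmod (u n k) <= B n k)%R) ->
  (forall n, is_series (B n) (M n)) -> is_series M T ->
  (forall n, C_is_series (u n) (rows n)) -> C_is_series rows l ->
  (forall k, C_is_series (fun n => u n k) (Csum (fun n => u n k))) /\
  C_is_series (fun k => Csum (fun n => u n k)) l.
Proof.
intros Hu HB HM Hr Hl.
assert (HB0 : forall n k, (0 <= B n k)%R)
  by (intros n k; eapply Rle_trans; [apply Cmod_ge_0 | apply Hu]).
assert (Hc : forall k, C_is_series (fun n => u n k) (Csum (fun n => u n k))).
{ intros k. apply (C_is_series_dominated _ M T); [|exact HM].
  intros n. eapply Rle_trans; [apply Hu|].
  eapply Rle_trans; [|apply (sum_n_le_series (B n) (M n) k (HB0 n) (HB n))].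
  destruct k as [|k]; [rewrite sum_O; lra|].
  rewrite sum_Sn. change (B n (S k) <= sum_n (B n) k + B n (S k))%R.
  assert (0 <= sum_n (B n) k)%R; [|lra].
  clear -HB0. induction k as [|k IH]; [rewrite sum_O; apply HB0|].
  rewrite sum_Sn. apply Rplus_le_le_0_compat; [exact IH | apply HB0]. }
split; [exact Hc|].
destruct (C_series_fubini u B M T rows _ Hu HB HM Hr Hc) as [l' [H1 H2]].
rewrite (C_is_series_unique _ _ _ Hl H1). exact H2.
Qed.

Lemma ex_series_Rabs_Re u S :
  is_series (fun n => Cmod (u n)) S -> ex_series (fun n => Rabs (Re (u n))).
Proof.
intros H. apply (ex_series_le (V := R_CompleteNormedModule) _ (fun n => Cmod (u n))); [|exists S; exact H].
intros n. unfold norm; cbn. rewrite Rabs_Rabsolu. apply re_le_Cmod.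
Qed.

Lemma ex_series_Rabs_Im u S :
  is_series (fun n => Cmod (u n)) S -> ex_series (fun n => Rabs (Im (u n))).
Proof.
intros H. apply (ex_series_le (V := R_CompleteNormedModule) _ (fun n => Cmod (u n))); [|exists S; exact H].
intros n. unfold norm; cbn. rewrite Rabs_Rabsolu. apply im_le_Cmod.
Qed.

Definition cauchy_prod (u v : nat -> C) (n : nat) : C :=
  csum_n (fun k => u k * v (n - k)%nat) n.

(** Four real Cauchy products, one for each pairing of real and imaginary parts. *)
Lemma C_is_series_mult u v lu lv S T :
  C_is_series u lu -> C_is_series v lv ->
  is_series (fun n => Cmod (u n)) S -> is_series (fun n => Cmod (v n)) T ->
  C_is_series (cauchy_prod u v) (lu * lv).
Proof.
intros Hu Hv HS HT.
apply C_is_series_Re_Im in Hu, Hv. destruct Hu as [u1 u2], Hv as [v1 v2].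
assert (a1 := ex_series_Rabs_Re u S HS). assert (a2 := ex_series_Rabs_Im u S HS).
assert (b1 := ex_series_Rabs_Re v T HT). assert (b2 := ex_series_Rabs_Im v T HT).
assert (H11 := is_series_mult _ _ _ _ u1 v1 a1 b1).
assert (H12 := is_series_mult _ _ _ _ u1 v2 a1 b2).
assert (H21 := is_series_mult _ _ _ _ u2 v1 a2 b1).
assert (H22 := is_series_mult _ _ _ _ u2 v2 a2 b2).
apply C_is_series_Re_Im. split.
- generalize (is_series_minus _ _ _ _ H11 H22). apply is_series_ext. intros n.
  unfold cauchy_prod. rewrite Re_sum_n, <- !sum_n_Reals.
  rewrite (sum_n_ext (fun k => Re (u k * v (n - k)%nat))
    (fun k => plus (Re (u k) * Re (v (n-k)%nat)) (mult (-1) (Im (u k) * Im (v (n-k)%nat))))%R).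
  + rewrite (sum_n_plus (G := R_AbelianGroup)), (sum_n_mult_l (K := R_Ring)).
    assert (E : forall x y : R, (x - y = x + (-1) * y)%R) by (intros; ring). apply E.
  + intros k. unfold Re, Im, plus, mult; cbn. ring.
- generalize (is_series_plus _ _ _ _ H12 H21). apply is_series_ext. intros n.
  unfold cauchy_prod. rewrite Im_sum_n, <- !sum_n_Reals.
  rewrite <- (sum_n_plus (G := R_AbelianGroup)). apply sum_n_ext. intros k.
  unfold plus; cbn. reflexivity.
Qed.

(** * Absolutely convergent power series on a disc *)

Lemma is_series_R_le (u v : nat -> R) T :
  (forall n, (0 <= u n <= v n)%R) -> is_series v T -> exists S : R, (S <= T)%R /\ is_series u S.
Proof.
intros H HT. exists (Series u).
assert (E : ex_series u).
{ apply (ex_series_le (V := R_CompleteNormedModule) _ v); [|exists T; exact HT].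
  intros n. unfold norm; cbn. rewrite Rabs_pos_eq; apply H. }
split; [|apply Series_correct, E].
rewrite <- (is_series_unique v T HT). apply Series_le; [exact H | exists T; exact HT].
Qed.

Lemma is_series_nonneg (u : nat -> R) U :
  (forall n, (0 <= u n)%R) -> is_series u U -> (0 <= U)%R.
Proof.
intros H HU. eapply Rle_trans; [apply (H 0%nat)|].
rewrite <- (sum_O u). apply sum_n_le_series; assumption.
Qed.

Lemma C_is_series_RtoC (u : nat -> R) l :
  is_series u l -> C_is_series (fun n => RtoC (u n)) (RtoC l).
Proof.
intros H. apply C_is_series_Re_Im. split; [exact H|].
cbn. generalize (C_is_series_0). rewrite C_is_series_Re_Im. intros [_ h]. exact h.
Qed.

Lemma is_series_fubini_nonneg (B : nat -> nat -> R) (M : nat -> R) T :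
  (forall n k, (0 <= B n k)%R) -> (forall n, is_series (B n) (M n)) -> is_series M T ->
  exists S : nat -> R, (forall k, is_series (fun n => B n k) (S k)) /\ is_series S T.
Proof.
intros H0 HB HM.
destruct (C_series_fubini_rows (fun n k => RtoC (B n k)) B M T (fun n => RtoC (M n)) (RtoC T))
  as [H1 H2].
- intros n k. rewrite Cmod_R, Rabs_pos_eq; [lra | apply H0].
- exact HB.
- exact HM.
- intros n. apply C_is_series_RtoC, HB.
- apply C_is_series_RtoC, HM.
- exists (fun k => Re (Csum (fun n => RtoC (B n k)))). split.
  + intros k. apply (proj1 (proj1 (C_is_series_Re_Im _ _) (H1 k))).
  + exact (proj1 (proj1 (C_is_series_Re_Im _ _) H2)).
Qed.

(* Ball of radius [M] of the weighted Wiener algebra. *)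
Definition wiener (z : C) (r M : R) (f : C -> C) : Prop :=
  exists (a : nat -> C) (T : R), (T <= M)%R /\
    is_series (fun k => Cmod (a k) * r ^ k)%R T /\
    forall w, (Cmod (w - z) <= r)%R -> C_is_series (fun k => a k * Cpow (w - z) k) (f w).

Lemma wiener_ext z r M f g :
  (forall w, (Cmod (w - z) <= r)%R -> f w = g w) -> wiener z r M f -> wiener z r M g.
Proof.
intros H (a & T & H1 & H2 & H3). exists a, T. repeat split; auto.
intros w Hw. rewrite <- (H w Hw). apply H3, Hw.
Qed.

Lemma wiener_le z r M M' f : (M <= M')%R -> wiener z r M f -> wiener z r M' f.
Proof.
intros H (a & T & H1 & H2 & H3). exists a, T. repeat split; auto. lra.
Qed.

Lemma Cpow_Cmod_le h r k : (Cmod h <= r)%R -> (Cmod (Cpow h k) <= r ^ k)%R.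
Proof.
intros H. rewrite Cmod_pow. apply pow_incr. split; [apply Cmod_ge_0 | exact H].
Qed.

Lemma term_le (c h : C) r k :
  (Cmod h <= r)%R -> (Cmod (c * Cpow h k) <= Cmod c * r ^ k)%R.
Proof.
intros H. rewrite Cmod_mult.
apply Rmult_le_compat_l; [apply Cmod_ge_0 | apply Cpow_Cmod_le, H].
Qed.

(** The weighted l1 norm dominates the supremum norm on the closed disc. *)
Lemma wiener_bound z r M f w :
  wiener z r M f -> (Cmod (w - z) <= r)%R -> (Cmod (f w) <= M)%R.
Proof.
intros (a & T & H1 & H2 & H3) Hw.
destruct (C_is_series_dominated _ _ _ (fun k => term_le (a k) _ r k Hw) H2) as [h1 h2].
rewrite (C_is_series_unique _ _ _ (H3 w Hw) h1). lra.
Qed.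

Lemma is_series_head (u : nat -> R) : (forall n, u (S n) = 0%R) -> is_series u (u 0%nat).
Proof.
intros H. apply is_series_decr_1.
change (is_series (fun k => u (S k)) (u 0%nat - u 0%nat)%R).
rewrite Rminus_diag. apply (is_series_ext (fun _ => 0%R)); [intros n; rewrite H; reflexivity|].
generalize C_is_series_0. rewrite C_is_series_Re_Im. intros [h _]. exact h.
Qed.

Lemma C_is_series_head (u : nat -> C) : (forall n, u (S n) = 0) -> C_is_series u (u 0%nat).
Proof.
intros H. replace (u 0%nat) with (u 0%nat + 0) by ring. apply C_is_series_S.
apply (C_is_series_ext (fun _ => 0)); [intros n; rewrite H; reflexivity | apply C_is_series_0].
Qed.

Lemma wiener_const z r c : wiener z r (Cmod c) (fun _ => c).
Proof.
exists (fun k => match k with O => c | _ => 0 end), (Cmod c). split; [lra|]. split.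
- replace (Cmod c) with (Cmod c * r ^ 0)%R at 1 by (cbn; ring).
  apply (is_series_head (fun k => Cmod (match k with O => c | _ => 0 end) * r ^ k)%R).
  intros n. rewrite Cmod_0. ring.
- intros w _.
  assert (h := C_is_series_head (fun k => match k with O => c | _ => 0 end * Cpow (w - z) k)).
  cbn in h. rewrite Cmult_1_r in h. apply h. intros n. ring.
Qed.

Lemma wiener_plus z r M M' f g :
  (0 <= r)%R ->
  wiener z r M f -> wiener z r M' g -> wiener z r (M + M') (fun w => f w + g w).
Proof.
intros Hr (a & T & H1 & H2 & H3) (b & T' & H1' & H2' & H3').
destruct (is_series_R_le (fun k => Cmod (a k + b k) * r ^ k)%R
   (fun k => plus (Cmod (a k) * r ^ k) (Cmod (b k) * r ^ k))%R (plus T T')) as [S [HS1 HS2]].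
- intros n. assert (0 <= r ^ n)%R by (apply pow_le, Hr).
  split; [apply Rmult_le_pos; [apply Cmod_ge_0 | assumption]|].
  unfold plus; cbn. rewrite <- Rmult_plus_distr_r.
  apply Rmult_le_compat_r; [assumption | apply Cmod_triangle].
- apply (is_series_plus (K := R_AbsRing) (V := R_NormedModule)); assumption.
- exists (fun k => a k + b k), S. split; [|split; [exact HS2|]].
  + unfold plus in HS1; cbn in HS1. lra.
  + intros w Hw.
    apply (C_is_series_ext (fun k => a k * Cpow (w - z) k + b k * Cpow (w - z) k)); [intros; ring|].
    apply C_is_series_plus; auto.
Qed.

Lemma Cpow_add h m n : Cpow h (m + n) = Cpow h m * Cpow h n.
Proof. induction m as [|m IH]; cbn; [ring | rewrite IH; ring]. Qed.

Lemma cauchy_prod_pow a b h n :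
  cauchy_prod (fun k => a k * Cpow h k) (fun k => b k * Cpow h k) n
  = cauchy_prod a b n * Cpow h n.
Proof.
unfold cauchy_prod. rewrite Cmult_comm, <- sum_n_scal_C. apply sum_n_ext_loc.
intros k Hk. replace n with (k + (n - k))%nat at 3 by lia. rewrite Cpow_add. cring.
Qed.

Lemma wiener_mult z r M M' f g :
  (0 <= r)%R ->
  wiener z r M f -> wiener z r M' g -> wiener z r (M * M') (fun w => f w * g w).
Proof.
intros Hr (a & T & H1 & H2 & H3) (b & T' & H1' & H2' & H3').
assert (Hp : forall n, (0 <= r ^ n)%R) by (intros n; apply pow_le, Hr).
assert (E : forall c U, is_series (fun k => Cmod (c k) * r ^ k)%R U ->
   ex_series (fun k => Rabs (Cmod (c k) * r ^ k))).
{ intros c U HU. exists U. revert HU. apply is_series_ext. intros k. symmetry.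
  apply Rabs_pos_eq, Rmult_le_pos; [apply Cmod_ge_0 | apply Hp]. }
assert (Hm := is_series_mult _ _ _ _ H2 H2').
destruct (is_series_R_le (fun k => Cmod (cauchy_prod a b k) * r ^ k)%R
   (fun n => sum_f_R0 (fun k => Cmod (a k) * r ^ k * (Cmod (b (n - k)%nat) * r ^ (n - k)))%R n)
   (T * T')%R) as [S [HS1 HS2]].
- intros n. split; [apply Rmult_le_pos; [apply Cmod_ge_0 | apply Hp]|].
  rewrite <- sum_n_Reals.
  eapply Rle_trans.
  { apply Rmult_le_compat_r; [apply Hp | apply Cmod_sum_n_le]. }
  rewrite Rmult_comm. change (r ^ n * ?x)%R with (mult (r ^ n)%R x).
  rewrite <- (sum_n_mult_l (K := R_Ring)). apply Req_le. apply sum_n_ext_loc.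
  intros k Hk. rewrite Cmod_mult. replace n with (k + (n - k))%nat at 1 by lia.
  rewrite pow_add. unfold mult; cbn. ring.
- apply Hm; eapply E; eassumption.
- assert (P : forall c U, is_series (fun k => Cmod (c k) * r ^ k)%R U -> (0 <= U)%R).
  { intros c U. apply is_series_nonneg.
    intros k. apply Rmult_le_pos; [apply Cmod_ge_0 | apply Hp]. }
  apply P in H2 as p. apply P in H2' as p'.
  exists (cauchy_prod a b), S. split; [nra|]. split; [exact HS2|].
  intros w Hw. apply (C_is_series_ext _ _ _ (cauchy_prod_pow a b (w - z))).
  assert (D : forall c U, is_series (fun k => Cmod (c k) * r ^ k)%R U ->
     exists U', is_series (fun k => Cmod (c k * Cpow (w - z) k)) U').
  { intros c U HU.
    destruct (is_series_R_le (fun k => Cmod (c k * Cpow (w - z) k)) (fun k => Cmod (c k) * r ^ k)%R U)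
      as [U' [_ HU']]; [|exact HU|exists U'; exact HU'].
    intros n. split; [apply Cmod_ge_0 | apply term_le, Hw]. }
  destruct (D _ _ H2) as [U HU]. destruct (D _ _ H2') as [U' HU'].
  apply (C_is_series_mult _ _ _ _ U U'); auto.
Qed.

(** Completeness of the algebra: the [k]-th coefficient of the sum is the sum of the [k]-th
    coefficients. Fubini is used twice, on the norms to bound the new coefficients (recovered
    through division by [r ^ k], whence [0 < r]), then at each point [w] to identify the sum. *)
Lemma wiener_series z r (M : nat -> R) T (f : nat -> C -> C) F :
  (0 < r)%R -> (forall n, wiener z r (M n) (f n)) -> is_series M T ->
  (forall w, (Cmod (w - z) <= r)%R -> C_is_series (fun n => f n w) (F w)) ->
  wiener z r T F.
Proof.
intros Hr Hf HM HF.
assert (Hp : forall n, (0 < r ^ n)%R) by (intros n; apply pow_lt, Hr).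
destruct (choice_fun _ Hf) as [a Ha].
destruct (choice_fun _ Ha) as [U HU].
assert (U0 : forall n, (0 <= U n)%R).
{ intros n. destruct (HU n) as (_ & h & _).
  revert h. apply is_series_nonneg. intros k. apply Rmult_le_pos; [apply Cmod_ge_0 | left; apply Hp]. }
destruct (is_series_R_le U M T) as [T' [HT1 HT2]]; [|exact HM|].
{ intros n. split; [apply U0 | apply HU]. }
set (B := fun n k => (Cmod (a n k) * r ^ k)%R).
assert (HB0 : forall n k, (0 <= B n k)%R)
  by (intros n k; apply Rmult_le_pos; [apply Cmod_ge_0 | left; apply Hp]).
destruct (is_series_fubini_nonneg B U T' HB0) as [S [HS1 HS2]]; [apply HU | exact HT2|].
assert (Hcol : forall k, C_is_series (fun n => a n k) (Csum (fun n => a n k)) /\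
   (Cmod (Csum (fun n => a n k)) <= / r ^ k * S k)%R).
{ intros k. apply (C_is_series_dominated _ (fun n => / r ^ k * B n k)%R).
  - intros n. unfold B. apply Req_le. field. apply Rgt_not_eq, Hp.
  - apply (is_series_scal (K := R_AbsRing) (V := R_NormedModule) (/ r ^ k)%R), HS1. }
destruct (is_series_R_le (fun k => Cmod (Csum (fun n => a n k)) * r ^ k)%R S T') as [T'' [HT3 HT4]].
- intros k. split; [apply Rmult_le_pos; [apply Cmod_ge_0 | left; apply Hp]|].
  destruct (Hcol k) as [_ h]. apply (Rmult_le_compat_r (r ^ k)) in h; [|left; apply Hp].
  replace (/ r ^ k * S k * r ^ k)%R with (S k) in h by (field; apply Rgt_not_eq, Hp).
  exact h.
- exact HS2.
- exists (fun k => Csum (fun n => a n k)), T''. split; [lra|]. split; [exact HT4|].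
  intros w Hw.
  destruct (C_series_fubini_rows (fun n k => a n k * Cpow (w - z) k) B U T' (fun n => f n w) (F w))
    as [_ h].
  + intros n k. apply term_le, Hw.
  + apply HU.
  + exact HT2.
  + intros n. apply HU, Hw.
  + apply HF, Hw.
  + revert h. apply C_is_series_ext. intros k. apply Csum_unique.
    rewrite Cmult_comm.
    apply (C_is_series_ext (fun n => Cpow (w - z) k * a n k)); [intros; ring|].
    apply C_is_series_scal, Hcol.
Qed.

Lemma wiener_shift z r : (0 < r)%R -> wiener z r r (fun w => w - z).
Proof.
intros Hr.
exists (fun k => match k with 1%nat => RtoC 1 | _ => RtoC 0 end), r. split; [lra|]. split.
- set (u := fun k => (Cmod (match k with 1%nat => RtoC 1 | _ => RtoC 0 end) * r ^ k)%R).
  assert (h : is_series (fun k => u (S k)) (u 1%nat)).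
  { apply (is_series_head (fun k => u (S k))). intros n. unfold u. rewrite Cmod_0. ring. }
  apply (is_series_decr_1 u). eapply eq_ind; [exact h|].
  unfold u, plus, opp; cbn. rewrite Cmod_0, Cmod_1. ring.
- intros w _.
  set (u := fun k => match k with 1%nat => RtoC 1 | _ => RtoC 0 end * Cpow (w - z) k).
  replace (w - z) with (u 0%nat + (u 1%nat)) by (unfold u; cbn; ring).
  apply C_is_series_S. apply (C_is_series_head (fun k => u (S k))).
  intros n. unfold u. ring.
Qed.

Lemma wiener_pow z r M f k :
  (0 <= r)%R -> wiener z r M f -> wiener z r (M ^ k) (fun w => Cpow (f w) k).
Proof.
intros Hr Hf. induction k as [|k IH].
- eapply wiener_le; [|exact (wiener_const z r 1)]. rewrite Cmod_1. cbn. lra.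
- cbn. apply wiener_mult; assumption.
Qed.

(** * Analytic functions *)

Lemma pow_n_Cpow (h : C) k : pow_n (K := C_Ring) h k = Cpow h k.
Proof. induction k as [|k IH]; [reflexivity|]. cbn. rewrite IH. reflexivity. Qed.

Lemma C_is_pseries_alt (a : nat -> C) h l :
  C_is_pseries a h l <-> C_is_series (fun k => a k * Cpow h k) l.
Proof.
unfold C_is_pseries, is_pseries, C_is_series.
assert (E : forall k, scal (K := C_AbsRing) (V := C_NormedModule) (pow_n (K := C_AbsRing) h k) (a k)
    = a k * Cpow h k) by (intros k; rewrite <- (pow_n_Cpow h k); apply Cmult_comm).
split; apply is_series_ext; intros k; [|symmetry]; apply E.
Qed.

Lemma is_series_geom (q : R) : (0 <= q < 1)%R -> is_series (fun n => q ^ n)%R (/ (1 - q))%R.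
Proof. intros H. apply Series.is_series_geom. rewrite Rabs_pos_eq; lra. Qed.

Lemma eventually_bounded (x : nat -> R) B K :
  (forall k, (K <= k)%nat -> (x k <= B)%R) -> exists M, (0 <= M)%R /\ forall k, (x k <= M)%R.
Proof.
intros H. assert (F : exists M, forall n, (n <= K)%nat -> (x n <= M)%R).
{ clear H. induction K as [|K [M HM]].
  - exists (x 0%nat). intros n Hn. replace n with 0%nat by lia. lra.
  - exists (Rmax M (x (S K))). intros n Hn. destruct (Nat.eq_dec n (S K)) as [->|E].
    + apply Rmax_r.
    + eapply Rle_trans; [apply HM; lia | apply Rmax_l]. }
destruct F as [M HM]. exists (Rmax 0 (Rmax M B)). split; [apply Rmax_l|]. intros k.
eapply Rle_trans; [|apply Rmax_r].
destruct (le_lt_dec k K) as [h|h].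
- eapply Rle_trans; [apply HM, h | apply Rmax_l].
- eapply Rle_trans; [apply H; lia | apply Rmax_r].
Qed.

Lemma C_is_series_terms_bounded u l :
  C_is_series u l -> exists M, forall n, (Cmod (u n) <= M)%R.
Proof.
intros H. destruct (proj1 (C_is_series_eps _ _) H 1%R Rlt_0_1) as [N HN].
destruct (eventually_bounded (fun n => Cmod (u n)) 2 (S N)) as [M [_ HM]]; [|exists M; exact HM].
intros [|n] Hn; [lia|].
assert (h1 := HN n ltac:(lia)). assert (h2 := HN (S n) ltac:(lia)).
rewrite sum_Sn in h2.
change (plus (csum_n u n) (u (S n))) with (csum_n u n + u (S n)) in h2.
replace (u (S n)) with ((csum_n u n + u (S n) - l) - (csum_n u n - l)) by ring.
eapply Rle_trans; [apply Cmod_triangle|]. rewrite Cmod_opp. lra.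
Qed.

Lemma Cmod_RtoC_pos x : (0 <= x)%R -> Cmod (RtoC x) = x.
Proof. intros H. rewrite Cmod_R. apply Rabs_pos_eq, H. Qed.

(** Convergence at one point at distance r/2 bounds the terms there; at radius r/4 they are then
    dominated by a geometric series of ratio 1/2. *)
Lemma analytic_at_wiener f z :
  analytic_at f z <-> exists r M, (0 < r)%R /\ wiener z r M f.
Proof.
split.
- intros (a & r & Hr & H).
  assert (H1 := H (z + RtoC (r / 2))).
  replace (z + RtoC (r / 2) - z) with (RtoC (r / 2)) in H1 by ring.
  rewrite Cmod_RtoC_pos in H1 by lra.
  specialize (H1 ltac:(lra)). apply C_is_pseries_alt, C_is_series_terms_bounded in H1.
  destruct H1 as [M HM].
  assert (M0 : (0 <= M)%R) by (eapply Rle_trans; [apply Cmod_ge_0 | apply (HM 0%nat)]).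
  destruct (is_series_R_le (fun k => Cmod (a k) * (r / 4) ^ k)%R (fun k => M * (/2) ^ k)%R
     (M * / (1 - / 2))%R) as [T [HT1 HT2]].
  + intros k. split; [apply Rmult_le_pos; [apply Cmod_ge_0 | apply pow_le; lra]|].
    replace (r / 4)%R with (r / 2 * / 2)%R by field. rewrite Rpow_mult_distr, <- Rmult_assoc.
    apply Rmult_le_compat_r; [apply pow_le; lra|].
    specialize (HM k). rewrite Cmod_mult, Cmod_pow, Cmod_RtoC_pos in HM by lra. exact HM.
  + apply (is_series_scal (K := R_AbsRing) (V := R_NormedModule)), is_series_geom. lra.
  + exists (r / 4)%R, T. split; [lra|]. exists a, T. split; [lra|]. split; [exact HT2|].
    intros w Hw. apply C_is_pseries_alt, H. lra.
- intros (r & M & Hr & (a & T & _ & _ & H)). exists a, r. split; [exact Hr|].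
  intros w Hw. apply C_is_pseries_alt, H. lra.
Qed.

Lemma wiener_restrict z r r' M f :
  (0 <= r' <= r)%R -> wiener z r M f -> wiener z r' M f.
Proof.
intros Hr (a & T & H1 & H2 & H3).
destruct (is_series_R_le (fun k => Cmod (a k) * r' ^ k)%R (fun k => Cmod (a k) * r ^ k)%R T)
  as [T' [h1 h2]]; [|exact H2|].
- intros k. split; [apply Rmult_le_pos; [apply Cmod_ge_0 | apply pow_le; lra]|].
  apply Rmult_le_compat_l; [apply Cmod_ge_0 | apply pow_incr; lra].
- exists a, T'. split; [lra|]. split; [exact h2|]. intros w Hw. apply H3. lra.
Qed.

Lemma analytic_at_ext f g z :
  (exists r, (0 < r)%R /\ forall w, (Cmod (w - z) < r)%R -> f w = g w) ->
  analytic_at f z -> analytic_at g z.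
Proof.
intros (r & Hr & H) (a & r' & Hr' & Ha).
exists a, (Rmin r r'). split; [apply Rmin_glb_lt; assumption|].
intros w Hw. rewrite <- H.
- apply Ha. eapply Rlt_le_trans; [exact Hw | apply Rmin_r].
- eapply Rlt_le_trans; [exact Hw | apply Rmin_l].
Qed.

Lemma analytic_at_plus f g z :
  analytic_at f z -> analytic_at g z -> analytic_at (fun w => f w + g w) z.
Proof.
rewrite !analytic_at_wiener. intros (r & M & Hr & Hf) (r' & M' & Hr' & Hg).
assert (0 < Rmin r r')%R by (apply Rmin_glb_lt; assumption).
assert (h1 := Rmin_l r r'). assert (h2 := Rmin_r r r').
exists (Rmin r r'), (M + M')%R. split; [assumption|].
apply wiener_plus; [lra| |]; eapply wiener_restrict; try eassumption; lra.
Qed.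

Lemma analytic_at_mult f g z :
  analytic_at f z -> analytic_at g z -> analytic_at (fun w => f w * g w) z.
Proof.
rewrite !analytic_at_wiener. intros (r & M & Hr & Hf) (r' & M' & Hr' & Hg).
assert (0 < Rmin r r')%R by (apply Rmin_glb_lt; assumption).
assert (h1 := Rmin_l r r'). assert (h2 := Rmin_r r r').
exists (Rmin r r'), (M * M')%R. split; [assumption|].
apply wiener_mult; [lra| |]; eapply wiener_restrict; try eassumption; lra.
Qed.

Lemma analytic_at_const c z : analytic_at (fun _ => c) z.
Proof.
apply analytic_at_wiener. exists 1%R, (Cmod c). split; [lra | apply wiener_const].
Qed.

Lemma analytic_at_id z : analytic_at (fun w => w) z.
Proof.
apply (analytic_at_ext (fun w => (w - z) + z)).
- exists 1%R. split; [lra|]. intros w _. ring.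
- apply analytic_at_plus; [|apply analytic_at_const].
  apply analytic_at_wiener. exists 1%R, 1%R. split; [lra | apply wiener_shift; lra].
Qed.

Lemma analytic_at_pow f z k : analytic_at f z -> analytic_at (fun w => Cpow (f w) k) z.
Proof.
intros H. induction k as [|k IH]; cbn.
- apply analytic_at_const.
- apply analytic_at_mult; assumption.
Qed.

Lemma analytic_at_translate f z c : analytic_at f (z + c) -> analytic_at (fun w => f (w + c)) z.
Proof.
intros (a & r & Hr & H). exists a, r. split; [exact Hr|]. intros w Hw.
replace (w - z) with ((w + c) - (z + c)) by ring. apply H.
replace ((w + c) - (z + c)) with (w - z) by ring. exact Hw.
Qed.

Lemma Cpow_mult_l x y k : Cpow (x * y) k = Cpow x k * Cpow y k.
Proof. induction k as [|k IH]; cbn; [ring | rewrite IH; ring]. Qed.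

Lemma analytic_at_scale f z c :
  analytic_at f (c * z) -> analytic_at (fun w => f (c * w)) z.
Proof.
intros (a & r & Hr & H).
assert (0 < Cmod c + 1)%R by (generalize (Cmod_ge_0 c); lra).
exists (fun k => a k * Cpow c k), (r / (Cmod c + 1))%R.
split; [apply Rdiv_lt_0_compat; assumption|]. intros w Hw.
assert (Hc : (Cmod (c * w - c * z) < r)%R).
{ replace (c * w - c * z) with (c * (w - z)) by ring. rewrite Cmod_mult.
  apply Rle_lt_trans with ((Cmod c + 1) * Cmod (w - z))%R.
  - apply Rmult_le_compat_r; [apply Cmod_ge_0 | lra].
  - apply (Rmult_lt_compat_l (Cmod c + 1)) in Hw; [|assumption].
    replace ((Cmod c + 1) * (r / (Cmod c + 1)))%R with r in Hw by (field; lra). exact Hw. }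
specialize (H (c * w) Hc). apply C_is_pseries_alt in H. apply C_is_pseries_alt.
revert H. apply C_is_series_ext. intros k.
replace (c * w - c * z) with (c * (w - z)) by ring. rewrite Cpow_mult_l. ring.
Qed.

(** Dropping [k] zero coefficients divides the norm by [r ^ k], so the quotient stays in the
    algebra. Its value at the center is what makes it nonzero when [a k] is the first nonzero
    coefficient. *)
Lemma wiener_factor z r T (a : nat -> C) f k :
  (0 < r)%R -> is_series (fun n => Cmod (a n) * r ^ n)%R T ->
  (forall w, (Cmod (w - z) <= r)%R -> C_is_series (fun n => a n * Cpow (w - z) n) (f w)) ->
  (forall n, (n < k)%nat -> a n = 0) ->
  exists g M, wiener z r M g /\ g z = a k /\
    forall w, (Cmod (w - z) <= r)%R -> f w = Cpow (w - z) k * g w.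
Proof.
intros Hr HT Hf Ha.
assert (Hp : forall n, (0 < r ^ n)%R) by (intros n; apply pow_lt, Hr).
assert (E : ex_series (fun n => Cmod (a (k + n)%nat) * r ^ n)%R).
{ apply (ex_series_ext (fun n => scal (/ r ^ k)%R (Cmod (a (k + n)%nat) * r ^ (k + n)))%R).
  - intros n. unfold scal; cbn. unfold mult; cbn. rewrite pow_add. field. apply Rgt_not_eq, Hp.
  - apply (ex_series_scal (K := R_AbsRing) (V := R_NormedModule)).
    apply (ex_series_incr_n (fun n => Cmod (a n) * r ^ n)%R). exists T. exact HT. }
set (g := fun w => Csum (fun n => a (k + n)%nat * Cpow (w - z) n)).
destruct E as [M HM].
assert (Hg : forall w, (Cmod (w - z) <= r)%R -> C_is_series (fun n => a (k + n)%nat * Cpow (w - z) n) (g w)).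
{ intros w Hw.
  refine (proj1 (C_is_series_dominated _ _ M (fun n => term_le (a (k + n)%nat) _ r n Hw) HM)). }
exists g, M. split; [exists (fun n => a (k + n)%nat), M; split; [lra | split; assumption]|]. split.
- apply Csum_unique.
  assert (h := C_is_series_head (fun n => a (k + n)%nat * Cpow (z - z) n)).
  cbn in h. rewrite Nat.add_0_r, Cmult_1_r in h. apply h. intros n. ring.
- intros w Hw. specialize (Hf w Hw). specialize (Hg w Hw).
  apply (C_is_series_unique _ _ _ Hf).
  apply (C_is_series_scal (Cpow (w - z) k)) in Hg. clear -Hg Ha.
  (* The zero terms are put back one at a time: stage [j] starts the series at index [k - j]. *)
  assert (D : forall j, (j <= k)%nat -> C_is_series (fun n => a (k - j + n)%nat * Cpow (w - z) (k - j + n)) (Cpow (w - z) k * g w)).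
  { induction j as [|j IH]; intros Hj.
    - revert Hg. apply C_is_series_ext. intros n. rewrite Nat.sub_0_r, Cpow_add. ring.
    - specialize (IH ltac:(lia)).
      set (u := fun n => a (k - S j + n)%nat * Cpow (w - z) (k - S j + n)).
      replace (Cpow (w - z) k * g w) with (u 0%nat + Cpow (w - z) k * g w).
      + apply C_is_series_S. revert IH. apply C_is_series_ext. intros n. unfold u.
        replace (k - S j + S n)%nat with (k - j + n)%nat by lia. reflexivity.
      + unfold u. rewrite Ha by lia. ring. }
  specialize (D k (Nat.le_refl _)). rewrite Nat.sub_diag in D. exact D.
Qed.

(** Once the constant coefficient is removed, every term gains a factor |w - z| / r over its bound
    on the full disc. *)
Lemma wiener_lipschitz z r M f :
  (0 < r)%R -> wiener z r M f ->
  forall w, (Cmod (w - z) <= r)%R -> (Cmod (f w - f z) <= Cmod (w - z) * (M + Cmod (f z)) / r)%R.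
Proof.
intros Hr Hf w Hw.
assert (Hs : wiener z r (M + Cmod (f z)) (fun w => f w + - f z)).
{ apply wiener_plus; [lra | exact Hf|].
  eapply wiener_le; [|apply wiener_const]. rewrite Cmod_opp. lra. }
destruct Hs as (a & T & H1 & H2 & H3).
assert (a0 : a 0%nat = 0).
{ assert (Hz : (Cmod (z - z) <= r)%R) by (unfold Cminus; rewrite Cplus_opp_r, Cmod_0; lra).
  specialize (H3 z Hz).
  assert (h := C_is_series_head (fun n => a n * Cpow (z - z) n)).
  cbn in h. rewrite Cmult_1_r in h.
  rewrite <- (C_is_series_unique _ _ _ H3 (h ltac:(intros n; ring))). ring. }
destruct (C_is_series_dominated (fun n => a n * Cpow (w - z) n)
   (fun n => Cmod (w - z) / r * (Cmod (a n) * r ^ n))%R (Cmod (w - z) / r * T)%R) as [h1 h2].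
- intros [|n].
  + rewrite a0, Cmult_0_l, !Cmod_0. lra.
  + rewrite Cmod_mult, Cmod_pow. cbn.
    replace (Cmod (w - z) / r * (Cmod (a (S n)) * (r * r ^ n)))%R
      with (Cmod (a (S n)) * (Cmod (w - z) * r ^ n))%R by (field; lra).
    apply Rmult_le_compat_l; [apply Cmod_ge_0|]. apply Rmult_le_compat_l; [apply Cmod_ge_0|].
    apply pow_incr. split; [apply Cmod_ge_0 | exact Hw].
- apply (is_series_scal (K := R_AbsRing) (V := R_NormedModule)), H2.
- change (f w - f z) with (f w + - f z). rewrite (C_is_series_unique _ _ _ (H3 w Hw) h1).
  eapply Rle_trans; [exact h2|]. unfold Rdiv. rewrite !Rmult_assoc.
  apply Rmult_le_compat_l; [apply Cmod_ge_0|]. rewrite (Rmult_comm _ (/ r)).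
  apply Rmult_le_compat_l; [left; apply Rinv_0_lt_compat, Hr | exact H1].
Qed.

Lemma analytic_at_continuous f z :
  analytic_at f z -> forall eps, (0 < eps)%R ->
  exists r, (0 < r)%R /\ forall w, (Cmod (w - z) < r)%R -> (Cmod (f w - f z) < eps)%R.
Proof.
rewrite analytic_at_wiener. intros (r & M & Hr & Hf) eps Heps.
assert (HM : (0 <= M)%R).
{ eapply Rle_trans; [|apply (wiener_bound z r M f z Hf)]; [apply Cmod_ge_0|].
  unfold Cminus; rewrite Cplus_opp_r, Cmod_0; lra. }
set (L := (M + Cmod (f z) + 1)%R).
assert (HL : (0 < L)%R) by (unfold L; generalize (Cmod_ge_0 (f z)); lra).
exists (Rmin r (eps * r / L)). split.
- apply Rmin_glb_lt; [exact Hr|]. apply Rdiv_lt_0_compat; [apply Rmult_lt_0_compat; assumption | exact HL].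
- intros w Hw. assert (h1 := Rmin_l r (eps * r / L)). assert (h2 := Rmin_r r (eps * r / L)).
  eapply Rle_lt_trans; [apply (wiener_lipschitz z r M f Hr Hf); lra|].
  apply Rle_lt_trans with (Cmod (w - z) * L / r)%R.
  + apply Rmult_le_compat_r; [left; apply Rinv_0_lt_compat, Hr|].
    apply Rmult_le_compat_l; [apply Cmod_ge_0 | unfold L; lra].
  + apply (Rmult_lt_reg_r (r / L)).
    * apply Rdiv_lt_0_compat; assumption.
    * replace (Cmod (w - z) * L / r * (r / L))%R with (Cmod (w - z)) by (field; lra).
      unfold Rdiv in *. rewrite <- Rmult_assoc. lra.
Qed.

Lemma analytic_at_nonzero f z :
  analytic_at f z -> f z <> 0 ->
  exists r, (0 < r)%R /\ forall w, (Cmod (w - z) < r)%R -> f w <> 0.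
Proof.
intros Hf Hz. destruct (analytic_at_continuous f z Hf (Cmod (f z))) as [r [Hr H]].
- apply Cmod_gt_0, Hz.
- exists r. split; [exact Hr|]. intros w Hw E. specialize (H w Hw). rewrite E in H.
  replace (0 - f z) with (- f z) in H by ring. rewrite Cmod_opp in H. lra.
Qed.

(** The alternative is whether all Taylor coefficients vanish; if not, the least index of a nonzero
    one is the order of the zero. *)
Lemma analytic_at_factor f z :
  analytic_at f z ->
  (exists r, (0 < r)%R /\ forall w, (Cmod (w - z) < r)%R -> f w = 0) \/
  (exists k g r, (0 < r)%R /\ analytic_at g z /\ g z <> 0 /\
     forall w, (Cmod (w - z) < r)%R -> f w = Cpow (w - z) k * g w).
Proof.
rewrite analytic_at_wiener. intros (r & M & Hr & (a & T & H1 & H2 & H3)).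
destruct (classic (exists n, a n <> 0)) as [E|E].
- right. destruct (dec_inh_nat_subset_has_unique_least_element (fun n => a n <> 0)
    (fun n => classic _) E) as [k [[Hk1 Hk2] _]].
  destruct (wiener_factor z r T a f k Hr H2 H3) as (g & M' & Hg & Hgz & Hfg).
  + intros n Hn. apply NNPP. intros h. apply Hk2 in h. lia.
  + exists k, g, r. split; [exact Hr|]. split; [apply analytic_at_wiener; eauto|].
    split; [rewrite Hgz; exact Hk1|]. intros w Hw. apply Hfg. lra.
- left. exists r. split; [exact Hr|]. intros w Hw.
  apply (C_is_series_unique _ _ _ (H3 w ltac:(lra))).
  apply (C_is_series_ext (fun _ => 0)); [|apply C_is_series_0].
  intros n. replace (a n) with (RtoC 0); [ring|]. symmetry. apply NNPP. intros h. apply E. eauto.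
Qed.

(** Without a constant term, every weight shrinks at least by the factor r'/r. This brings a norm
    below 1, as the Neumann series requires. *)
Lemma wiener_small z r r' M f :
  (0 <= r' <= r)%R -> (0 < r)%R -> wiener z r M f -> f z = 0 -> wiener z r' (r' / r * M) f.
Proof.
intros Hr' Hr (a & T & H1 & H2 & H3) Hz.
assert (a0 : a 0%nat = 0).
{ assert (Hzz : (Cmod (z - z) <= r)%R) by (unfold Cminus; rewrite Cplus_opp_r, Cmod_0; lra).
  specialize (H3 z Hzz). rewrite Hz in H3.
  assert (h := C_is_series_head (fun n => a n * Cpow (z - z) n)).
  cbn in h. rewrite Cmult_1_r in h.
  symmetry. apply (C_is_series_unique _ _ _ H3), h. intros n. ring. }
assert (0 <= r' / r)%R by (apply Rdiv_le_0_compat; lra).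
destruct (is_series_R_le (fun k => Cmod (a k) * r' ^ k)%R
   (fun k => r' / r * (Cmod (a k) * r ^ k))%R (r' / r * T)%R) as [T' [h1 h2]].
- intros k. split; [apply Rmult_le_pos; [apply Cmod_ge_0 | apply pow_le; lra]|].
  destruct k as [|k]; [rewrite a0, Cmod_0; lra|]. cbn.
  replace (r' / r * (Cmod (a (S k)) * (r * r ^ k)))%R
    with (Cmod (a (S k)) * (r' * r ^ k))%R by (field; lra).
  apply Rmult_le_compat_l; [apply Cmod_ge_0|]. apply Rmult_le_compat_l; [lra|].
  apply pow_incr; lra.
- apply (is_series_scal (K := R_AbsRing) (V := R_NormedModule)), H2.
- exists a, T'. split; [nra|]. split; [exact h2|]. intros w Hw. apply H3. lra.
Qed.

Lemma C_is_series_geom q : (Cmod q < 1)%R -> C_is_series (fun n => Cpow q n) (/ (1 - q)).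
Proof.
intros Hq.
assert (Hq1 : 1 - q <> 0).
{ intros E. assert (q = 1) by (replace q with (1 - (1 - q)) by ring; rewrite E; ring).
  subst q. rewrite Cmod_1 in Hq. lra. }
assert (E : forall n, csum_n (fun n => Cpow q n) n - / (1 - q) = - / (1 - q) * Cpow q (S n)).
{ induction n as [|n IH].
  - rewrite sum_O. cbn. field. exact Hq1.
  - rewrite sum_Sn. change (plus ?x ?y) with (x + y).
    transitivity (csum_n (fun n => Cpow q n) n - / (1 - q) + Cpow q (S n)); [ring|].
    rewrite IH. cbn. field. exact Hq1. }
apply C_is_series_eps. intros eps Heps.
set (c := Cmod (- / (1 - q))).
assert (Hc := Cmod_ge_0 (- / (1 - q))). fold c in Hc.
destruct (pow_lt_1_zero (Cmod q) ltac:(rewrite Rabs_pos_eq; [exact Hq | apply Cmod_ge_0]) (eps / (c + 1))%R) as [N HN].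
{ apply Rdiv_lt_0_compat; lra. }
exists N. intros n Hn. rewrite E, Cmod_mult, Cmod_pow. fold c.
specialize (HN (S n) ltac:(lia)). rewrite Rabs_pos_eq in HN by apply pow_le, Cmod_ge_0.
apply Rle_lt_trans with ((c + 1) * Cmod q ^ S n)%R.
- apply Rmult_le_compat_r; [apply pow_le, Cmod_ge_0 | lra].
- apply (Rmult_lt_compat_l (c + 1)) in HN; [|lra].
  replace ((c + 1) * (eps / (c + 1)))%R with eps in HN by (field; lra). exact HN.
Qed.

Lemma wiener_inv_one_minus z r q g :
  (0 < r)%R -> (0 <= q < 1)%R -> wiener z r q g -> wiener z r (/ (1 - q)) (fun w => / (1 - g w)).
Proof.
intros Hr Hq Hg.
apply (wiener_series z r (fun n => q ^ n)%R _ (fun n w => Cpow (g w) n)).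
- exact Hr.
- intros n. apply wiener_pow; [lra | exact Hg].
- apply is_series_geom, Hq.
- intros w Hw. apply C_is_series_geom.
  apply Rle_lt_trans with q; [apply (wiener_bound z r q g w Hg Hw) | lra].
Qed.

(** The function g = 1 - f / f(z) vanishes at [z], so its norm is small on a small disc, and 1/f =
    (1/f(z)) / (1 - g) is given there by the Neumann series. *)
Lemma analytic_at_inv f z : analytic_at f z -> f z <> 0 -> analytic_at (fun w => / f w) z.
Proof.
intros Hf Hz.
assert (Hg : analytic_at (fun w => 1 + - / f z * f w) z).
{ apply analytic_at_plus; [apply analytic_at_const|].
  apply analytic_at_mult; [apply analytic_at_const | exact Hf]. }
apply analytic_at_wiener in Hg. destruct Hg as (r & M & Hr & Hg).
assert (Hg0 : 1 + - / f z * f z = 0) by (field; exact Hz).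
assert (HM : (0 <= M)%R).
{ eapply Rle_trans; [|apply (wiener_bound z r M _ z Hg)]; [apply Cmod_ge_0|].
  unfold Cminus; rewrite Cplus_opp_r, Cmod_0; lra. }
(* Chosen so that the norm r'/r M = M / (2 (M + 1)) is at most 1/2. *)
set (r' := (r / (2 * (M + 1)))%R).
assert (Hr' : (0 < r' <= r)%R).
{ unfold r'. split; [apply Rdiv_lt_0_compat; lra|].
  apply (Rmult_le_reg_r (2 * (M + 1))); [lra|].
  unfold Rdiv. rewrite Rmult_assoc, Rinv_l by lra. nra. }
assert (Hw := wiener_small z r r' M _ ltac:(lra) Hr Hg Hg0).
assert (Hq : (r' / r * M <= / 2)%R).
{ unfold r'. apply (Rmult_le_reg_r (2 * (M + 1))); [lra|].
  replace (r / (2 * (M + 1)) / r * M * (2 * (M + 1)))%R with M by (field; lra). lra. }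
apply (wiener_le _ _ _ (/ 2) _ Hq), wiener_inv_one_minus in Hw; [|lra|lra].
apply (analytic_at_ext (fun w => / f z * / (1 - (1 + - / f z * f w)))).
- destruct (analytic_at_nonzero f z Hf Hz) as [s [Hs H]]. exists s. split; [exact Hs|].
  intros w hw. specialize (H w hw). replace (1 - (1 + - / f z * f w)) with (/ f z * f w) by ring.
  field. split; assumption.
- apply analytic_at_mult; [apply analytic_at_const|]. apply analytic_at_wiener.
  exists r', (/ (1 - / 2))%R. split; [lra | exact Hw].
Qed.

Lemma analytic_at_sum_n (f : nat -> C -> C) m n z :
  (forall k, (m <= k <= n)%nat -> analytic_at (f k) z) ->
  analytic_at (fun w => sum_n_m (G := C_AbelianGroup) (fun k => f k w) m n) z.
Proof.
revert f. induction n as [|n IH]; intros f H.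
- destruct m as [|m].
  + apply (analytic_at_ext (f 0%nat)); [|apply H; lia].
    exists 1%R. split; [lra|]. intros w _. rewrite sum_n_n. reflexivity.
  + apply (analytic_at_ext (fun _ => 0)); [|apply analytic_at_const].
    exists 1%R. split; [lra|]. intros w _. rewrite sum_n_m_zero by lia. reflexivity.
- destruct (le_lt_dec m (S n)) as [h|h].
  + apply (analytic_at_ext (fun w => sum_n_m (G := C_AbelianGroup) (fun k => f k w) m n + f (S n) w)).
    * exists 1%R. split; [lra|]. intros w _. rewrite sum_n_Sm by exact h. reflexivity.
    * apply analytic_at_plus; [apply IH; intros; apply H; lia | apply H; lia].
  + apply (analytic_at_ext (fun _ => 0)); [|apply analytic_at_const].
    exists 1%R. split; [lra|]. intros w _. rewrite sum_n_m_zero by lia. reflexivity.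
Qed.

Lemma Cpow_neq_0 (x : C) k : x <> 0 -> Cpow x k <> 0.
Proof.
intros Hx. induction k as [|k IH]; cbn.
- intros E. apply (f_equal fst) in E. cbn in E. lra.
- exact (Cmult_neq_0 _ _ Hx IH).
Qed.

(* At the supremum of the initial part of the segment on which [f] vanishes,
   the power series of [f] has zeros accumulating at its center. *)
Lemma analytic_identity_segment f z0 z1 d :
  (0 < d)%R ->
  (forall u, (0 <= u <= 1)%R -> analytic_at f (z0 + RtoC u * (z1 - z0))) ->
  (forall u, (0 <= u < d)%R -> f (z0 + RtoC u * (z1 - z0)) = 0) ->
  f z1 = 0.
Proof.
intros Hd Han Hz.
destruct (Ceq_dec z0 z1) as [->|Hne].
{ specialize (Hz 0%R ltac:(lra)). replace (z1 + 0 * (z1 - z1)) with z1 in Hz by ring. exact Hz. }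
set (p := fun u => z0 + RtoC u * (z1 - z0)) in *.
assert (Hl : (0 < Cmod (z1 - z0))%R).
{ apply Cmod_gt_0. intros E. apply Hne. replace z1 with (z0 + (z1 - z0)) by ring. rewrite E. ring. }
assert (Hp : forall u v, Cmod (p u - p v) = (Rabs (u - v) * Cmod (z1 - z0))%R).
{ intros u v. unfold p.
  replace (z0 + u * (z1 - z0) - (z0 + v * (z1 - z0))) with (RtoC (u - v) * (z1 - z0))
    by (rewrite RtoC_minus; ring).
  rewrite Cmod_mult, Cmod_R. reflexivity. }
set (E := fun u => (0 <= u <= 1)%R /\ forall v, (0 <= v < u)%R -> f (p v) = 0).
destruct (completeness E) as [t [Ht1 Ht2]].
{ exists 1%R. intros u [H _]. lra. }
{ exists 0%R. split; [lra|]. intros v Hv. lra. }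
assert (Hdt : (Rmin d 1 <= t)%R).
{ apply Ht1. split; [split; [apply Rmin_glb; lra | apply Rmin_r]|].
  intros v Hv. apply Hz. generalize (Rmin_l d 1). lra. }
assert (Ht0 : (0 < t)%R) by (generalize (Rmin_glb_lt d 1 0 Hd Rlt_0_1); lra).
assert (Hta : (t <= 1)%R) by (apply Ht2; intros u [H _]; lra).
assert (Htz : forall v, (0 <= v < t)%R -> f (p v) = 0).
{ intros v Hv. apply NNPP. intros h. apply (Rlt_not_le t v); [lra|]. apply Ht2.
  intros u [Hu1 Hu2]. apply Rnot_lt_le. intros Hvu. apply h, Hu2. lra. }
(* If [f] vanishes near [p t], the vanishing goes on past [t], so maximality leaves only [t = 1],
   where [p t] is [z1]. If [p t] is at most an isolated zero, this contradicts the zeros just before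
   [t]. *)
destruct (analytic_at_factor f (p t) (Han t ltac:(lra))) as [(r & Hr & H)|(k & g & r & Hr & Hg & Hg0 & H)].
- set (e := (r / 2 / Cmod (z1 - z0))%R).
  assert (He : (0 < e)%R) by (unfold e; apply Rdiv_lt_0_compat; lra).
  assert (Hext : forall v, (Rabs (v - t) <= e)%R -> f (p v) = 0).
  { intros v Hv. apply H. rewrite Hp. apply (Rmult_le_compat_r (Cmod (z1 - z0))) in Hv; [|lra].
    unfold e in Hv. replace (r / 2 / Cmod (z1 - z0) * Cmod (z1 - z0))%R with (r / 2)%R in Hv
      by (field; lra). lra. }
  destruct (Req_dec t 1) as [->|Ht].
  + specialize (Hext 1%R). replace (p 1%R) with z1 in Hext by (unfold p; ring).
    apply Hext. rewrite Rminus_diag, Rabs_R0. lra.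
  + exfalso. set (u := Rmin 1 (t + e)).
    assert (Hu1 : (u <= 1)%R) by apply Rmin_l. assert (Hu2 : (u <= t + e)%R) by apply Rmin_r.
    assert (Hu3 : (t < u)%R) by (apply Rmin_glb_lt; lra).
    apply (Rlt_not_le u t Hu3). apply Ht1. split; [lra|]. intros v Hv.
    destruct (Rlt_dec v t) as [h|h]; [apply Htz; lra|].
    apply Hext. rewrite Rabs_pos_eq; lra.
- exfalso. destruct (analytic_at_nonzero g (p t) Hg Hg0) as [s [Hs Hgs]].
  set (e := (Rmin r s / 2 / Cmod (z1 - z0))%R).
  assert (Hrs : (0 < Rmin r s)%R) by (apply Rmin_glb_lt; assumption).
  assert (He : (0 < e)%R) by (unfold e; apply Rdiv_lt_0_compat; lra).
  set (v := Rmax 0 (t - e)).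
  assert (Hv1 : (0 <= v)%R) by apply Rmax_l. assert (Hv2 : (t - e <= v)%R) by apply Rmax_r.
  assert (Hv3 : (v < t)%R) by (apply Rmax_lub_lt; lra).
  assert (Hm : (0 < Cmod (p v - p t) < Rmin r s)%R).
  { rewrite Hp, Rabs_minus_sym, Rabs_pos_eq by lra. split; [apply Rmult_lt_0_compat; lra|].
    apply Rle_lt_trans with (e * Cmod (z1 - z0))%R; [apply Rmult_le_compat_r; lra|].
    unfold e. replace (Rmin r s / 2 / Cmod (z1 - z0) * Cmod (z1 - z0))%R with (Rmin r s / 2)%R
      by (field; lra). lra. }
  assert (h1 := Rmin_l r s). assert (h2 := Rmin_r r s).
  specialize (H (p v) ltac:(lra)). rewrite Htz in H by lra.
  apply (Cmult_neq_0 (Cpow (p v - p t) k) (g (p v))).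
  + apply Cpow_neq_0. intros h. rewrite h, Cmod_0 in Hm. lra.
  + apply Hgs. lra.
  + symmetry. exact H.
Qed.

(** * Exponential and binomial series *)

Lemma Cexp_plus x y : Cexp (x + y) = Cexp x * Cexp y.
Proof.
destruct x as [a b], y as [c d]. unfold Cexp; cbn.
rewrite exp_plus, cos_plus, sin_plus. apply injective_projections; cbn; ring.
Qed.

Lemma Cexp_0 : Cexp 0 = 1.
Proof. unfold Cexp; cbn. rewrite exp_0, cos_0, sin_0. apply injective_projections; cbn; ring. Qed.

Lemma Cmod_Cexp z : Cmod (Cexp z) = exp (Re z).
Proof.
unfold Cexp, Cmod; cbn.
replace (exp (Re z) * cos (Im z) * (exp (Re z) * cos (Im z) * 1) +
  exp (Re z) * sin (Im z) * (exp (Re z) * sin (Im z) * 1))%R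
  with ((exp (Re z) * exp (Re z)) * (Rsqr (sin (Im z)) + Rsqr (cos (Im z))))%R
  by (unfold Rsqr; ring).
rewrite sin2_cos2, Rmult_1_r. apply sqrt_square. left; apply exp_pos.
Qed.

Lemma Cexp_RtoC x : Cexp (RtoC x) = RtoC (exp x).
Proof. unfold Cexp; cbn. rewrite cos_0, sin_0. apply injective_projections; cbn; ring. Qed.

(* The linear equation [f' = c l f] with complex [c] and real [l = L'], in
   components. *)
Lemma linear_ode_unique c1 c2 (f1 f2 L l : R -> R) x :
  (0 < x)%R -> L 0%R = 0%R ->
  (forall t, (0 <= t <= x)%R -> is_derive L t (l t)) ->
  (forall t, (0 <= t <= x)%R -> is_derive f1 t (l t * (c1 * f1 t - c2 * f2 t))%R) ->
  (forall t, (0 <= t <= x)%R -> is_derive f2 t (l t * (c1 * f2 t + c2 * f1 t))%R) ->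
  (f1 x, f2 x) = (f1 0%R, f2 0%R) * Cexp ((c1, c2) * RtoC (L x)).
Proof.
intros Hx L0 HL H1 H2.
(* [g1] and [g2] are the real and imaginary parts of f exp(-c L), whose derivative is zero. *)
set (g1 := fun t => (exp (- c1 * L t) * (f1 t * cos (c2 * L t) + f2 t * sin (c2 * L t)))%R).
set (g2 := fun t => (exp (- c1 * L t) * (f2 t * cos (c2 * L t) - f1 t * sin (c2 * L t)))%R).
assert (E1 : g1 0%R = g1 x).
{ apply (eq_is_derive g1); [|exact Hx]. intros t Ht. specialize (HL t Ht). specialize (H1 t Ht). specialize (H2 t Ht).
  unfold g1. evar_last.
  - auto_derive; [|reflexivity]. repeat split; eexists; eassumption.
  - rewrite (is_derive_unique (fun y : R => L y) _ _ HL), (is_derive_unique (fun y : R => f1 y) _ _ H1),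
      (is_derive_unique (fun y : R => f2 y) _ _ H2).
    unfold zero; cbn. ring. }
assert (E2 : g2 0%R = g2 x).
{ apply (eq_is_derive g2); [|exact Hx]. intros t Ht. specialize (HL t Ht). specialize (H1 t Ht). specialize (H2 t Ht).
  unfold g2. evar_last.
  - auto_derive; [|reflexivity]. repeat split; eexists; eassumption.
  - rewrite (is_derive_unique (fun y : R => L y) _ _ HL), (is_derive_unique (fun y : R => f1 y) _ _ H1),
      (is_derive_unique (fun y : R => f2 y) _ _ H2).
    unfold zero; cbn. ring. }
unfold g1, g2 in E1, E2. rewrite L0, !Rmult_0_r, exp_0, cos_0, sin_0 in E1, E2.
unfold Cexp, Re, Im; cbn.
replace (c1 * L x - c2 * 0)%R with (c1 * L x)%R by ring.
replace (c1 * 0 + c2 * L x)%R with (c2 * L x)%R by ring.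
assert (He : (exp (c1 * L x) * exp (- c1 * L x) = 1)%R).
{ rewrite <- exp_plus, <- exp_0. f_equal. ring. }
assert (Hcs := sin2_cos2 (c2 * L x)). unfold Rsqr in Hcs.
set (e := exp (c1 * L x)) in *. set (e' := exp (- c1 * L x)) in *.
set (co := cos (c2 * L x)) in *. set (si := sin (c2 * L x)) in *.
replace (f1 0%R) with (e' * (f1 x * co + f2 x * si))%R by lra.
replace (f2 0%R) with (e' * (f2 x * co - f1 x * si))%R by lra.
unfold Cmult; cbn. apply injective_projections; cbn.
- transitivity ((e * e') * (f1 x * (si * si + co * co)))%R; [rewrite He, Hcs|]; ring.
- transitivity ((e * e') * (f2 x * (si * si + co * co)))%R; [rewrite He, Hcs|]; ring.
Qed.

Lemma CV_radius_summable (u : nat -> R) (v : nat -> R) r T :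
  (forall k, (Rabs (u k) <= v k)%R) -> (0 <= r)%R ->
  is_series (fun k => v k * r ^ k)%R T -> Rbar_le r (CV_radius u).
Proof.
intros Hu Hr HT.
assert (Hp : forall k, (0 <= r ^ k)%R) by (intros k; apply pow_le, Hr).
assert (P : forall k, (0 <= v k * r ^ k)%R).
{ intros k. apply Rmult_le_pos; [|apply Hp]. eapply Rle_trans; [apply Rabs_pos | apply Hu]. }
apply (proj1 (CV_radius_bounded u)). exists T. intros n.
rewrite Rabs_mult, (Rabs_pos_eq (r ^ n)) by apply Hp.
eapply Rle_trans; [apply Rmult_le_compat_r; [apply Hp | apply Hu]|].
eapply Rle_trans; [|apply (sum_n_le_series _ T n P HT)].
destruct n as [|n]; [rewrite sum_O; lra|]. rewrite sum_Sn.
change (v (S n) * r ^ S n <= sum_n (fun k => v k * r ^ k) n + v (S n) * r ^ S n)%R.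
assert (0 <= sum_n (fun k => v k * r ^ k) n)%R; [|lra].
clear -P. induction n as [|n IH]; [rewrite sum_O; apply P|].
rewrite sum_Sn. apply Rplus_le_le_0_compat; [exact IH | apply P].
Qed.

Lemma PSeries_derive_recurrence (u v : nat -> R) e x :
  Rbar_lt (Rabs x) (CV_radius u) ->
  (forall k, INR (S k) * u (S k) + e * (INR k * u k) = v k)%R ->
  ((1 + e * x) * PSeries (PS_derive u) x = PSeries v x)%R.
Proof.
intros Hx H.
assert (Hd : ex_pseries (PS_derive u) x) by (apply ex_pseries_derive, Hx).
replace ((1 + e * x) * PSeries (PS_derive u) x)%R
  with (PSeries (PS_derive u) x + e * (x * PSeries (PS_derive u) x))%R by ring.
rewrite <- PSeries_incr_1, <- PSeries_scal, <- PSeries_plus.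
- apply PSeries_ext. intros [|k]; rewrite <- H; unfold PS_plus, PS_scal, PS_incr_1, PS_derive, plus, scal, zero;
    cbn -[INR]; unfold mult; cbn -[INR]; [rewrite INR_0|]; ring.
- exact Hd.
- apply ex_pseries_scal; [apply Rmult_comm|]. apply ex_pseries_incr_1, Hd.
Qed.

(* The recurrence on the coefficients says that the sum [f] of the power series
   satisfies [(1 + e t) f' = c f]; [e = 0] gives the exponential series, [e = 1]
   the binomial one. *)
Lemma pseries_ode (a : nat -> C) (c : C) (e : R) (L : R -> R) r T x :
  (forall k, RtoC (INR (S k)) * a (S k) + RtoC e * (RtoC (INR k) * a k) = c * a k) ->
  (0 < x < r)%R -> is_series (fun k => Cmod (a k) * r ^ k)%R T ->
  L 0%R = 0%R -> (forall t, (0 <= t <= x)%R -> 1 + e * t <> 0)%R ->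
  (forall t, (0 <= t <= x)%R -> is_derive L t (/ (1 + e * t))%R) ->
  C_is_series (fun k => a k * RtoC (x ^ k)) (a 0%nat * Cexp (c * RtoC (L x))).
Proof.
intros Ha Hx HT L0 He HL.
set (u := fun k => Re (a k)). set (v := fun k => Im (a k)).
assert (Ru : Rbar_le r (CV_radius u)) by (apply (CV_radius_summable u _ r T (fun k => re_le_Cmod _)); [lra | exact HT]).
assert (Rv : Rbar_le r (CV_radius v)) by (apply (CV_radius_summable v _ r T (fun k => im_le_Cmod _)); [lra | exact HT]).
assert (Hin : forall t, (0 <= t <= x)%R -> Rbar_lt (Rabs t) (CV_radius u) /\ Rbar_lt (Rabs t) (CV_radius v)).
{ intros t Ht. rewrite Rabs_pos_eq by lra.
  split; (apply Rbar_lt_le_trans with r; [cbn; lra | assumption]). }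
destruct c as [c1 c2].
assert (Hu : forall k, (INR (S k) * u (S k) + e * (INR k * u k) = c1 * u k - c2 * v k)%R).
{ intros k. assert (h := f_equal Re (Ha k)). cbn -[INR] in h. unfold u, v, Re, Im in *. cbn -[INR] in h. lra. }
assert (Hv : forall k, (INR (S k) * v (S k) + e * (INR k * v k) = c1 * v k + c2 * u k)%R).
{ intros k. assert (h := f_equal Im (Ha k)). cbn -[INR] in h. unfold u, v, Re, Im in *. cbn -[INR] in h. lra. }
assert (Hex : forall t, (0 <= t <= x)%R -> ex_pseries u t /\ ex_pseries v t).
{ intros t Ht. destruct (Hin t Ht). split; apply CV_radius_inside; assumption. }
assert (Sol := linear_ode_unique c1 c2 (PSeries u) (PSeries v) L (fun t => / (1 + e * t))%R x
  ltac:(lra) L0 HL).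
assert (E : forall w, PSeries w 0 = w 0%nat) by (intros w; apply PSeries_0).
rewrite !E in Sol.
apply C_is_series_Re_Im.
replace (a 0%nat) with (u 0%nat, v 0%nat) by (unfold u, v, Re, Im; destruct (a 0%nat); reflexivity).
rewrite <- Sol; clear Sol.
- destruct (Hex x ltac:(lra)) as [h1 h2].
  apply PSeries_correct in h1, h2. unfold is_pseries in h1, h2.
  split; [revert h1 | revert h2]; apply is_series_ext; intros k; rewrite pow_n_pow;
    unfold scal, u, v, Re, Im; cbn; unfold mult; cbn; ring.
- intros t Ht. destruct (Hin t Ht) as [h1 h2], (Hex t Ht) as [h3 h4]. evar_last; [apply is_derive_PSeries, h1|].
  assert (E' : ((1 + e * t) * PSeries (PS_derive u) t = (c1 * PSeries u t - c2 * PSeries v t))%R).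
  { rewrite (PSeries_derive_recurrence u _ e t h1 Hu), <- (PSeries_scal c1), <- (PSeries_scal c2), <- PSeries_minus;
      [|apply ex_pseries_scal; [apply Rmult_comm | assumption] ..].
    apply PSeries_ext. reflexivity. }
  rewrite <- E'. field. apply He, Ht.
- intros t Ht. destruct (Hin t Ht) as [h1 h2], (Hex t Ht) as [h3 h4]. evar_last; [apply is_derive_PSeries, h2|].
  assert (E' : ((1 + e * t) * PSeries (PS_derive v) t = (c1 * PSeries v t + c2 * PSeries u t))%R).
  { rewrite (PSeries_derive_recurrence v _ e t h2 Hv), <- (PSeries_scal c1), <- (PSeries_scal c2), <- PSeries_plus;
      [|apply ex_pseries_scal; [apply Rmult_comm | assumption] ..].
    apply PSeries_ext. reflexivity. }
  rewrite <- E'. field. apply He, Ht.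
Qed.

Lemma is_series_exp x : is_series (fun k => x ^ k / INR (fact k))%R (exp x).
Proof.
generalize (is_exp_Reals x). unfold is_pseries. apply is_series_ext. intros k.
rewrite pow_n_pow. unfold scal; cbn. unfold mult; cbn. reflexivity.
Qed.

Lemma RtoC_neq_0 x : x <> 0%R -> RtoC x <> 0.
Proof. intros H E. apply H. apply (f_equal fst) in E. exact E. Qed.

Lemma INR_fact_neq_0_C k : RtoC (INR (fact k)) <> 0.
Proof. apply RtoC_neq_0, INR_fact_neq_0. Qed.

Lemma Cexp_series z : C_is_series (fun k => Cpow z k / RtoC (INR (fact k))) (Cexp z).
Proof.
set (a := fun k => Cpow z k / RtoC (INR (fact k))).
(* The variable of [pseries_ode] is real, so [z] goes into the coefficients and the variable is set
   to 1; the radius 2 only has to exceed 1. *)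
assert (H : C_is_series (fun k => a k * RtoC (1 ^ k)) (a 0%nat * Cexp (z * RtoC 1))).
{ apply (pseries_ode a z 0 (fun t => t) 2 (exp (Cmod z * 2))).
  - intros k. unfold a. rewrite fact_simpl, mult_INR, RtoC_mult. cbn [Cpow]. field.
    split; [apply INR_fact_neq_0_C | apply RtoC_neq_0, not_0_INR; lia].
  - lra.
  - generalize (is_series_exp (Cmod z * 2)). apply is_series_ext. intros k. unfold a.
    rewrite Cmod_div by apply INR_fact_neq_0_C.
    rewrite Cmod_pow, Cmod_RtoC_pos by apply pos_INR. rewrite Rpow_mult_distr.
    unfold Rdiv. rring.
  - reflexivity.
  - intros; lra.
  - intros t _. evar_last; [apply (is_derive_id (K := R_AbsRing))|]. change (1 = / (1 + 0 * t))%R. field. }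
replace (a 0%nat * Cexp (z * RtoC 1)) with (Cexp z) in H.
- revert H. apply C_is_series_ext. intros k. rewrite pow1. unfold a. ring.
- rewrite Cmult_1_r. unfold a. cbn. field. 
Qed.

(** The norm is computed exactly. For n^(-w) on a disc about [z] it equals n^(-(Re z - r)), again a
    term of a Dirichlet series at a real point, so no convergence is lost. *)
Lemma wiener_Cexp z r c d :
  (0 <= r)%R -> wiener z r (exp (Re (c * z + d) + Cmod c * r)) (fun w => Cexp (c * w + d)).
Proof.
intros Hr.
exists (fun k => Cexp (c * z + d) * (Cpow c k / RtoC (INR (fact k)))), (exp (Re (c * z + d) + Cmod c * r)).
split; [lra|]. split.
- rewrite exp_plus. rewrite <- Cmod_Cexp.
  apply (is_series_ext (fun k => scal (Cmod (Cexp (c * z + d))) ((Cmod c * r) ^ k / INR (fact k)))%R).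
  + intros k. rewrite Cmod_mult, Cmod_div by apply INR_fact_neq_0_C.
    rewrite Cmod_pow, (Cmod_RtoC_pos (INR _)) by apply pos_INR. rewrite Rpow_mult_distr.
    unfold scal; cbn; unfold mult; cbn. unfold Rdiv. rring.
  + apply (is_series_scal (K := R_AbsRing) (V := R_NormedModule)), is_series_exp.
- intros w _. replace (c * w + d) with ((c * z + d) + c * (w - z)) by ring.
  rewrite (Cexp_plus (c * z + d) (c * (w - z))).
  apply (C_is_series_ext (fun k => Cexp (c * z + d) * (Cpow (c * (w - z)) k / RtoC (INR (fact k))))).
  + intros k. rewrite Cpow_mult_l. unfold Cdiv. ring.
  + apply C_is_series_scal, Cexp_series.
Qed.

Lemma analytic_at_Cexp c d z : analytic_at (fun w => Cexp (c * w + d)) z.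
Proof.
apply analytic_at_wiener. exists 1%R. eexists. split; [lra | apply wiener_Cexp; lra].
Qed.

Fixpoint cbinom (c : C) (k : nat) : C :=
  match k with
  | O => 1
  | S k => cbinom c k * ((c - RtoC (INR k)) / RtoC (INR (S k)))
  end.

(** This is r (r + 1) ... (r + k - 1) / k!, the modulus of binom(-r, k) for r >= 0, and hence the
    majorant of binom(c, k) over |c| <= r. *)
Fixpoint rbinom (r : R) (k : nat) : R :=
  match k with
  | O => 1
  | S k => (rbinom r k * ((r + INR k) / INR (S k)))%R
  end.

Lemma INR_S_pos k : (0 < INR (S k))%R.
Proof. apply lt_0_INR. lia. Qed.

Lemma rbinom_pos r k : (0 < r)%R -> (0 < rbinom r k)%R.
Proof.
intros Hr. induction k as [|k IH]; cbn -[INR]; [lra|].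
apply Rmult_lt_0_compat; [exact IH|]. apply Rdiv_lt_0_compat; [|apply INR_S_pos].
generalize (pos_INR k). lra.
Qed.

Lemma cbinom_le c r k : (Cmod c <= r)%R -> (Cmod (cbinom c k) <= rbinom r k)%R.
Proof.
intros Hc. induction k as [|k IH]; cbn -[INR]; [rewrite Cmod_1; lra|].
assert (H := INR_S_pos k).
rewrite Cmod_mult, Cmod_div by (apply RtoC_neq_0; lra).
rewrite (Cmod_RtoC_pos (INR (S k))) by lra.
apply Rmult_le_compat; [apply Cmod_ge_0 | | exact IH|].
- apply Rdiv_le_0_compat; [apply Cmod_ge_0 | exact H].
- apply Rmult_le_compat_r; [left; apply Rinv_0_lt_compat, H|].
  eapply Rle_trans; [apply Cmod_triangle|]. rewrite Cmod_opp, Cmod_RtoC_pos by apply pos_INR. lra.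
Qed.

Lemma ex_series_rbinom r q : (0 < r)%R -> (0 < q < 1)%R -> ex_series (fun k => rbinom r k * q ^ k)%R.
Proof.
intros Hr Hq.
assert (P : forall k, (0 < rbinom r k * q ^ k)%R).
{ intros k. apply Rmult_lt_0_compat; [apply rbinom_pos, Hr | apply pow_lt; lra]. }
apply (ex_series_ext (fun k => Rabs (rbinom r k * q ^ k))).
{ intros k. apply Rabs_pos_eq. left; apply P. }
apply (ex_series_DAlembert _ q); [lra | intros n; apply Rgt_not_eq, P|].
apply (is_lim_seq_ext (fun k => q * (1 + (r - 1) * / INR (S k)))%R).
- intros k. rewrite Rabs_pos_eq.
  + cbn -[INR]. rewrite S_INR. assert (h1 := rbinom_pos r k Hr). assert (h2 := pos_INR k).
    assert (h3 : (0 < q ^ k)%R) by (apply pow_lt; lra). field. repeat split; lra.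
  + left. apply Rdiv_lt_0_compat; apply P.
- replace (Finite q) with (Rbar_mult q (Rbar_plus 1 (Rbar_mult (r - 1)%R (Rbar_inv p_infty))))
    by (cbn; f_equal; ring).
  apply is_lim_seq_scal_l. apply is_lim_seq_plus'; [apply is_lim_seq_const|].
  replace (Finite ((r - 1) * 0))%R with (Rbar_mult (r - 1)%R (Rbar_inv p_infty)) by reflexivity.
  apply is_lim_seq_scal_l. apply is_lim_seq_inv; [|discriminate].
  apply (is_lim_seq_incr_1 INR). apply is_lim_seq_INR.
Qed.

Lemma cbinom_series c x :
  (0 <= x < 1)%R -> C_is_series (fun k => cbinom c k * RtoC (x ^ k)) (Cexp (c * RtoC (ln (1 + x)))).
Proof.
(* [pseries_ode] needs [0 < x], while the digit 0 leads to [x = 0]. *)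
intros Hx. destruct (Req_dec x 0) as [->|Hx0].
{ rewrite Rplus_0_r, ln_1, Cmult_0_r, Cexp_0.
  assert (h := C_is_series_head (fun k => cbinom c k * RtoC (0 ^ k))). cbn -[pow] in h.
  replace (1 * RtoC (0 ^ 0)) with (RtoC 1) in h by (cbn; ring). apply h.
  intros n. rewrite pow_i by lia. ring. }
replace (Cexp (c * ln (1 + x))) with (cbinom c 0 * Cexp (c * RtoC (ln (1 + x)))) by (cbn; ring).
(* Any radius strictly between [x] and 1 would do. Below, [Cmod c + 1] stands in for [Cmod c] to
   keep the parameter of [rbinom] positive. *)
set (r := ((1 + x) / 2)%R).
destruct (ex_series_rbinom (Cmod c + 1) r) as [T HT].
{ generalize (Cmod_ge_0 c). lra. }
{ unfold r. lra. }
destruct (is_series_R_le (fun k => Cmod (cbinom c k) * r ^ k)%R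
  (fun k => rbinom (Cmod c + 1) k * r ^ k)%R T) as [T' [_ HT']]; [|exact HT|].
{ intros n. assert (0 <= r ^ n)%R by (apply pow_le; unfold r; lra).
  split; [apply Rmult_le_pos; [apply Cmod_ge_0 | assumption]|].
  apply Rmult_le_compat_r; [assumption | apply cbinom_le; lra]. }
apply (pseries_ode (cbinom c) c 1 (fun t => ln (1 + t))%R r T').
- intros k. cbn -[INR]. field. apply RtoC_neq_0, Rgt_not_eq, INR_S_pos.
- unfold r. lra.
- exact HT'.
- rewrite Rplus_0_r. apply ln_1.
- intros; lra.
- intros t Ht. auto_derive; [lra | field; lra].
Qed.

(** Each factor (-w - k) / (k + 1) has norm at most (|z| + r + k) / (k + 1), which is the
    corresponding factor of [rbinom]. *)
Lemma wiener_cbinom z r k :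
  (0 < r)%R -> wiener z r (rbinom (Cmod z + r) k) (fun w => cbinom (- w) k).
Proof.
intros Hr. induction k as [|k IH].
- eapply wiener_le; [|exact (wiener_const z r 1)]. rewrite Cmod_1. cbn. lra.
- assert (H := INR_S_pos k). cbn -[INR]. apply wiener_mult; [lra | exact IH|].
  apply (wiener_ext _ _ _ (fun w => - / RtoC (INR (S k)) * ((w - z) + (z + RtoC (INR k))))).
  + intros w _. field. apply RtoC_neq_0. lra.
  + apply (wiener_le _ _ (Cmod (- / RtoC (INR (S k))) * (r + Cmod (z + RtoC (INR k))))).
    * rewrite Cmod_opp, Cmod_inv by (apply RtoC_neq_0; lra). rewrite Cmod_RtoC_pos by lra.
      unfold Rdiv. rewrite Rmult_comm. apply Rmult_le_compat_r; [left; apply Rinv_0_lt_compat, H|].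
      assert (h := Cmod_triangle z (RtoC (INR k))). rewrite Cmod_RtoC_pos in h by apply pos_INR. lra.
    * apply wiener_mult; [lra | apply wiener_const|].
      apply wiener_plus; [lra | apply wiener_shift, Hr | apply wiener_const].
Qed.

(** * Digits and blocks of the Dirichlet series *)

Lemma cbinom_nat_le m j :
  (j <= m)%nat -> cbinom (RtoC (INR m)) j = RtoC (Binomial.C m j).
Proof.
induction j as [|j IH]; intros Hj.
- unfold Binomial.C. cbn -[INR fact]. rewrite Nat.sub_0_r. f_equal. cbn [fact]. rewrite INR_1.
  field. apply INR_fact_neq_0.
- cbn -[INR]. rewrite IH by lia. rewrite <- RtoC_minus, <- RtoC_div by apply Rgt_not_eq, INR_S_pos.
  rewrite <- RtoC_mult. f_equal. unfold Binomial.C.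
  replace (m - j)%nat with (S (m - S j)) by lia.
  rewrite (fact_simpl j), (fact_simpl (m - S j)), !mult_INR.
  replace (S (m - S j)) with (m - j)%nat by lia. rewrite (minus_INR m j) by lia.
  assert (H := INR_S_pos j). assert (h1 := INR_fact_lt_0 j). assert (h2 := INR_fact_lt_0 (m - S j)).
  assert (h3 : (0 < INR m - INR j)%R) by (apply Rlt_0_minus, lt_INR; lia).
  field. lra.
Qed.

Lemma cbinom_nat_gt m j : (m < j)%nat -> cbinom (RtoC (INR m)) j = 0.
Proof.
intros Hj. induction Hj as [|j Hj IH]; cbn -[INR].
- unfold Cminus. rewrite Cplus_opp_r. unfold Cdiv. ring.
- rewrite IH. ring.
Qed.

Definition lsum {T : Type} (f : T -> C) (L : list T) : C := fold_right Cplus 0 (map f L).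

Lemma lsum_app {T} (f : T -> C) L L' : lsum f (L ++ L') = lsum f L + lsum f L'.
Proof.
unfold lsum. induction L as [|x L IH]; cbn [app map fold_right]; [ring | rewrite IH; ring].
Qed.

Lemma lsum_ext {T} (f g : T -> C) L : (forall x, In x L -> f x = g x) -> lsum f L = lsum g L.
Proof. intros H. unfold lsum. f_equal. apply map_ext_in, H. Qed.

Lemma lsum_perm {T} (f : T -> C) L L' : Permutation L L' -> lsum f L = lsum f L'.
Proof.
unfold lsum. induction 1; cbn [map fold_right]; [reflexivity | rewrite IHPermutation; reflexivity | ring | congruence].
Qed.

Lemma lsum_scal {T} c (f : T -> C) L : lsum (fun x => c * f x) L = c * lsum f L.
Proof. unfold lsum. induction L as [|x L IH]; cbn [map fold_right]; [ring | rewrite IH; ring]. Qed.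

Lemma lsum_filter {T} p (f : T -> C) L :
  lsum (fun x => if p x : bool then f x else 0) L = lsum f (filter p L).
Proof.
unfold lsum. induction L as [|x L IH]; cbn [map fold_right filter]; [reflexivity|].
rewrite IH. destruct (p x); cbn [map fold_right]; [reflexivity | ring].
Qed.

(** Turns a sum over all residues into a sum over digits; since [L] lists the digits in any order,
    the comparison goes through a permutation. *)
Lemma lsum_In (f g : nat -> C) n L :
  NoDup L -> (forall a, In a L -> (a < n)%nat) ->
  (forall i, (i < n)%nat -> In i L -> f i = g i) ->
  (forall i, (i < n)%nat -> ~ In i L -> f i = 0) ->
  lsum f (seq 0 n) = lsum g L.
Proof.
intros HL HA H1 H2.
set (p := fun i => if in_dec Nat.eq_dec i L then true else false).
transitivity (lsum (fun i => if p i then g i else 0) (seq 0 n)).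
- apply lsum_ext. intros i Hi. apply in_seq in Hi. unfold p.
  destruct (in_dec Nat.eq_dec i L); [apply H1 | apply H2]; solve [lia | assumption].
- rewrite lsum_filter. apply lsum_perm, NoDup_Permutation.
  + apply NoDup_filter, seq_NoDup.
  + exact HL.
  + intros i. rewrite filter_In, in_seq. unfold p. destruct (in_dec Nat.eq_dec i L) as [h|h].
    * split; [tauto|]. intros _. specialize (HA i h). split; [lia | reflexivity].
    * split; [intros [_ E]; discriminate | tauto].
Qed.

Lemma sum_n_lsum (u : nat -> C) n : csum_n u n = lsum u (seq 0 (S n)).
Proof.
induction n as [|n IH].
- rewrite sum_O. unfold lsum. cbn. ring.
- rewrite sum_Sn, IH, (seq_S (S n)), lsum_app. unfold lsum at 3. cbn. f_equal. ring.
Qed.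

(** The partial sums by blocks form the subsequence of the partial sums of [u] at the indices b Q +
    b - 1. *)
Lemma C_is_series_blocks b (u : nat -> C) l :
  (0 < b)%nat -> C_is_series u l ->
  C_is_series (fun q => lsum (fun i => u (b * q + i)%nat) (seq 0 b)) l.
Proof.
intros Hb. rewrite !C_is_series_eps. intros H eps Heps.
destruct (H eps Heps) as [N HN]. exists N. intros Q HQ.
replace (csum_n (fun q => lsum (fun i => u (b * q + i)%nat) (seq 0 b)) Q)
  with (csum_n u (b * Q + (b - 1))).
- apply HN. nia.
- clear HN HQ. rewrite sum_n_lsum. replace (S (b * Q + (b - 1))) with (b * S Q)%nat by nia.
  assert (E : forall q, lsum (fun i => u (b * q + i)%nat) (seq 0 b) = lsum u (seq (b * q) b)).
  { intros q. unfold lsum. f_equal.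
    rewrite <- (map_map (fun i => (b * q + i)%nat) u).
    f_equal. generalize (b * q)%nat as c. clear. intros c.
    assert (E : forall s, map (fun i => c + i)%nat (seq s b) = seq (c + s) b).
    { induction b as [|b IH]; intros s; cbn; [reflexivity|]. rewrite IH, Nat.add_succ_r. reflexivity. }
    rewrite E, Nat.add_0_r. reflexivity. }
  induction Q as [|Q IH].
  + rewrite sum_O, E. rewrite Nat.mul_0_r, Nat.mul_1_r. reflexivity.
  + rewrite sum_Sn, <- IH, E. replace (b * S (S Q))%nat with (b * S Q + b)%nat by nia.
    rewrite seq_app, lsum_app. reflexivity.
Qed.

Lemma C_is_series_lsum {T} (u : T -> nat -> C) (l : T -> C) L :
  (forall x, In x L -> C_is_series (u x) (l x)) ->
  C_is_series (fun n => lsum (fun x => u x n) L) (lsum l L).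
Proof.
induction L as [|x L IH]; intros H; unfold lsum; cbn [map fold_right].
- apply C_is_series_0.
- apply C_is_series_plus; [apply H; left; reflexivity|]. apply IH. intros y Hy. apply H. right. exact Hy.
Qed.

Lemma analytic_at_lsum {T} (f : T -> C -> C) L z :
  (forall x, In x L -> analytic_at (f x) z) -> analytic_at (fun w => lsum (fun x => f x w) L) z.
Proof.
induction L as [|x L IH]; intros H; unfold lsum; cbn [map fold_right].
- apply analytic_at_const.
- apply analytic_at_plus; [apply H; left; reflexivity|]. apply IH. intros y Hy. apply H. right. exact Hy.
Qed.

Lemma gamma_lsum A j : RtoC (INR (gamma A j)) = lsum (fun a => RtoC (INR a ^ j)) A.
Proof.
unfold gamma, lsum, list_sum. induction A as [|a A IH]; cbn [map fold_right]; [reflexivity|].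
rewrite plus_INR, RtoC_plus, IH, pow_INR. reflexivity.
Qed.

Lemma gamma_le b A j :
  (forall a, In a A -> (a < b)%nat) -> (gamma A j <= length A * (b - 1) ^ j)%nat.
Proof.
unfold gamma, list_sum. induction A as [|a A IH]; intros H; cbn [map fold_right length]; [lia|].
specialize (IH (fun x hx => H x (or_intror hx))).
assert (a ^ j <= (b - 1) ^ j)%nat; [|lia].
apply Nat.pow_le_mono_l. specialize (H a (or_introl eq_refl)). lia.
Qed.

Lemma admissible_small b A i :
  (1 < b)%nat -> (i < b)%nat -> admissible b A i <-> In i (nonzero_digits A).
Proof.
intros Hb Hi. unfold nonzero_digits. rewrite filter_In. split.
- intros [H0 H]. specialize (H 0%nat). rewrite Nat.pow_0_r in H. rewrite Nat.div_1_r, Nat.mod_small in H by lia.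
  split; [apply H; lia|]. destruct i; [lia | reflexivity].
- intros [H1 H2]. destruct i as [|i]; [discriminate|]. split; [lia|].
  intros [|k] Hk.
  + rewrite Nat.pow_0_r, Nat.div_1_r, Nat.mod_small by lia. exact H1.
  + exfalso. assert (b ^ k <> 0)%nat by (apply Nat.pow_nonzero; lia). cbn in Hk. nia.
Qed.

(** The last digit of b q + i is [i] and the others are those of [q]. For q = 0 the digit [i] would
    be the leading one and could not be 0, so that block is treated apart. *)
Lemma admissible_step b A q i :
  (1 < b)%nat -> (0 < q)%nat -> (i < b)%nat ->
  admissible b A (b * q + i) <-> In i A /\ admissible b A q.
Proof.
intros Hb Hq Hi.
assert (Hdiv : ((b * q + i) / b = q)%nat).
{ rewrite Nat.mul_comm, Nat.div_add_l, (Nat.div_small i b) by lia. lia. }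
assert (Hstep : forall k, ((b * q + i) / b ^ S k = q / b ^ k)%nat).
{ intros k. rewrite Nat.pow_succ_r', <- Nat.Div0.div_div, Hdiv. reflexivity. }
assert (H0 : ((b * q + i) / b ^ 0 mod b = i)%nat).
{ rewrite Nat.pow_0_r, Nat.div_1_r, Nat.add_comm, Nat.mul_comm, Nat.Div0.mod_add, Nat.mod_small; lia. }
split.
- intros [_ H]. split.
  + rewrite <- H0. apply H. cbn. nia.
  + split; [exact Hq|]. intros k Hk. rewrite <- Hstep. apply H. cbn. nia.
- intros [H1 [_ H2]]. split; [nia|]. intros [|k] Hk.
  + rewrite H0. exact H1.
  + rewrite Hstep. apply H2. cbn in Hk.
    (* Otherwise b (q + 1) <= b^(k+1) <= b q + i, against i < b. *)
    apply Nat.nlt_ge. intros h. assert (b * S q <= b * b ^ k)%nat by (apply Nat.mul_le_mono_l; lia). nia.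
Qed.

(** * The functional equation in the half-plane of convergence *)

Definition npow (s : C) (n : nat) : C := Cexp (- s * RtoC (ln (INR n))).

Lemma npow_shift s k n :
  (0 < n)%nat -> npow (s + RtoC (INR k)) n = npow s n * / RtoC (INR n ^ k).
Proof.
intros Hn. apply lt_0_INR in Hn. unfold npow.
replace (- (s + INR k) * ln (INR n)) with (- s * ln (INR n) + RtoC (- (INR k * ln (INR n))))
  by (rewrite RtoC_opp, RtoC_mult; ring).
rewrite Cexp_plus, Cexp_RtoC. f_equal.
rewrite exp_Ropp, RtoC_inv by apply Rgt_not_eq, exp_pos. f_equal. f_equal.
rewrite <- ln_pow by exact Hn. apply exp_ln, pow_lt, Hn.
Qed.

Lemma npow_neg_nat m n : (0 < n)%nat -> npow (RtoC (- INR m)) n = RtoC (INR n ^ m).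
Proof.
intros Hn. apply lt_0_INR in Hn. unfold npow.
rewrite <- RtoC_opp, <- RtoC_mult, Ropp_involutive, Cexp_RtoC, <- ln_pow by exact Hn.
f_equal. apply exp_ln, pow_lt, Hn.
Qed.

Lemma npow_block s b q a :
  (0 < b)%nat -> (0 < q)%nat -> (a < b)%nat ->
  C_is_series (fun k => cbinom (- s) k * (RtoC (INR a ^ k) / RtoC (INR b ^ k)) * npow (s + RtoC (INR k)) q)
    (Cexp (s * RtoC (ln (INR b))) * npow s (b * q + a)).
Proof.
intros Hb Hq Ha.
assert (Hb' := lt_0_INR b Hb). assert (Hq' := lt_0_INR q Hq). assert (Ha' := lt_INR a b Ha).
assert (Hq1 : (1 <= INR q)%R) by (apply (le_INR 1 q); lia).
(* The expansion point lies below 1 because a < b and q >= 1. *)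
set (x := (INR a / (INR b * INR q))%R).
assert (Hbq : (0 < INR b * INR q)%R) by (apply Rmult_lt_0_compat; assumption).
assert (Hx : (0 <= x < 1)%R).
{ unfold x. split; [apply Rdiv_le_0_compat; [apply pos_INR | exact Hbq]|].
  apply (Rmult_lt_reg_r (INR b * INR q)); [exact Hbq|].
  unfold Rdiv. rewrite Rmult_assoc, Rinv_l by lra. nra. }
assert (H := C_is_series_scal (npow s q) _ _ (cbinom_series (- s) x Hx)).
replace (Cexp (s * ln (INR b)) * npow s (b * q + a)) with (npow s q * Cexp (- s * ln (1 + x))).
- revert H. apply C_is_series_ext. intros k. rewrite npow_shift by exact Hq. unfold x, Rdiv.
  rewrite Rpow_mult_distr, pow_inv, Rpow_mult_distr.
  rewrite RtoC_mult, RtoC_inv, RtoC_mult.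
  + field. split; apply RtoC_neq_0, pow_nonzero; lra.
  + apply Rmult_integral_contrapositive; split; apply pow_nonzero; lra.
- unfold npow. rewrite <- !Cexp_plus. f_equal.
  rewrite plus_INR, mult_INR.
  replace (INR b * INR q + INR a)%R with (INR b * (INR q * (1 + x)))%R by (unfold x; field; lra).
  rewrite !ln_mult by nra. rewrite !RtoC_plus. ring.
Qed.

(** The modulus of a term depends on [s] only through its real part [x]; this real series supplies
    the majorants in [n]. *)
Definition dterm (b : nat) (A : list nat) (x : R) (n : nat) : R :=
  if excluded_middle_informative (admissible b A n) then exp (- x * ln (INR n)) else 0%R.

Lemma Cmod_dirichlet_term b A s n : Cmod (dirichlet_term b A s n) = dterm b A (Re s) n.
Proof.
unfold dirichlet_term, dterm. destruct (excluded_middle_informative _).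
- rewrite Cmod_Cexp. f_equal. cbn. unfold Re. ring.
- apply Cmod_0.
Qed.

Lemma dirichlet_term_RtoC b A x n : dirichlet_term b A (RtoC x) n = RtoC (dterm b A x n).
Proof.
unfold dirichlet_term, dterm. destruct (excluded_middle_informative _); [|reflexivity].
rewrite <- Cexp_RtoC, RtoC_mult, RtoC_opp. reflexivity.
Qed.

Lemma dterm_pos b A x n : (0 <= dterm b A x n)%R.
Proof. unfold dterm. destruct (excluded_middle_informative _); [left; apply exp_pos | lra]. Qed.

Lemma ln_INR_nonneg n : (0 < n)%nat -> (0 <= ln (INR n))%R.
Proof.
intros Hn. rewrite <- ln_1. destruct (Nat.eq_dec n 1) as [->|h]; [rewrite INR_1; lra|].
left. apply ln_increasing; [lra|]. apply (lt_INR 1). lia.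
Qed.

Lemma exp_le_compat x y : (x <= y)%R -> (exp x <= exp y)%R.
Proof. intros [h| ->]; [left; apply exp_increasing, h | lra]. Qed.

Lemma dterm_antitone b A x y n : (x <= y)%R -> (dterm b A y n <= dterm b A x n)%R.
Proof.
intros H. unfold dterm. destruct (excluded_middle_informative _) as [[Hn _]|]; [|lra].
apply exp_le_compat. apply Rmult_le_compat_r; [apply ln_INR_nonneg, Hn | lra].
Qed.

(** At a real argument the terms are nonnegative reals, so the convergence assumed of the series of
    [K] is absolute convergence on the whole vertical line. *)
Lemma dterm_summable b A K x :
  restricted_dirichlet b A K -> (log_base b (INR (length A)) < x)%R ->
  is_series (dterm b A x) (Re (K (RtoC x))).
Proof.
intros [_ H] Hx. specialize (H (RtoC x) Hx).
apply C_is_series_Re_Im, proj1 in H. revert H. apply is_series_ext.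
intros n. rewrite dirichlet_term_RtoC. reflexivity.
Qed.

Definition coef (b : nat) (A : list nat) (s : C) (k : nat) : C :=
  cbinom (- s) k * (RtoC (INR (gamma A k)) / RtoC (INR b ^ k)).

(** Digits are at most b - 1, which gives a geometric decay of ratio (b - 1)/b < 1; it beats the
    growth of the binomial coefficients. *)
Lemma Cmod_gamma_le b A k :
  (1 < b)%nat -> digit_set b A ->
  (Cmod (RtoC (INR (gamma A k)) / RtoC (INR b ^ k)) <= INR (length A) * ((INR b - 1) / INR b) ^ k)%R.
Proof.
intros Hb [_ HA]. assert (Hb' : (0 < INR b)%R) by (apply lt_0_INR; lia).
assert (Hbk : (0 < INR b ^ k)%R) by (apply pow_lt, Hb').
rewrite Cmod_div by (apply RtoC_neq_0; lra).
rewrite !Cmod_RtoC_pos by (try apply pos_INR; lra).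
unfold Rdiv. rewrite Rpow_mult_distr, pow_inv, <- Rmult_assoc.
apply Rmult_le_compat_r; [left; apply Rinv_0_lt_compat, Hbk|].
replace (INR b - 1)%R with (INR (b - 1)) by (rewrite minus_INR by lia; reflexivity).
rewrite <- pow_INR, <- mult_INR. apply le_INR, gamma_le, HA.
Qed.

Lemma digit_ratio b : (1 < b)%nat -> (0 < (INR b - 1) / INR b < 1)%R.
Proof.
intros Hb. assert (Hb' : (1 < INR b)%R) by (apply (lt_INR 1); lia). split.
- apply Rdiv_lt_0_compat; lra.
- apply (Rmult_lt_reg_r (INR b)); [lra|]. unfold Rdiv. rewrite Rmult_assoc, Rinv_l by lra. lra.
Qed.

Lemma dirichlet_block_0 b A s :
  (1 < b)%nat -> digit_set b A ->
  lsum (fun i => dirichlet_term b A s (b * 0 + i)) (seq 0 b) = lsum (npow s) (nonzero_digits A).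
Proof.
intros Hb [HA1 HA2].
apply lsum_In.
- apply NoDup_filter, HA1.
- intros a Ha. apply filter_In in Ha. apply HA2, Ha.
- intros i Hi H. rewrite Nat.mul_0_r, Nat.add_0_l. unfold dirichlet_term.
  destruct (excluded_middle_informative _) as [_|h]; [reflexivity|].
  exfalso. apply h, admissible_small; assumption.
- intros i Hi H. rewrite Nat.mul_0_r, Nat.add_0_l. unfold dirichlet_term.
  destruct (excluded_middle_informative _) as [h|_]; [|reflexivity].
  exfalso. apply H. apply (admissible_small b A i Hb Hi), h.
Qed.

Lemma dirichlet_block_pos b A s q :
  (1 < b)%nat -> digit_set b A -> (0 < q)%nat ->
  lsum (fun i => dirichlet_term b A s (b * q + i)) (seq 0 b) =
  if excluded_middle_informative (admissible b A q)
  then lsum (fun a => npow s (b * q + a)) A else 0.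
Proof.
intros Hb [HA1 HA2] Hq. destruct (excluded_middle_informative (admissible b A q)) as [h|h].
- apply lsum_In; try assumption.
  + intros i Hi H. unfold dirichlet_term.
    destruct (excluded_middle_informative _) as [_|h']; [reflexivity|].
    exfalso. apply h', admissible_step; auto.
  + intros i Hi H. unfold dirichlet_term.
    destruct (excluded_middle_informative _) as [h'|_]; [|reflexivity].
    exfalso. apply H. apply (admissible_step b A q i Hb Hq Hi), h'.
- replace (RtoC 0) with (lsum (fun _ : nat => RtoC 0) (seq 0 b)).
  + apply lsum_ext. intros i Hi. apply in_seq in Hi. unfold dirichlet_term.
    destruct (excluded_middle_informative _) as [h'|_]; [|reflexivity].
    exfalso. apply h. apply (admissible_step b A q i Hb Hq ltac:(lia)), h'.
  + unfold lsum. clear. generalize (seq 0 b) as L.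
    induction L as [|x L IH]; cbn [map fold_right]; [reflexivity | rewrite IH; ring].
Qed.

Lemma dirichlet_term_0 b A s : dirichlet_term b A s 0 = 0.
Proof.
unfold dirichlet_term. destruct (excluded_middle_informative _) as [[h _]|]; [lia | reflexivity].
Qed.

(* Writing [n = b q + a] and expanding [(1 + a / (b q))^(-s)]. *)
Lemma dirichlet_functional_equation b A K s :
  (1 < b)%nat -> digit_set b A -> restricted_dirichlet b A K ->
  (log_base b (INR (length A)) < Re s)%R ->
  C_is_series (fun k => coef b A s k * K (s + RtoC (INR k)))
    (Cexp (s * RtoC (ln (INR b))) * (K s - lsum (npow s) (nonzero_digits A))).
Proof.
intros Hb HA HK Hs.
set (B := Cexp (s * RtoC (ln (INR b)))).
(* The index is [S q] because block 0 is split off; it accounts for the sum over nonzero digits. *)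
set (u := fun q k => coef b A s k * dirichlet_term b A (s + RtoC (INR k)) (S q)).
set (rows := fun q => B * lsum (fun i => dirichlet_term b A s (b * S q + i)) (seq 0 b)).
assert (Hre : forall k, Re (s + RtoC (INR k)) = (Re s + INR k)%R) by reflexivity.
assert (Hrows : C_is_series rows (B * (K s - lsum (npow s) (nonzero_digits A)))).
{ apply C_is_series_scal.
  apply (C_is_series_S (fun q => lsum (fun i => dirichlet_term b A s (b * q + i)) (seq 0 b))).
  rewrite dirichlet_block_0 by assumption.
  replace (lsum (npow s) (nonzero_digits A) + (K s - lsum (npow s) (nonzero_digits A))) with (K s) by ring.
  apply C_is_series_blocks; [lia|]. apply HK, Hs. }
set (r := (Cmod s + 1)%R). set (d := ((INR b - 1) / INR b)%R).
destruct (ex_series_rbinom r d) as [X HX].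
{ unfold r. generalize (Cmod_ge_0 s). lra. }
{ apply digit_ratio, Hb. }
(* Since n^(-Re s - k) <= n^(-Re s), the majorant can be taken as a product of a series in [q] and a
   series in [k]. *)
destruct (C_series_fubini u
  (fun q k => dterm b A (Re s) (S q) * INR (length A) * (rbinom r k * d ^ k))%R
  (fun q => dterm b A (Re s) (S q) * INR (length A) * X)%R
  ((Re (K (RtoC (Re s))) - dterm b A (Re s) 0) * (INR (length A) * X))%R
  rows (fun k => coef b A s k * K (s + RtoC (INR k)))) as [l [H1 H2]].
- intros q k. unfold u, coef. rewrite !Cmod_mult, Cmod_dirichlet_term, Hre.
  assert (h1 := cbinom_le (- s) r k ltac:(unfold r; rewrite Cmod_opp; lra)).
  assert (h2 := Cmod_gamma_le b A k Hb HA). fold d in h2.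
  assert (h3 := dterm_antitone b A (Re s) (Re s + INR k) (S q) ltac:(generalize (pos_INR k); lra)).
  assert (h4 := dterm_pos b A (Re s + INR k) (S q)).
  replace (dterm b A (Re s) (S q) * INR (length A) * (rbinom r k * d ^ k))%R
    with (rbinom r k * (INR (length A) * d ^ k) * dterm b A (Re s) (S q))%R by ring.
  apply Rmult_le_compat; [apply Rmult_le_pos; apply Cmod_ge_0 | exact h4 | | exact h3].
  apply Rmult_le_compat; try apply Cmod_ge_0; assumption.
- intros q. apply (is_series_scal (K := R_AbsRing) (V := R_NormedModule)), HX.
- apply (is_series_ext (fun q => dterm b A (Re s) (S q) * (INR (length A) * X))%R);
    [intros q; symmetry; apply Rmult_assoc|].
  apply (is_series_scal_r (INR (length A) * X)%R (fun q => dterm b A (Re s) (S q))).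
  apply (is_series_incr_1 (dterm b A (Re s))). unfold plus; cbn.
  replace (Re (K (Re s)) - dterm b A (Re s) 0 + dterm b A (Re s) 0)%R with (Re (K (RtoC (Re s)))) by ring.
  apply (dterm_summable b A K); assumption.
- intros q. unfold rows. rewrite dirichlet_block_pos by (assumption || lia). unfold u, dirichlet_term.
  destruct (excluded_middle_informative _) as [h|h].
  + rewrite <- lsum_scal.
    apply (C_is_series_ext (fun k => lsum (fun a => cbinom (- s) k * (RtoC (INR a ^ k) / RtoC (INR b ^ k)) * npow (s + RtoC (INR k)) (S q)) A)).
    * intros k. unfold coef. rewrite gamma_lsum.
      transitivity ((cbinom (- s) k * / RtoC (INR b ^ k) * npow (s + RtoC (INR k)) (S q)) * lsum (fun a => RtoC (INR a ^ k)) A).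
      -- rewrite <- lsum_scal. apply lsum_ext. intros a _. unfold Cdiv. ring.
      -- unfold Cdiv, npow. ring.
    * apply C_is_series_lsum. intros a Ha. apply npow_block; [lia | lia |]. apply HA, Ha.
  + rewrite Cmult_0_r. apply (C_is_series_ext (fun _ => 0)); [intros; ring | apply C_is_series_0].
- intros k. apply C_is_series_scal. apply C_is_series_S. rewrite dirichlet_term_0, Cplus_0_l.
  apply HK. rewrite Hre. generalize (pos_INR k). lra.
- rewrite (C_is_series_unique _ _ _ Hrows H1). exact H2.
Qed.

(** * Continuation of the functional equation beyond the half-plane *)

Lemma wiener_coef b A z r k :
  (1 < b)%nat -> digit_set b A -> (0 < r)%R ->
  wiener z r (INR (length A) * (rbinom (Cmod z + r) k * ((INR b - 1) / INR b) ^ k)) (fun w => coef b A w k).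
Proof.
intros Hb HA Hr. unfold coef.
eapply wiener_le; [|apply wiener_mult; [lra | apply wiener_cbinom, Hr | apply wiener_const]].
rewrite (Rmult_comm (INR (length A))), Rmult_assoc, (Rmult_comm _ (INR (length A))).
apply Rmult_le_compat_l; [|apply Cmod_gamma_le; assumption].
left. apply rbinom_pos. generalize (Cmod_ge_0 z). lra.
Qed.

(** On the disc the real part of w + p is at least [x], so n^(-w-p) has norm at most n^(-x). The
    bound is the same for all larger [p], which makes the tail summable. *)
Lemma wiener_dirichlet b A K z r x p :
  (1 < b)%nat -> restricted_dirichlet b A K -> (0 < r)%R ->
  (log_base b (INR (length A)) < x)%R -> (x <= Re z + INR p - r)%R ->
  wiener z r (Re (K (RtoC x))) (fun w => K (w + RtoC (INR p))).
Proof.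
intros Hb HK Hr Hx Hz.
apply (wiener_series z r (dterm b A x) _ (fun n w => dirichlet_term b A (w + RtoC (INR p)) n)).
- exact Hr.
- intros n. unfold dirichlet_term, dterm. destruct (excluded_middle_informative _) as [[h _]|_].
  + apply (wiener_ext _ _ _ (fun w => Cexp (RtoC (- ln (INR n)) * w + RtoC (- INR p * ln (INR n))))).
    { intros w _. f_equal. rewrite RtoC_mult, !RtoC_opp. ring. }
    eapply wiener_le; [|apply wiener_Cexp; lra].
    apply exp_le_compat. assert (hl := ln_INR_nonneg n h).
    rewrite Cmod_R, Rabs_Ropp, Rabs_pos_eq by exact hl. unfold Re in *; cbn. nra.
  + eapply wiener_le; [|apply wiener_const]. rewrite Cmod_0. lra.
- apply (dterm_summable b A K); assumption.
- intros w Hw. apply HK.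
  assert (h := re_le_Cmod (w - z)). apply Rabs_le_between in h.
  change (Re (w - z)) with (Re w - Re z)%R in h.
  change (Re (w + RtoC (INR p))) with (Re w + INR p)%R. lra.
Qed.

(* The part of the functional equation that converges beyond the half-plane
   of convergence of [K]. *)
Definition dirichlet_tail (b : nat) (A : list nat) (K : C -> C) (m : nat) (s : C) : C :=
  Csum (fun k => coef b A s (S m + k) * K (s + RtoC (INR (S m + k)))).

Lemma analytic_at_dirichlet_tail b A K m z :
  (1 < b)%nat -> digit_set b A -> restricted_dirichlet b A K ->
  (log_base b (INR (length A)) < Re z + INR (S m))%R ->
  analytic_at (dirichlet_tail b A K m) z.
Proof.
intros Hb HA HK Hz. set (sg := log_base b (INR (length A))) in *.
(* With a third of the gap, [x] is past the abscissa by [r], and Re z + (m + 1) - r = sg + 2 r still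
   exceeds [x]. *)
set (r := ((Re z + INR (S m) - sg) / 3)%R). set (x := (sg + r)%R).
assert (Hr : (0 < r)%R) by (unfold r; lra).
assert (Hx : (x <= Re z + INR (S m) - r)%R) by (unfold x, r; lra).
set (D := Re (K (RtoC x))). set (d := ((INR b - 1) / INR b)%R).
set (M := fun k => ((INR (length A) * D) * (rbinom (Cmod z + r) (S m + k) * d ^ (S m + k)))%R).
assert (HD : (0 <= D)%R).
{ apply (is_series_nonneg (dterm b A x)); [intros; apply dterm_pos|].
  apply dterm_summable; [exact HK | unfold x, sg in *; lra]. }
assert (Hw : forall k, wiener z r (M k) (fun w => coef b A w (S m + k) * K (w + RtoC (INR (S m + k))))).
{ intros k. eapply wiener_le; [|apply wiener_mult; [lra | apply wiener_coef; assumption |]].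
  2: { apply (wiener_dirichlet b A K z r x); try assumption; [unfold x, sg in *; lra|].
       rewrite plus_INR. generalize (pos_INR k). lra. }
  unfold M. fold d D. apply Req_le. ring. }
assert (HM : ex_series M).
{ apply (ex_series_scal (K := R_AbsRing) (V := R_NormedModule) (INR (length A) * D)%R
     (fun k => rbinom (Cmod z + r) (S m + k) * d ^ (S m + k))%R).
  apply (ex_series_incr_n (fun k => rbinom (Cmod z + r) k * d ^ k)%R).
  apply ex_series_rbinom; [generalize (Cmod_ge_0 z); lra | apply digit_ratio, Hb]. }
destruct HM as [T HT].
apply analytic_at_wiener. exists r, T. split; [exact Hr|].
apply (wiener_series z r M T _ _ Hr Hw HT).
intros w hw. refine (proj1 (C_is_series_dominated _ M T _ HT)).
intros k. apply (wiener_bound z r (M k) _ w (Hw k) hw).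
Qed.

(** The difference of the two sides. The terms k <= m are kept explicit because they are analytic
    through the continuation of [K], off its poles, whereas the tail is analytic by convergence. *)
Definition dirichlet_defect (b : nat) (A : list nat) (K : C -> C) (m : nat) (s : C) : C :=
  Cexp (s * RtoC (ln (INR b))) * (K s - lsum (npow s) (nonzero_digits A))
  - (csum_n (fun k => coef b A s k * K (s + RtoC (INR k))) m + dirichlet_tail b A K m s).

Lemma C_is_series_tail (u : nat -> C) l m :
  C_is_series u l -> C_is_series (fun k => u (S m + k)%nat) (l - csum_n u m).
Proof.
intros H. apply (is_series_incr_n (K := C_AbsRing) (V := C_NormedModule) u (S m)); [lia|].
cbn [pred Init.Nat.pred].
change (C_is_series u (l - csum_n u m + csum_n u m)).
replace (l - csum_n u m + csum_n u m) with l by ring. exact H.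
Qed.

Lemma dirichlet_defect_half_plane b A K m s :
  (1 < b)%nat -> digit_set b A -> restricted_dirichlet b A K ->
  (log_base b (INR (length A)) < Re s)%R -> dirichlet_defect b A K m s = 0.
Proof.
intros Hb HA HK Hs.
assert (H := dirichlet_functional_equation b A K s Hb HA HK Hs).
unfold dirichlet_defect, dirichlet_tail.
rewrite (Csum_unique _ _ (C_is_series_tail _ _ m H)). ring.
Qed.

(** The candidate set is stable under s -> s - 1, so the single condition that [s] is not a
    candidate covers all the K(s + k). *)
Lemma candidate_pole_shift b A s k :
  candidate_pole b A (s + RtoC (INR k)) -> candidate_pole b A s.
Proof.
intros (m & j & E). exists (m + k)%nat, j.
replace s with ((s + RtoC (INR k)) - RtoC (INR k)) by ring. rewrite E.
rewrite plus_INR, !RtoC_minus, RtoC_plus. ring.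
Qed.

Lemma analytic_at_dirichlet_defect b A K m z :
  (1 < b)%nat -> digit_set b A -> restricted_dirichlet b A K ->
  (log_base b (INR (length A)) < Re z + INR (S m))%R -> ~ candidate_pole b A z ->
  analytic_at (dirichlet_defect b A K m) z.
Proof.
intros Hb HA HK Hz Hp.
assert (HKa : forall k, analytic_at (fun w => K (w + RtoC (INR k))) z).
{ intros k. apply analytic_at_translate. apply HK. intros h. apply Hp, (candidate_pole_shift b A z k h). }
assert (Hexp : forall c, analytic_at (fun w => Cexp (w * c)) z).
{ intros c. apply (analytic_at_ext (fun w => Cexp (c * w + 0))); [|apply analytic_at_Cexp].
  exists 1%R. split; [lra|]. intros w _. f_equal. ring. }
assert (Hm : forall f, analytic_at f z -> analytic_at (fun w => - f w) z).
{ intros f Hf. apply (analytic_at_ext (fun w => (-1) * f w)).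
  - exists 1%R. split; [lra|]. intros; ring.
  - apply analytic_at_mult; [apply analytic_at_const | exact Hf]. }
unfold dirichlet_defect. apply analytic_at_plus; [apply analytic_at_mult|].
- apply Hexp.
- apply analytic_at_plus.
  + apply HK, Hp.
  + apply Hm, analytic_at_lsum. intros a _. unfold npow.
    apply (analytic_at_ext (fun w => Cexp (w * - RtoC (ln (INR a))))); [|apply Hexp].
    exists 1%R. split; [lra|]. intros w _. f_equal. ring.
- apply Hm, analytic_at_plus.
  + apply (analytic_at_sum_n (fun k w => coef b A w k * K (w + RtoC (INR k)))). intros k _.
    apply analytic_at_mult; [|apply HKa]. apply analytic_at_wiener.
    exists 1%R. eexists. split; [lra|]. apply wiener_coef; [assumption | assumption | lra].
  + apply analytic_at_dirichlet_tail; assumption.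
Qed.

Lemma log_base_between b N :
  (1 < N < b)%nat -> (0 < log_base b (INR N) < 1)%R.
Proof.
intros [H1 H2]. assert (h1 : (1 < INR N)%R) by (apply (lt_INR 1); lia).
assert (h2 := lt_INR _ _ H2).
assert (l1 : (0 < ln (INR N))%R) by (rewrite <- ln_1; apply ln_increasing; lra).
assert (l2 : (ln (INR N) < ln (INR b))%R) by (apply ln_increasing; lra).
unfold log_base. split; [apply Rdiv_lt_0_compat; lra|].
apply (Rmult_lt_reg_r (ln (INR b))); [lra|]. unfold Rdiv. rewrite Rmult_assoc, Rinv_l by lra. lra.
Qed.

Lemma candidate_pole_Re_Im b A s :
  (1 < b)%nat -> candidate_pole b A s ->
  exists (m : nat) (k : Z), Re s = (log_base b (INR (length A)) - INR m)%R /\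
    Im s = (IZR k * (2 * PI / ln (INR b)))%R.
Proof.
intros Hb (m & k & ->). exists m, k.
assert (Hl : (ln (INR b) <> 0)%R).
{ apply Rgt_not_eq. rewrite <- ln_1. apply ln_increasing; [lra|]. apply (lt_INR 1), Hb. }
split; unfold Re, Im; cbn; field; repeat split; try nra.
Qed.

(** * Values at the negative integers *)

Lemma dirichlet_defect_neg_nat b A K m :
  digit_set b A -> (1 < length A < b)%nat -> restricted_dirichlet b A K ->
  dirichlet_defect b A K m (RtoC (- INR m)) = 0.
Proof.
intros HA HN HK. assert (Hb : (1 < b)%nat) by lia.
assert (Hsg := log_base_between b _ HN).
assert (Hl : (0 < ln (INR b))%R).
{ rewrite <- ln_1. apply ln_increasing; [lra|]. apply (lt_INR 1), Hb. }
(* Half the vertical spacing of the candidate poles; the segment runs from 2 + i h to -m. *)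
set (h := (PI / ln (INR b))%R).
assert (Hh : (0 < h)%R) by (unfold h; apply Rdiv_lt_0_compat; [apply PI_RGT_0 | exact Hl]).
assert (HRe : forall u, Re ((2, h)%R + RtoC u * (RtoC (- INR m) - (2, h)%R)) = (2 - u * (INR m + 2))%R)
  by (intros u; unfold Re; cbn; ring).
assert (HIm : forall u, Im ((2, h)%R + RtoC u * (RtoC (- INR m) - (2, h)%R)) = (h * (1 - u))%R)
  by (intros u; unfold Im; cbn; ring).
assert (Hm := pos_INR m).
(* For u < 1/(m + 2) the real part 2 - u (m + 2) stays above 1, which exceeds log_b N. *)
apply (analytic_identity_segment _ (2, h)%R _ (/ (INR m + 2))).
- apply Rinv_0_lt_compat. lra.
- intros u Hu. apply analytic_at_dirichlet_defect; try assumption.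
  + rewrite HRe, S_INR. nra.
  + intros Hp. apply candidate_pole_Re_Im in Hp; [|exact Hb].
    destruct Hp as (j & k & H1 & H2). rewrite HRe in H1. rewrite HIm in H2.
    replace (IZR k * (2 * PI / ln (INR b)))%R with (h * (2 * IZR k))%R in H2 by (unfold h; field; lra).
    apply Rmult_eq_reg_l in H2; [|lra].
    (* A candidate pole on the segment satisfies 1 - u = 2 k with 0 <= u <= 1, so k = 0 and u = 1.
       At that endpoint log_b N would be an integer strictly between 0 and 1. *)
    assert (k0 : k = 0%Z).
    { assert (0 <= k)%Z by (apply Z.lt_succ_r, lt_IZR; unfold Z.succ; rewrite plus_IZR; lra).
      assert (k < 1)%Z by (apply lt_IZR; lra). lia. }
    subst k. assert (u = 1%R) by lra. subst u.
    assert (H3 : (log_base b (INR (length A)) = INR j - INR m)%R) by lra.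
    rewrite !INR_IZR_INZ, <- minus_IZR in H3. rewrite <- INR_IZR_INZ in H3. rewrite H3 in Hsg.
    destruct Hsg as [h1 h2]. apply lt_IZR in h1, h2. lia.
- intros u Hu. apply dirichlet_defect_half_plane; try assumption. rewrite HRe.
  assert (u * (INR m + 2) < 1)%R; [|lra].
  destruct Hu as [_ Hu]. apply (Rmult_lt_compat_r (INR m + 2)) in Hu; [|lra].
  rewrite Rinv_l in Hu by lra. exact Hu.
Qed.

Lemma Cexp_ln_neg_nat b m : (0 < b)%nat -> Cexp (RtoC (- INR m) * RtoC (ln (INR b))) = / bpow b m.
Proof.
intros Hb. apply lt_0_INR in Hb. unfold bpow.
rewrite <- RtoC_mult, Cexp_RtoC, Ropp_mult_distr_l_reverse, exp_Ropp, <- ln_pow by exact Hb.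
assert (0 < INR b ^ m)%R by (apply pow_lt, Hb).
rewrite exp_ln by assumption. apply RtoC_inv. lra.
Qed.

Lemma lsum_const {T} c (L : list T) : lsum (fun _ => c) L = RtoC (INR (length L)) * c.
Proof.
unfold lsum. induction L as [|x L IH]; cbn [map fold_right length]; [cbn; ring|].
rewrite IH, S_INR, RtoC_plus. ring.
Qed.

Lemma Cminus_eq_0 (x y : C) : x - y = 0 -> x = y.
Proof. intros H. replace x with (x - y + y) by ring. rewrite H. ring. Qed.

(** Common source of the value at 0 and of the recurrence. At m = 0 the sum over nonzero digits is
    N_1 while gamma_0 = N, which is why K(0) has a formula of its own. *)
Lemma dirichlet_neg_nat_eq b A K m :
  digit_set b A -> (1 < length A < b)%nat -> restricted_dirichlet b A K ->
  / bpow b m * (K (RtoC (- INR m)) - lsum (fun a => RtoC (INR a ^ m)) (nonzero_digits A))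
  = csum_n (fun j => RtoC (Binomial.C m j) * (RtoC (INR (gamma A j)) / bpow b j)
                     * K (RtoC (- INR m + INR j))) m.
Proof.
intros HA HN HK.
assert (H := dirichlet_defect_neg_nat b A K m HA HN HK). unfold dirichlet_defect in H.
rewrite Cexp_ln_neg_nat in H by lia.
replace (dirichlet_tail b A K m (RtoC (- INR m))) with (RtoC 0) in H.
- rewrite Cplus_0_r in H.
  rewrite (lsum_ext (npow (RtoC (- INR m))) (fun a => RtoC (INR a ^ m))) in H.
  + apply Cminus_eq_0 in H. rewrite H. apply sum_n_ext_loc. intros j Hj.
    unfold coef. rewrite <- RtoC_opp, Ropp_involutive, cbinom_nat_le by exact Hj.
    unfold bpow. rewrite RtoC_plus. reflexivity.
  + intros a Ha. apply npow_neg_nat. apply filter_In in Ha. destruct a; [destruct Ha; discriminate | lia].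
- symmetry. apply Csum_unique.
  apply (C_is_series_ext (fun _ => 0)); [|apply C_is_series_0].
  intros k. unfold coef. rewrite <- RtoC_opp, Ropp_involutive, cbinom_nat_gt by lia. ring.
Qed.

Lemma gamma_0 A : gamma A 0 = length A.
Proof. unfold gamma, list_sum. induction A as [|a A IH]; cbn [map fold_right length]; [reflexivity | rewrite IH; reflexivity]. Qed.

Lemma dirichlet_at_0 b A K :
  digit_set b A -> (1 < length A < b)%nat -> restricted_dirichlet b A K ->
  K 0 = RtoC (- (INR (length (nonzero_digits A)) / (INR (length A) - 1))).
Proof.
intros HA HN HK. assert (H := dirichlet_neg_nat_eq b A K 0 HA HN HK).
rewrite sum_O, gamma_0 in H. unfold bpow in H. cbn [INR pow] in H. rewrite Ropp_0, Rplus_0_r in H.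
rewrite (lsum_const 1) in H.
replace (Binomial.C 0 0) with 1%R in H by (unfold Binomial.C; cbn; field).
assert (h : (1 < INR (length A))%R) by (apply (lt_INR 1); lia).
assert (h' : RtoC (INR (length A)) - 1 <> 0) by (rewrite <- RtoC_minus; apply RtoC_neq_0; lra).
rewrite RtoC_opp, RtoC_div, RtoC_minus by lra.
assert (E : (RtoC (INR (length A)) - 1) * K 0 = - RtoC (INR (length (nonzero_digits A)))).
{ replace (/ 1 * (K 0 - INR (length (nonzero_digits A)) * 1)) with (K 0 - INR (length (nonzero_digits A))) in H
    by (field; apply RtoC_neq_0; lra).
  replace (1 * (INR (length A) / 1) * K 0) with (RtoC (INR (length A)) * K 0) in H
    by (field; apply RtoC_neq_0; lra).
  transitivity (RtoC (INR (length A)) * K 0 - K 0); [ring|]. rewrite <- H. ring. }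
transitivity ((RtoC (INR (length A)) - 1) * K 0 / (RtoC (INR (length A)) - 1)); [field; exact h'|].
rewrite E. field. exact h'.
Qed.

Lemma dirichlet_recurrence b A K m :
  digit_set b A -> (1 < length A < b)%nat -> restricted_dirichlet b A K -> (1 <= m)%nat ->
  (/ bpow b m - RtoC (INR (length A))) * K (RtoC (- INR m)) =
  RtoC (INR (gamma A m)) / bpow b m +
  sum_n_m (G := C_AbelianGroup)
    (fun j => RtoC (Binomial.C m j) * (RtoC (INR (gamma A j)) / bpow b j)
              * K (RtoC (- INR m + INR j))) 1 m.
Proof.
intros HA HN HK Hm. assert (H := dirichlet_neg_nat_eq b A K m HA HN HK).
unfold sum_n in H. rewrite sum_Sn_m in H by lia.
change (plus ?x ?y) with (x + y) in H. rewrite gamma_0 in H.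
replace (Binomial.C m 0) with 1%R in H
  by (unfold Binomial.C; rewrite Nat.sub_0_r; cbn [fact]; rewrite INR_1; field; apply INR_fact_neq_0).
replace (bpow b 0) with (RtoC 1) in H by reflexivity.
rewrite INR_0, Rplus_0_r in H.
(* For m >= 1 a digit 0 contributes 0^m = 0, so it may be restored. *)
replace (lsum (fun a => RtoC (INR a ^ m)) (nonzero_digits A)) with (RtoC (INR (gamma A m))) in H.
- set (S := sum_n_m _ 1 m) in *. clearbody S.
  replace (1 * (INR (length A) / 1) * K (RtoC (- INR m))) with (RtoC (INR (length A)) * K (RtoC (- INR m))) in H
    by (field; apply RtoC_neq_0; lra).
  unfold Cdiv. set (x := RtoC (INR (length A)) * K (RtoC (- INR m))) in *.
  transitivity (/ bpow b m * (K (RtoC (- INR m)) - RtoC (INR (gamma A m))) + RtoC (INR (gamma A m)) * / bpow b m - x);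
    [unfold x; ring|]. rewrite H. ring.
- rewrite gamma_lsum. unfold nonzero_digits. rewrite <- lsum_filter. apply lsum_ext. intros a _.
  destruct a; [|reflexivity]. cbn [Nat.eqb negb]. rewrite INR_0, pow_i by lia. reflexivity.
Qed.

(** * Rationality and vanishing of the values *)

Definition rational (z : C) : Prop :=
  exists p q : Z, q <> 0%Z /\ z = RtoC (IZR p / IZR q).

Lemma rational_IZR p : rational (RtoC (IZR p)).
Proof. exists p, 1%Z. split; [discriminate|]. f_equal. field. Qed.

Lemma rational_INR n : rational (RtoC (INR n)).
Proof. rewrite INR_IZR_INZ. apply rational_IZR. Qed.

Lemma rational_plus x y : rational x -> rational y -> rational (x + y).
Proof.
intros (p & q & Hq & ->) (p' & q' & Hq' & ->). exists (p * q' + p' * q)%Z, (q * q')%Z. split; [nia|].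
rewrite <- RtoC_plus, plus_IZR, !mult_IZR. f_equal. field. split; apply eq_IZR_contrapositive; assumption.
Qed.

Lemma rational_mult x y : rational x -> rational y -> rational (x * y).
Proof.
intros (p & q & Hq & ->) (p' & q' & Hq' & ->). exists (p * p')%Z, (q * q')%Z. split; [nia|].
rewrite <- RtoC_mult, !mult_IZR. f_equal. field. split; apply eq_IZR_contrapositive; assumption.
Qed.

Lemma rational_opp x : rational x -> rational (- x).
Proof.
intros (p & q & Hq & ->). exists (- p)%Z, q. split; [exact Hq|].
rewrite <- RtoC_opp, opp_IZR. f_equal. unfold Rdiv. ring.
Qed.

Lemma rational_inv x : rational x -> x <> 0 -> rational (/ x).
Proof.
intros (p & q & Hq & ->) Hx.
assert (Hp : p <> 0%Z) by (intros ->; apply Hx; f_equal; unfold Rdiv; ring).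
apply eq_IZR_contrapositive in Hp as Hp', Hq as Hq'.
exists q, p. split; [exact Hp|]. rewrite <- RtoC_inv; [f_equal; field; split; assumption|].
intros h. apply Hx. f_equal. exact h.
Qed.

Lemma rational_sum_n_m (u : nat -> C) n m :
  (forall j, (n <= j <= m)%nat -> rational (u j)) -> rational (csum_n_m u n m).
Proof.
induction m as [|m IH]; intros H.
- destruct n as [|n].
  + rewrite sum_n_n. apply H. lia.
  + rewrite sum_n_m_zero by lia. apply (rational_IZR 0).
- destruct (le_lt_dec n (S m)) as [h|h].
  + rewrite sum_n_Sm by exact h. apply rational_plus; [apply IH; intros; apply H; lia | apply H; lia].
  + rewrite sum_n_m_zero by lia. apply (rational_IZR 0).
Qed.

Lemma bpow_INR b m : bpow b m = RtoC (INR (b ^ m)).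
Proof. unfold bpow. rewrite pow_INR. reflexivity. Qed.

Lemma bpow_neq_0 b m : (0 < b)%nat -> bpow b m <> 0.
Proof. intros Hb. apply RtoC_neq_0, pow_nonzero, not_0_INR. lia. Qed.

Lemma inv_bpow_minus b m N :
  (1 < b)%nat -> / bpow b m - RtoC (INR N) = RtoC (/ INR b ^ m - INR N).
Proof.
intros Hb. unfold bpow. rewrite RtoC_minus, RtoC_inv; [reflexivity|].
apply pow_nonzero, not_0_INR. lia.
Qed.

Lemma inv_pow_le b m : (1 < b)%nat -> (1 <= m)%nat -> (/ INR b ^ m <= / 2)%R.
Proof.
intros Hb Hm. assert (2 <= INR b)%R by (apply (le_INR 2); lia).
apply Rinv_le_contravar; [lra|]. destruct m as [|m]; [lia|]. cbn [pow].
assert (1 <= INR b ^ m)%R by (apply pow_R1_Rle; lra). nra.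
Qed.

Lemma inv_bpow_minus_neq_0 b m N :
  (1 < b)%nat -> (1 <= m)%nat -> (1 < N)%nat -> / bpow b m - RtoC (INR N) <> 0.
Proof.
intros Hb Hm HN. rewrite inv_bpow_minus by exact Hb. apply RtoC_neq_0.
assert (h := inv_pow_le b m Hb Hm). apply lt_INR in HN. rewrite INR_1 in HN. lra.
Qed.

Lemma opp_INR_plus m j : (j <= m)%nat -> (- INR m + INR j = - INR (m - j))%R.
Proof. intros H. rewrite minus_INR by exact H. ring. Qed.

Lemma K_rational b A K :
  digit_set b A -> (1 < length A < b)%nat -> restricted_dirichlet b A K ->
  forall m, rational (K (RtoC (- INR m))).
Proof.
intros HA HN HK m. induction m as [m IH] using lt_wf_ind.
destruct (Nat.eq_dec m 0) as [->|Hm].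
- rewrite INR_0, Ropp_0, (dirichlet_at_0 b A K HA HN HK).
  rewrite RtoC_opp, RtoC_div by (apply Rgt_not_eq, Rlt_0_minus, (lt_INR 1); lia).
  apply rational_opp, rational_mult; [apply rational_INR|].
  apply rational_inv; [rewrite RtoC_minus; apply rational_plus; [apply rational_INR | apply rational_opp, (rational_INR 1)]|].
  apply RtoC_neq_0, Rgt_not_eq, Rlt_0_minus, (lt_INR 1). lia.
- assert (H := dirichlet_recurrence b A K m HA HN HK ltac:(lia)).
  assert (Hn := inv_bpow_minus_neq_0 b m (length A) ltac:(lia) ltac:(lia) ltac:(lia)).
  assert (Hbp : forall j, rational (/ bpow b j)).
  { intros j. apply rational_inv; [rewrite bpow_INR; apply rational_INR | apply bpow_neq_0; lia]. }
  set (d := / bpow b m - RtoC (INR (length A))) in *.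
  replace (K (RtoC (- INR m))) with (/ d * (d * K (RtoC (- INR m)))) by (field; exact Hn).
  rewrite H. apply rational_mult.
  + apply rational_inv; [|exact Hn]. apply rational_plus; [apply Hbp | apply rational_opp, rational_INR].
  + apply rational_plus; [apply rational_mult; [apply rational_INR | apply Hbp]|].
    apply rational_sum_n_m. intros j Hj. apply rational_mult; [apply rational_mult|].
    * unfold Binomial.C. rewrite RtoC_div by (apply Rmult_integral_contrapositive; split; apply INR_fact_neq_0).
      apply rational_mult; [apply rational_INR|]. rewrite <- mult_INR. apply rational_inv; [apply rational_INR|].
      apply RtoC_neq_0. rewrite mult_INR. apply Rmult_integral_contrapositive; split; apply INR_fact_neq_0.
    * apply rational_mult; [apply rational_INR | apply Hbp].
    * rewrite opp_INR_plus by lia. apply IH. lia.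
Qed.

Lemma length_nonzero_digits A :
  NoDup A -> (length (nonzero_digits A) + (if in_dec Nat.eq_dec 0%nat A then 1 else 0) = length A)%nat.
Proof.
unfold nonzero_digits. induction 1 as [|a A Ha HA IH]; [reflexivity|].
destruct (in_dec Nat.eq_dec 0%nat (a :: A)) as [h|h], (in_dec Nat.eq_dec 0%nat A) as [h'|h'];
  destruct a as [|a]; cbn [filter Nat.eqb negb length]; try lia; exfalso.
- contradiction.
- destruct h as [h|h]; [discriminate | contradiction].
- apply h. right. exact h'.
- apply h. right. exact h'.
- apply h. left. reflexivity.
Qed.

(** By strong induction only the term j = m survives in the recurrence; with K(0) = -1 it cancels
    gamma_m / b^m, and b^(-m) - N is nonzero. *)
Lemma K_neg_zero b A K :
  digit_set b A -> (1 < length A < b)%nat -> restricted_dirichlet b A K ->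
  K 0 = RtoC (-1) -> forall m, (1 <= m)%nat -> K (RtoC (- INR m)) = 0.
Proof.
intros HA HN HK H0 m. induction m as [m IH] using lt_wf_ind. intros Hm.
assert (H := dirichlet_recurrence b A K m HA HN HK Hm).
assert (Hn := inv_bpow_minus_neq_0 b m (length A) ltac:(lia) ltac:(lia) ltac:(lia)).
destruct m as [|m]; [lia|]. rewrite sum_n_Sm in H by lia.
rewrite (sum_n_m_ext_loc _ (fun _ => zero)) in H.
- rewrite sum_n_m_const_zero, Rplus_opp_l, H0 in H.
  replace (Binomial.C (S m) (S m)) with 1%R in H
    by (unfold Binomial.C; rewrite Nat.sub_diag; cbn [fact]; rewrite INR_1; field; apply (INR_fact_neq_0 (S m))).
  change (plus ?x ?y) with (x + y) in H. change (zero : C) with (RtoC 0) in H.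
  apply NNPP. intros h. apply (Cmult_neq_0 _ _ Hn h). rewrite H. replace (RtoC (-1)) with (- RtoC 1) by (rewrite <- RtoC_opp; reflexivity). ring.
- intros j Hj. rewrite opp_INR_plus, IH by lia. change (zero : C) with (RtoC 0). cring.
Qed.

(** * Taylor coefficients of the generating function *)

(** Taylor coefficient of t -> alpha(t/b), see [alpha_series]. *)
Definition alpha_coeff (b : nat) (A : list nat) (j : nat) : C :=
  RtoC (INR (gamma A j)) / bpow b j / RtoC (INR (fact j)).

(** Division by m! turns the binomial convolution into a Cauchy product. *)
Lemma egf_recurrence_pos b A K m :
  digit_set b A -> (1 < length A < b)%nat -> restricted_dirichlet b A K -> (1 <= m)%nat ->
  (/ bpow b m - RtoC (INR (length A))) * egf_coeff K m =
  alpha_coeff b A m + csum_n_m (fun j => alpha_coeff b A j * egf_coeff K (m - j)) 1 m.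
Proof.
intros HA HN HK Hm. assert (H := dirichlet_recurrence b A K m HA HN HK Hm).
unfold egf_coeff at 1, alpha_coeff at 1.
assert (Hf := INR_fact_neq_0_C m).
transitivity ((/ bpow b m - RtoC (INR (length A))) * K (RtoC (- INR m)) * / RtoC (INR (fact m)));
  [unfold Cdiv; ring|].
rewrite H, Cmult_plus_distr_r. f_equal.
rewrite Cmult_comm. change (/ RtoC (INR (fact m)) * ?x) with (mult (K := C_Ring) (/ RtoC (INR (fact m))) x).
rewrite <- (sum_n_m_mult_l (K := C_Ring)). apply sum_n_m_ext_loc. intros j Hj.
unfold mult; cbn -[INR]. unfold alpha_coeff, egf_coeff. rewrite opp_INR_plus by lia.
unfold Binomial.C.
assert (h1 := INR_fact_neq_0 j). assert (h2 := INR_fact_neq_0 (m - j)).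
rewrite RtoC_div, RtoC_mult by (apply Rmult_integral_contrapositive; split; assumption).
match goal with |- @eq _ ?x ?y => change (@eq C x y) end.
field. repeat split; try apply INR_fact_neq_0_C. apply bpow_neq_0. lia.
Qed.

(** For m >= 1 the term N c_m moves to the right, as the term j = 0 of the Cauchy product. At m = 0
    the identity reads K(0) = N + N K(0), which holds because N_1 = N when 0 is not a digit. *)
Lemma egf_recurrence b A K m :
  digit_set b A -> (1 < length A < b)%nat -> restricted_dirichlet b A K -> ~ In 0%nat A ->
  egf_coeff K m / bpow b m =
  alpha_coeff b A m + cauchy_prod (alpha_coeff b A) (egf_coeff K) m.
Proof.
intros HA HN HK H0.
assert (E0 : alpha_coeff b A 0 = RtoC (INR (length A))).
{ unfold alpha_coeff. rewrite gamma_0. unfold bpow. cbn [fact pow]. rewrite INR_1. field. }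
unfold cauchy_prod. destruct (Nat.eq_dec m 0) as [->|Hm].
- rewrite sum_O, E0, Nat.sub_diag. unfold egf_coeff. rewrite INR_0, Ropp_0, (dirichlet_at_0 b A K HA HN HK).
  assert (HL := length_nonzero_digits A (proj1 HA)). destruct (in_dec Nat.eq_dec 0%nat A) as [h|_]; [contradiction|].
  rewrite Nat.add_0_r in HL. rewrite HL.
  assert (1 < INR (length A))%R by (apply (lt_INR 1); lia).
  unfold bpow. cbn [fact pow]. rewrite INR_1, RtoC_opp, RtoC_div, RtoC_minus by lra.
  match goal with |- @eq _ ?x ?y => change (@eq C x y) end.
  field. cbv beta. rewrite <- RtoC_minus. apply RtoC_neq_0. lra.
- unfold sum_n. rewrite sum_Sn_m by lia. change (plus ?x ?y) with (x + y). rewrite Nat.sub_0_r, E0.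
  assert (H := egf_recurrence_pos b A K m HA HN HK ltac:(lia)).
  set (s := csum_n_m _ 1 m) in *. clearbody s.
  transitivity ((/ bpow b m - RtoC (INR (length A))) * egf_coeff K m + RtoC (INR (length A)) * egf_coeff K m);
    [unfold Cdiv; ring|]. rewrite H. cring.
Qed.

Lemma Cmod_alpha_coeff_le b A j :
  (1 < b)%nat -> digit_set b A -> (Cmod (alpha_coeff b A j) <= INR (length A))%R.
Proof.
intros Hb HA. unfold alpha_coeff. rewrite Cmod_div by apply INR_fact_neq_0_C.
rewrite (Cmod_RtoC_pos (INR (fact j))) by apply pos_INR.
assert (H := Cmod_gamma_le b A j Hb HA). assert (Hd := digit_ratio b Hb).
assert (h1 : (1 <= INR (fact j))%R) by (apply (le_INR 1), lt_O_fact).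
assert (h2 : (((INR b - 1) / INR b) ^ j <= 1)%R).
{ eapply Rle_trans; [apply (pow_incr _ 1); lra | rewrite pow1; lra]. }
assert (h3 := pos_INR (length A)). fold (bpow b j) in H.
apply Rle_trans with (INR (length A) / INR (fact j))%R.
- apply Rmult_le_compat_r; [left; apply Rinv_0_lt_compat; lra|].
  eapply Rle_trans; [exact H|]. rewrite <- (Rmult_1_r (INR (length A))) at 2.
  apply Rmult_le_compat_l; assumption.
- apply (Rmult_le_reg_r (INR (fact j))); [lra|]. unfold Rdiv. rewrite Rmult_assoc, Rinv_l by lra. nra.
Qed.

Lemma Cmod_sum_n_m_le (u : nat -> C) n m :
  (Cmod (csum_n_m u n m) <= sum_n_m (fun k => Cmod (u k)) n m)%R.
Proof.
induction m as [|m IH].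
- destruct n as [|n]; [rewrite !sum_n_n; lra|]. rewrite !sum_n_m_zero by lia.
  change (Cmod (RtoC 0) <= 0)%R. rewrite Cmod_0. lra.
- destruct (le_lt_dec n (S m)) as [h|h].
  + rewrite !sum_n_Sm by exact h. eapply Rle_trans; [apply Cmod_triangle|]. apply Rplus_le_compat_r, IH.
  + rewrite !sum_n_m_zero by lia. change (Cmod (RtoC 0) <= 0)%R. rewrite Cmod_0. lra.
Qed.

Lemma sum_n_m_le_loc (u v : nat -> R) n m :
  (forall j, (n <= j <= m)%nat -> (u j <= v j)%R) -> (sum_n_m u n m <= sum_n_m v n m)%R.
Proof.
induction m as [|m IH]; intros H.
- destruct n as [|n]; [rewrite !sum_n_n; apply H; lia | rewrite !sum_n_m_zero by lia; lra].
- destruct (le_lt_dec n (S m)) as [h|h].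
  + rewrite !sum_n_Sm by exact h. apply Rplus_le_compat; [apply IH; intros; apply H; lia | apply H; lia].
  + rewrite !sum_n_m_zero by lia. lra.
Qed.

Lemma sum_third n : sum_n_m (fun j => 2 * (/ 3) ^ j)%R 1 n = (1 - (/ 3) ^ n)%R.
Proof.
induction n as [|n IH].
- rewrite sum_n_m_zero by lia. unfold zero; cbn. ring.
- rewrite sum_n_Sm, IH by lia. unfold plus; cbn. field.
Qed.

(** The constants close the induction exactly. From N - b^(-m) >= N/2 and |alpha_j| <= N, the
    induction hypothesis gives (N/2) |c_m| <= N + N sum_(1<=j<=m) 2 3^(m-j) = N + N (3^m - 1) = N
    3^m. For m = 0, N_1/(N - 1) <= 2 because N >= 2. *)
Lemma Cmod_egf_coeff_le b A K :
  digit_set b A -> (1 < length A < b)%nat -> restricted_dirichlet b A K ->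
  forall m, (Cmod (egf_coeff K m) <= 2 * 3 ^ m)%R.
Proof.
intros HA HN HK m. induction m as [m IH] using lt_wf_ind.
assert (HN2 : (2 <= INR (length A))%R) by (apply (le_INR 2); lia).
destruct (Nat.eq_dec m 0) as [->|Hm].
- unfold egf_coeff. rewrite INR_0, Ropp_0, (dirichlet_at_0 b A K HA HN HK). cbn [fact]. rewrite INR_1.
  rewrite <- RtoC_div by lra. rewrite Cmod_R. rewrite Rdiv_1_r, Rabs_Ropp.
  assert (HL := length_nonzero_digits A (proj1 HA)).
  assert (h : (INR (length (nonzero_digits A)) <= INR (length A))%R) by (apply le_INR; lia).
  assert (h' := pos_INR (length (nonzero_digits A))).
  rewrite Rabs_pos_eq by (apply Rdiv_le_0_compat; lra).
  apply (Rmult_le_reg_r (INR (length A) - 1)); [lra|]. unfold Rdiv. rewrite Rmult_assoc, Rinv_l by lra.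
  cbn. nra.
- assert (H := f_equal Cmod (egf_recurrence_pos b A K m HA HN HK ltac:(lia))).
  rewrite inv_bpow_minus, Cmod_mult, Cmod_R in H by lia.
  assert (hb := inv_pow_le b m ltac:(lia) ltac:(lia)).
  rewrite Rabs_left in H by lra.
  assert (Hs : (Cmod (csum_n_m (fun j => alpha_coeff b A j * egf_coeff K (m - j)%nat)%C 1 m)
     <= INR (length A) * (3 ^ m - 1))%R).
  { eapply Rle_trans; [apply Cmod_sum_n_m_le|].
    replace (3 ^ m - 1)%R with (3 ^ m * (1 - (/ 3) ^ m))%R
      by (rewrite pow_inv; field; apply pow_nonzero; lra).
    rewrite <- sum_third.
    change (INR (length A) * (3 ^ m * ?x))%R with (mult (INR (length A)) (mult (3 ^ m)%R x)).
    rewrite <- !(sum_n_m_mult_l (K := R_Ring)).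
    apply sum_n_m_le_loc. intros j Hj. rewrite Cmod_mult.
    apply Rmult_le_compat; try apply Cmod_ge_0; [apply Cmod_alpha_coeff_le; [lia | exact HA]|].
    eapply Rle_trans; [apply IH; lia|]. apply Req_le.
    replace m with (m - j + j)%nat at 2 by lia. rewrite pow_add, pow_inv.
    unfold mult; cbn. field. apply pow_nonzero. lra. }
  assert (Ht := Cmod_triangle (alpha_coeff b A m)
    (csum_n_m (fun j => alpha_coeff b A j * egf_coeff K (m - j)) 1 m)).
  rewrite <- H in Ht. assert (Ha := Cmod_alpha_coeff_le b A m ltac:(lia) HA).
  assert (hc := Cmod_ge_0 (egf_coeff K m)). assert (h3 : (0 < 3 ^ m)%R) by (apply pow_lt; lra).
  set (c := Cmod (egf_coeff K m)) in *. set (N := INR (length A)) in *. set (y := (3 ^ m)%R) in *.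
  set (x := (/ INR b ^ m)%R) in *.
  assert (Hx : (N / 2 * c <= - (x - N) * c)%R) by (apply Rmult_le_compat_r; lra).
  assert (N * c <= N * (2 * y))%R by lra. apply Rmult_le_reg_l in H0; lra.
Qed.

(** * The generating function *)

Lemma alpha_lsum A t : alpha A t = lsum (fun a => Cexp (RtoC (INR a) * t)) A.
Proof. reflexivity. Qed.

Lemma alpha_0 A : alpha A 0 = RtoC (INR (length A)).
Proof.
rewrite alpha_lsum, (lsum_ext _ (fun _ => RtoC 1)).
- rewrite lsum_const. ring.
- intros a _. rewrite Cmult_0_r. apply Cexp_0.
Qed.

Lemma analytic_at_alpha A z : analytic_at (alpha A) z.
Proof.
apply (analytic_at_lsum (fun a t => Cexp (RtoC (INR a) * t))). intros a _.
apply (analytic_at_ext (fun t => Cexp (RtoC (INR a) * t + 0))); [|apply analytic_at_Cexp].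
exists 1%R. split; [lra|]. intros w _. rewrite Cplus_0_r. reflexivity.
Qed.

(** Vanishing near [z] would propagate along the segment to 0, where [alpha] equals the number of
    digits. *)
Lemma alpha_not_locally_zero A z r :
  (0 < length A)%nat -> (0 < r)%R -> ~ (forall w, (Cmod (w - z) < r)%R -> alpha A w = 0).
Proof.
intros HA Hr H.
assert (E : alpha A 0 = 0).
{ assert (hz := Cmod_ge_0 z).
  apply (analytic_identity_segment _ z 0 (r / (Cmod z + 1))).
  - apply Rdiv_lt_0_compat; lra.
  - intros u _. apply analytic_at_alpha.
  - intros u Hu. apply H. replace (z + u * (0 - z) - z) with (- (RtoC u * z)) by ring.
    rewrite Cmod_opp, Cmod_mult, Cmod_RtoC_pos by lra.
    apply Rle_lt_trans with (u * (Cmod z + 1))%R; [nra|].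
    destruct Hu as [_ Hu]. apply (Rmult_lt_compat_r (Cmod z + 1)) in Hu; [|lra].
    replace (r / (Cmod z + 1) * (Cmod z + 1))%R with r in Hu by (field; lra). exact Hu. }
rewrite alpha_0 in E. revert E. apply RtoC_neq_0. apply lt_0_INR in HA. lra.
Qed.

Lemma alpha_series b A t :
  (0 < b)%nat -> C_is_series (fun j => alpha_coeff b A j * Cpow t j) (alpha A (t / bpow b 1)).
Proof.
intros Hb. assert (Hb' : RtoC (INR b) <> 0) by (apply RtoC_neq_0, not_0_INR; lia).
assert (Hbp : forall j, bpow b j = Cpow (RtoC (INR b)) j) by (intros j; unfold bpow; apply RtoC_pow).
rewrite alpha_lsum.
apply (C_is_series_ext (fun j => lsum (fun a => Cpow (RtoC (INR a) * (t / bpow b 1)) j / RtoC (INR (fact j))) A)).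
- intros j. unfold alpha_coeff. rewrite gamma_lsum, !Hbp.
  transitivity (Cpow t j / Cpow (RtoC (INR b)) j / RtoC (INR (fact j)) * lsum (fun a => RtoC (INR a ^ j)) A);
    [|unfold Cdiv; ring].
  rewrite <- lsum_scal. apply lsum_ext. intros a _. rewrite RtoC_pow. cbn [Cpow]. rewrite Cmult_1_r.
  unfold Cdiv. rewrite !Cpow_mult_l, Cpow_inv by exact Hb'. ring.
- apply C_is_series_lsum. intros a _. apply Cexp_series.
Qed.

Definition in_disc (c : nat -> C) (t : C) : Prop := Rbar_lt (Cmod t) (C_radius c).

Definition disc_sum (c : nat -> C) (t : C) : C := Csum (fun m => c m * Cpow t m).

Lemma in_disc_summable c t : in_disc c t -> ex_series (fun m => Cmod (c m) * Cmod t ^ m)%R.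
Proof.
intros H. unfold in_disc, C_radius in H.
rewrite <- (Rabs_pos_eq (Cmod t)) in H by apply Cmod_ge_0.
apply CV_disk_inside in H. revert H. apply ex_series_ext. intros m.
apply Rabs_pos_eq, Rmult_le_pos; [apply Cmod_ge_0 | apply pow_le, Cmod_ge_0].
Qed.

Lemma disc_sum_series c t : in_disc c t -> C_is_series (fun m => c m * Cpow t m) (disc_sum c t).
Proof.
intros H. apply in_disc_summable in H as [T HT].
refine (proj1 (C_is_series_dominated _ _ T _ HT)). intros m. apply term_le. lra.
Qed.

Lemma in_disc_le c t t' : (Cmod t' <= Cmod t)%R -> in_disc c t -> in_disc c t'.
Proof. intros H. unfold in_disc. apply Rbar_le_lt_trans. exact H. Qed.

(** Summability at the one real point |z| + r controls the series on the whole disc of radius [r]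
    about [z]. *)
Lemma in_disc_open c z :
  in_disc c z -> exists r, (0 < r)%R /\ in_disc c (RtoC (Cmod z + r)).
Proof.
unfold in_disc. assert (hz := Cmod_ge_0 z). intros H.
destruct (C_radius c) as [rho| |]; cbn in H; [|exists 1%R; split; [lra | exact I]|contradiction].
exists ((rho - Cmod z) / 2)%R. split; [lra|]. cbn. rewrite Cmod_RtoC_pos by lra. lra.
Qed.

Lemma in_disc_near c z :
  in_disc c z -> exists r, (0 < r)%R /\ forall w, (Cmod (w - z) < r)%R -> in_disc c w.
Proof.
intros H. destruct (in_disc_open c z H) as [r [Hr Hd]]. exists r. split; [exact Hr|].
intros w Hw. revert Hd. apply in_disc_le. assert (hz := Cmod_ge_0 z). rewrite Cmod_RtoC_pos by lra.
replace w with (w - z + z) by ring. eapply Rle_trans; [apply Cmod_triangle|]. lra.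
Qed.

(** Re-expansion at [z]: since w^m = ((w - z) + z)^m has norm at most (r + |z|)^m, the norms add up
    to the absolute series at |z| + r. *)
Lemma analytic_at_disc_sum c z : in_disc c z -> analytic_at (disc_sum c) z.
Proof.
intros H. destruct (in_disc_open c z H) as [r [Hr Hd]].
assert (hz := Cmod_ge_0 z).
assert (Hd' := in_disc_summable _ _ Hd). rewrite Cmod_RtoC_pos in Hd' by lra. destruct Hd' as [T HT].
apply analytic_at_wiener. exists r, T. split; [exact Hr|].
apply (wiener_series z r (fun m => Cmod (c m) * (Cmod z + r) ^ m)%R T (fun m w => c m * Cpow w m)).
- exact Hr.
- intros m. apply wiener_mult; [lra | apply wiener_const|].
  apply (wiener_pow z r _ (fun w => w)); [lra|].
  apply (wiener_ext _ _ _ (fun w => w - z + z)); [intros; ring|].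
  apply (wiener_le _ _ (r + Cmod z)); [lra|].
  apply wiener_plus; [lra | apply wiener_shift, Hr | apply wiener_const].
- exact HT.
- intros w Hw. apply disc_sum_series. revert Hd. apply in_disc_le. rewrite Cmod_RtoC_pos by lra.
  replace w with (w - z + z) by ring. eapply Rle_trans; [apply Cmod_triangle|]. lra.
Qed.

Lemma bpow_S b n : bpow b (S n) = bpow b 1 * bpow b n.
Proof. unfold bpow. rewrite <- RtoC_mult. f_equal. cbn. ring. Qed.

Lemma Cmod_div_bpow b n t : (0 < b)%nat -> Cmod (t / bpow b n) = (Cmod t / INR b ^ n)%R.
Proof.
intros Hb. rewrite Cmod_div by (apply bpow_neq_0, Hb). unfold bpow. rewrite Cmod_RtoC_pos; [reflexivity|].
apply pow_le, pos_INR.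
Qed.

Lemma div_bpow_small b t eps :
  (1 < b)%nat -> (0 < eps)%R -> exists n0, forall n, (n0 <= n)%nat -> (Cmod (t / bpow b n) < eps)%R.
Proof.
intros Hb Heps. assert (Hb' : (1 < INR b)%R) by (apply (lt_INR 1); lia).
assert (ht := Cmod_ge_0 t).
destruct (pow_lt_1_zero (/ INR b)) with (y := (eps / (Cmod t + 1))%R) as [N HN].
- rewrite Rabs_pos_eq by (left; apply Rinv_0_lt_compat; lra). rewrite <- Rinv_1. apply Rinv_lt_contravar; lra.
- apply Rdiv_lt_0_compat; lra.
- exists N. intros n Hn. specialize (HN n Hn). rewrite Cmod_div_bpow by lia.
  assert (hp : (0 < (/ INR b) ^ n)%R) by (apply pow_lt, Rinv_0_lt_compat; lra).
  rewrite Rabs_pos_eq in HN by lra. unfold Rdiv. rewrite <- pow_inv.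
  apply Rle_lt_trans with ((Cmod t + 1) * (/ INR b) ^ n)%R; [nra|].
  apply (Rmult_lt_compat_l (Cmod t + 1)) in HN; [|lra].
  replace ((Cmod t + 1) * (eps / (Cmod t + 1)))%R with eps in HN by (field; lra). exact HN.
Qed.

Lemma in_disc_eventually b c t :
  (1 < b)%nat -> Rbar_lt 0%R (C_radius c) -> exists n, in_disc c (t / bpow b n).
Proof.
intros Hb Hc.
destruct (in_disc_near c 0) as [r [Hr H]]; [unfold in_disc; rewrite Cmod_0; exact Hc|].
destruct (div_bpow_small b t r Hb Hr) as [n Hn]. exists n. apply H.
replace (t / bpow b n - 0) with (t / bpow b n) by ring. apply Hn. lia.
Qed.

(* Extension of the sum of the power series by at most [n] steps of
   [F(t) = -1 + F(t/b) / alpha(t/b)]. *)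
Fixpoint extend (b : nat) (A : list nat) (c : nat -> C) (n : nat) (t : C) : C :=
  match n with
  | O => disc_sum c t
  | S n => if excluded_middle_informative (in_disc c t) then disc_sum c t
           else - (1) + extend b A c n (t / bpow b 1) / alpha A (t / bpow b 1)
  end.

Lemma div_bpow_0 b t : t / bpow b 0 = t.
Proof. change (bpow b 0) with (RtoC 1). field. Qed.

Lemma div_bpow_S b n t : (0 < b)%nat -> t / bpow b 1 / bpow b n = t / bpow b (S n).
Proof.
intros Hb. rewrite (bpow_S b n). assert (h := bpow_neq_0 b n Hb). assert (h1 := bpow_neq_0 b 1 Hb).
field. split; assumption.
Qed.

(** The recursion stops as soon as its argument lies in the disc, so surplus fuel does not change
    the value. *)
Lemma extend_S b A c n t :
  (0 < b)%nat -> in_disc c (t / bpow b n) -> extend b A c (S n) t = extend b A c n t.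
Proof.
intros Hb. revert t. induction n as [|n IH]; intros t H.
- rewrite div_bpow_0 in H. cbn [extend].
  destruct (excluded_middle_informative (in_disc c t)); [reflexivity | contradiction].
- rewrite <- div_bpow_S in H by exact Hb. specialize (IH _ H).
  change (extend b A c (S (S n)) t) with (if excluded_middle_informative (in_disc c t) then disc_sum c t
           else - (1) + extend b A c (S n) (t / bpow b 1) / alpha A (t / bpow b 1)).
  rewrite IH. reflexivity.
Qed.

Lemma in_disc_div c b n t : (0 < b)%nat -> in_disc c t -> in_disc c (t / bpow b n).
Proof.
intros Hb. apply in_disc_le. rewrite Cmod_div_bpow by exact Hb.
assert (h : (1 <= INR b ^ n)%R) by (apply pow_R1_Rle, (le_INR 1); lia).
assert (ht := Cmod_ge_0 t). apply (Rmult_le_reg_r (INR b ^ n)); [lra|].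
unfold Rdiv. rewrite Rmult_assoc, Rinv_l by lra. nra.
Qed.

Lemma extend_add b A c n k t :
  (0 < b)%nat -> in_disc c (t / bpow b n) -> extend b A c (k + n) t = extend b A c n t.
Proof.
intros Hb H. induction k as [|k IH]; [reflexivity|].
change (S k + n)%nat with (S (k + n)). rewrite extend_S; [exact IH | exact Hb|].
replace (t / bpow b (k + n)) with (t / bpow b n / bpow b k); [apply in_disc_div; assumption|].
replace (bpow b (k + n)) with (bpow b k * bpow b n)
  by (unfold bpow; rewrite pow_add, RtoC_mult; reflexivity).
field. split; apply bpow_neq_0, Hb.
Qed.

(** The relation outside the disc holds by construction, for any coefficients. Inside, it is a fact
    about the coefficients and is proved separately. *)
Lemma extend_exists b A c :
  (1 < b)%nat -> Rbar_lt 0%R (C_radius c) ->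
  exists F : C -> C,
    (forall t, in_disc c t -> F t = disc_sum c t) /\
    (forall t, ~ in_disc c t -> F t = - (1) + F (t / bpow b 1) / alpha A (t / bpow b 1)).
Proof.
intros Hb Hc.
destruct (choice_fun _ (fun t => in_disc_eventually b c t Hb Hc)) as [n0 Hn0].
exists (fun t => extend b A c (n0 t) t).
(* Two sufficient amounts of fuel are compared through their sum, so the choice of [n0] is
   immaterial. *)
assert (E : forall t n, in_disc c (t / bpow b n) -> extend b A c (n0 t) t = extend b A c n t).
{ intros t n H. rewrite <- (extend_add b A c (n0 t) n t) by (lia || apply Hn0).
  rewrite Nat.add_comm. apply extend_add; [lia | exact H]. }
split; intros t Ht.
- apply (E t 0%nat). rewrite div_bpow_0. exact Ht.
- rewrite (E t (S (n0 (t / bpow b 1)))).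
  + cbn [extend]. destruct (excluded_middle_informative (in_disc c t)); [contradiction | reflexivity].
  + rewrite <- div_bpow_S by lia. apply Hn0.
Qed.

(** * Meromorphic continuation and the product series *)

(** Form of [meromorphic_at] in which the numerator is an analytic function [h], also at [z] itself,
    so that closure properties of analytic functions apply to it. *)
Definition meromorphic_germ (f : C -> C) (z : C) : Prop :=
  exists k h r, (0 < r)%R /\ analytic_at h z /\
    forall w, (0 < Cmod (w - z) < r)%R -> Cpow (w - z) k * f w = h w.

Lemma meromorphic_germ_at f z : meromorphic_germ f z -> meromorphic_at f z.
Proof.
intros (k & h & r & Hr & (a & s & Hs & Ha) & H).
exists k, a, (Rmin r s). split; [apply Rmin_glb_lt; assumption|].
intros w Hw. assert (h1 := Rmin_l r s). assert (h2 := Rmin_r r s).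
rewrite H by lra. apply Ha. lra.
Qed.

Lemma analytic_meromorphic_germ f z : analytic_at f z -> meromorphic_germ f z.
Proof.
intros H. exists 0%nat, f, 1%R. split; [lra|]. split; [exact H|]. intros w _. cbn. ring.
Qed.

Lemma alpha_prod_S b A t k : alpha_prod b A t (S k) = alpha_prod b A t k * alpha A (t / bpow b (S k)).
Proof.
unfold alpha_prod. rewrite seq_S, map_app, fold_right_app.
generalize (map (fun j => alpha A (t / bpow b j)) (seq 1 k)) as L. cbn [map fold_right Nat.add].
generalize (alpha A (t / bpow b (S k))) as x. intros x. induction L as [|y L IH]; cbn [fold_right]; [ring | rewrite IH; ring].
Qed.

Lemma alpha_singular_div b A t :
  (0 < b)%nat -> alpha_singular b A (t / bpow b 1) -> alpha_singular b A t.
Proof.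
intros Hb (j & z & Hj & Hz & E). exists (S j), z. split; [lia|]. split; [exact Hz|].
assert (h1 := bpow_neq_0 b 1 Hb).
rewrite (bpow_S b j). replace t with (bpow b 1 * (t / bpow b 1)) by (field; exact h1).
rewrite E. ring.
Qed.

Lemma alpha_neq_0 b A t n :
  (0 < b)%nat -> ~ alpha_singular b A t -> alpha A (t / bpow b (S n)) <> 0.
Proof.
intros Hb H E. apply H. exists (S n), (t / bpow b (S n)). split; [lia|]. split; [exact E|].
assert (h := bpow_neq_0 b (S n) Hb). field. exact h.
Qed.

Lemma analytic_at_div_bpow f b z :
  analytic_at f (z / bpow b 1) -> analytic_at (fun w => f (w / bpow b 1)) z.
Proof.
intros H. apply (analytic_at_ext (fun w => f (/ bpow b 1 * w))).
- exists 1%R. split; [lra|]. intros w _. f_equal. unfold Cdiv. ring.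
- apply analytic_at_scale. replace (/ bpow b 1 * z) with (z / bpow b 1) by (unfold Cdiv; ring). exact H.
Qed.

(** Induction on the number of contractions by [b] that bring [z] into the disc. Off the singular
    set alpha(z/b) is nonzero, hence nonzero nearby, and the dilation relation holds on a whole
    neighborhood. *)
Lemma continuation_analytic b A c (F : C -> C) :
  (0 < b)%nat ->
  (forall t, in_disc c t -> F t = disc_sum c t) ->
  (forall t, alpha A (t / bpow b 1) <> 0 -> F t = - (1) + F (t / bpow b 1) / alpha A (t / bpow b 1)) ->
  forall n z, in_disc c (z / bpow b n) -> ~ alpha_singular b A z -> analytic_at F z.
Proof.
intros Hb HP HF. induction n as [|n IH]; intros z Hn Hz.
- rewrite div_bpow_0 in Hn. apply (analytic_at_ext (disc_sum c)); [|apply analytic_at_disc_sum, Hn].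
  destruct (in_disc_near c z Hn) as [r [Hr H]]. exists r. split; [exact Hr|].
  intros w Hw. symmetry. apply HP, H, Hw.
- rewrite <- div_bpow_S in Hn by exact Hb.
  assert (Hz' : ~ alpha_singular b A (z / bpow b 1)) by (intros h; apply Hz, alpha_singular_div; assumption).
  assert (Hal := analytic_at_div_bpow (alpha A) b z (analytic_at_alpha A _)).
  assert (H0 := alpha_neq_0 b A z 0 Hb Hz).
  apply (analytic_at_ext (fun w => - (1) + F (w / bpow b 1) * / alpha A (w / bpow b 1))).
  + destruct (analytic_at_nonzero _ z Hal H0) as [r [Hr H]]. exists r. split; [exact Hr|].
    intros w Hw. symmetry. apply HF, (H w Hw).
  + apply analytic_at_plus; [apply analytic_at_const|]. apply analytic_at_mult.
    * apply analytic_at_div_bpow, IH; assumption.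
    * apply (analytic_at_inv (fun w => alpha A (w / bpow b 1))); assumption.
Qed.

(** Pole orders add up: a factor of order [k] that clears [F] at z/b and the order [l] of the zero
    of alpha(w/b) at [z] give a factor of order k + l that clears [F] at [z]. *)
Lemma continuation_meromorphic b A c (F : C -> C) :
  (0 < b)%nat -> (0 < length A)%nat ->
  (forall t, in_disc c t -> F t = disc_sum c t) ->
  (forall t, alpha A (t / bpow b 1) <> 0 -> F t = - (1) + F (t / bpow b 1) / alpha A (t / bpow b 1)) ->
  forall n z, in_disc c (z / bpow b n) -> meromorphic_germ F z.
Proof.
intros Hb HA HP HF. assert (hb := bpow_neq_0 b 1 Hb).
induction n as [|n IH]; intros z Hn.
- rewrite div_bpow_0 in Hn. apply analytic_meromorphic_germ.
  apply (analytic_at_ext (disc_sum c)); [|apply analytic_at_disc_sum, Hn].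
  destruct (in_disc_near c z Hn) as [r [Hr H]]. exists r. split; [exact Hr|].
  intros w Hw. symmetry. apply HP, H, Hw.
- rewrite <- div_bpow_S in Hn by exact Hb.
  destruct (IH _ Hn) as (k & h & r & Hr & Hh & H).
  assert (Hal := analytic_at_div_bpow (alpha A) b z (analytic_at_alpha A _)).
  assert (hm : (0 < Cmod (bpow b 1))%R) by (apply Cmod_gt_0, hb).
  destruct (analytic_at_factor _ z Hal) as [(s & Hs & H0)|(l & g & s & Hs & Hg & Hg0 & Hfac)].
  { exfalso. apply (alpha_not_locally_zero A (z / bpow b 1) (s / Cmod (bpow b 1)) HA).
    - apply Rdiv_lt_0_compat; assumption.
    - intros w Hw. replace w with (bpow b 1 * w / bpow b 1) by (field; exact hb). apply H0.
      replace (bpow b 1 * w - z) with (bpow b 1 * (w - z / bpow b 1)) by (field; exact hb).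
      rewrite Cmod_mult. apply (Rmult_lt_compat_l (Cmod (bpow b 1))) in Hw; [|exact hm].
      replace (Cmod (bpow b 1) * (s / Cmod (bpow b 1)))%R with s in Hw by (field; lra). exact Hw. }
  destruct (analytic_at_nonzero g z Hg Hg0) as [s' [Hs' Hgs]].
  (* With alpha(w/b) = (w - z)^l g(w) and w - z = b (w/b - z/b), this is (w - z)^(k+l) (-1 + F(w/b)
     / alpha(w/b)). The radius keeps w/b where [h] represents [F], and [w] where the factorization
     holds and [g] is nonzero. *)
  exists (k + l)%nat, (fun w => (-1) * Cpow (w + - z) (k + l) + Cpow (bpow b 1) k * h (w / bpow b 1) * / g w),
    (Rmin (r * Cmod (bpow b 1)) (Rmin s s')).
  split; [repeat apply Rmin_glb_lt; try assumption; apply Rmult_lt_0_compat; assumption|]. split.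
  + apply analytic_at_plus.
    * apply analytic_at_mult; [apply analytic_at_const|].
      apply (analytic_at_pow (fun w => w + - z)), analytic_at_plus; [apply analytic_at_id | apply analytic_at_const].
    * apply analytic_at_mult; [apply analytic_at_mult; [apply analytic_at_const | apply analytic_at_div_bpow, Hh]|].
      apply analytic_at_inv; assumption.
  + intros w Hw.
    assert (m1 := Rmin_l (r * Cmod (bpow b 1)) (Rmin s s')).
    assert (m2 := Rmin_r (r * Cmod (bpow b 1)) (Rmin s s')).
    assert (m3 := Rmin_l s s'). assert (m4 := Rmin_r s s').
    assert (Hwz : w - z <> 0) by (intros e; rewrite e, Cmod_0 in Hw; lra).
    assert (Hgw := Hgs w ltac:(lra)). assert (Hfw := Hfac w ltac:(lra)). cbv beta in Hfw.
    assert (Hpl := Cpow_neq_0 (w - z) l Hwz).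
    assert (Hal0 : alpha A (w / bpow b 1) <> 0) by (rewrite Hfw; apply Cmult_neq_0; assumption).
    assert (Hk : Cpow (w / bpow b 1 - z / bpow b 1) k * F (w / bpow b 1) = h (w / bpow b 1)).
    { apply H. replace (w / bpow b 1 - z / bpow b 1) with ((w - z) / bpow b 1) by (field; exact hb).
      rewrite Cmod_div by exact hb. split; [apply Rdiv_lt_0_compat; lra|].
      apply (Rmult_lt_reg_r (Cmod (bpow b 1))); [exact hm|].
      unfold Rdiv. rewrite Rmult_assoc, Rinv_l by lra. lra. }
    rewrite HF, Hfw, <- Hk by exact Hal0.
    replace (w - z) with (bpow b 1 * (w / bpow b 1 - z / bpow b 1)) at 2 by (field; exact hb).
    change (w + - z) with (w - z).
    transitivity ((-1) * Cpow (w - z) (k + l) + Cpow (w - z) k * F (w / bpow b 1) / g w).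
    * rewrite Cpow_add.
      replace (bpow b 1 * (w / bpow b 1 - z / bpow b 1)) with (w - z) by (field; exact hb).
      field. split; assumption.
    * replace (Cpow (w - z) k) with (Cpow (bpow b 1) k * Cpow (w / bpow b 1 - z / bpow b 1) k).
      -- field. exact Hgw.
      -- rewrite <- Cpow_mult_l. f_equal. field. exact hb.
Qed.

Lemma continuation_series b A (F : C -> C) t :
  (1 < b)%nat -> (2 <= length A)%nat -> analytic_at F 0 ->
  (forall w, alpha A (w / bpow b 1) <> 0 -> F (w / bpow b 1) = alpha A (w / bpow b 1) + alpha A (w / bpow b 1) * F w) ->
  ~ alpha_singular b A t ->
  exists S : C, converges_geometrically (fun k => / alpha_prod b A t (k + 1)) S /\ F t = RtoC (-1) - S.
Proof.
intros Hb HA HF0 HF Ht. assert (Hb0 : (0 < b)%nat) by lia.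
assert (HA' : (2 <= INR (length A))%R) by (apply (le_INR 2), HA).
set (p := alpha_prod b A t).
set (Q := fun k => 1 + F (t / bpow b k)).
assert (Hal : forall k, alpha A (t / bpow b (S k)) <> 0) by (intros k; apply alpha_neq_0; assumption).
assert (Hp : forall k, p k <> 0).
{ induction k as [|k IH]; [unfold p, alpha_prod; cbn; apply RtoC_neq_0; lra|].
  unfold p. rewrite alpha_prod_S. apply Cmult_neq_0; [exact IH | apply Hal]. }
assert (HQ : forall k, Q (S k) - 1 = alpha A (t / bpow b (S k)) * Q k).
{ intros k. unfold Q.
  assert (E : t / bpow b k / bpow b 1 = t / bpow b (S k)).
  { rewrite (bpow_S b k). field. split; apply bpow_neq_0, Hb0. }
  assert (h := HF (t / bpow b k)). rewrite E in h. rewrite h by apply Hal. ring. }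
(* Dividing Q_(k+1) - 1 = alpha(t/b^(k+1)) Q_k by p_(k+1) gives 1/p_(k+1) = Q_(k+1)/p_(k+1) -
   Q_k/p_k, which telescopes. *)
assert (Hsum : forall n, csum_n (fun k => / p (k + 1)%nat) n = Q (S n) / p (S n) - Q 0%nat).
{ assert (Hstep : forall k, / p (S k) = Q (S k) / p (S k) - Q k / p k).
  { intros k. replace (Q k / p k) with ((Q (S k) - 1) / p (S k)).
    - field. apply Hp.
    - rewrite HQ. unfold p. rewrite alpha_prod_S. field. split; [apply Hp | apply Hal]. }
  assert (p0 : p 0%nat = 1) by reflexivity.
  induction n as [|n IH].
  - rewrite sum_O. change (0 + 1)%nat with 1%nat. rewrite Hstep, p0. cfield. apply (Hp 1%nat).
  - rewrite sum_Sn, IH. change (plus ?x ?y) with (x + y). replace (S n + 1)%nat with (S (S n)) by lia.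
    rewrite (Hstep (S n)). cring. }
(* Eventually [3/2 <= |alpha(t/b^k)|], since [alpha(0) >= 2]. *)
destruct (analytic_at_continuous _ 0 (analytic_at_alpha A 0) (/ 2) ltac:(lra)) as [r1 [Hr1 Hc1]].
destruct (analytic_at_continuous _ 0 HF0 1 ltac:(lra)) as [r2 [Hr2 Hc2]].
destruct (div_bpow_small b t r1 Hb Hr1) as [K1 HK1].
destruct (div_bpow_small b t r2 Hb Hr2) as [K2 HK2].
destruct (eventually_bounded (fun k => Cmod (Q k)) (Cmod (F 0) + 2) K2) as [MQ [HMQ0 HMQ]].
{ intros k Hk. unfold Q.
  assert (h := Hc2 (t / bpow b k)).
  replace (t / bpow b k - 0) with (t / bpow b k) in h by ring. specialize (h (HK2 k Hk)).
  replace (1 + F (t / bpow b k)) with (1 + (F (t / bpow b k) - F 0 + F 0)) by ring.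
  eapply Rle_trans; [apply Cmod_triangle|]. rewrite Cmod_1.
  assert (h' := Cmod_triangle (F (t / bpow b k) - F 0) (F 0)). lra. }
(* Beyond [K1] each new factor of the product has modulus at least 3/2, so this quantity no longer
   increases. *)
destruct (eventually_bounded (fun k => Cmod (/ p k) * (3 / 2) ^ k)%R (Cmod (/ p K1) * (3 / 2) ^ K1)%R K1)
  as [Mp [HMp0 HMp]].
{ intros k Hk. induction Hk as [|k Hk IH]; [lra|]. eapply Rle_trans; [|exact IH].
  assert (h := Hc1 (t / bpow b (S k))).
  replace (t / bpow b (S k) - 0) with (t / bpow b (S k)) in h by ring. specialize (h (HK1 (S k) ltac:(lia))).
  rewrite alpha_0 in h.
  assert (ha : (3 / 2 <= Cmod (alpha A (t / bpow b (S k))))%R).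
  { assert (h' := Cmod_triangle (alpha A (t / bpow b (S k))) (RtoC (INR (length A)) - alpha A (t / bpow b (S k)))).
    replace (alpha A (t / bpow b (S k)) + (RtoC (INR (length A)) - alpha A (t / bpow b (S k))))
      with (RtoC (INR (length A))) in h' by ring.
    rewrite Cmod_RtoC_pos in h' by lra.
    rewrite <- Cmod_opp in h. replace (- (alpha A (t / bpow b (S k)) - INR (length A)))
      with (RtoC (INR (length A)) - alpha A (t / bpow b (S k))) in h by ring. lra. }
  unfold p at 1. rewrite alpha_prod_S. fold p.
  rewrite !Cmod_inv, Cmod_mult by (try apply Cmult_neq_0; (apply Hp || apply Hal)).
  assert (hp : (0 < Cmod (p k))%R) by (apply Cmod_gt_0, Hp).
  assert (h32 : (0 < (3 / 2) ^ k)%R) by (apply pow_lt; lra).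
  set (x := Cmod (alpha A (t / bpow b (S k)))) in *. cbn [pow].
  rewrite Rinv_mult. replace (/ Cmod (p k) * / x * (3 / 2 * (3 / 2) ^ k))%R
    with (/ Cmod (p k) * (3 / 2) ^ k * (3 / 2 / x))%R by (field; lra).
  rewrite <- (Rmult_1_r (/ Cmod (p k) * (3 / 2) ^ k)) at 2.
  apply Rmult_le_compat_l; [apply Rmult_le_pos; [left; apply Rinv_0_lt_compat, hp | lra]|].
  apply (Rmult_le_reg_r x); [lra|]. unfold Rdiv. rewrite Rmult_assoc, Rinv_l by lra. lra. }
assert (Herr : forall n, (Cmod (csum_n (fun k => / p (k + 1)%nat)%C n - - Q 0%nat) <= MQ * Mp * (2 / 3) ^ n)%R).
{ intros n. rewrite Hsum. replace (Q (S n) / p (S n) - Q 0%nat - - Q 0%nat) with (Q (S n) * / p (S n))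
    by (unfold Cdiv; ring).
  rewrite Cmod_mult. specialize (HMQ (S n)). specialize (HMp (S n)). cbv beta in HMQ, HMp.
  assert (h32 : (0 < (3 / 2) ^ S n)%R) by (apply pow_lt; lra).
  assert (h23 : (0 < (2 / 3) ^ n)%R) by (apply pow_lt; lra).
  assert (hinv : ((3 / 2) ^ S n * (2 / 3) ^ S n = 1)%R).
  { rewrite <- Rpow_mult_distr. replace (3 / 2 * (2 / 3))%R with 1%R by field. apply pow1. }
  assert (h : (Cmod (/ p (S n)) <= Mp * (2 / 3) ^ S n)%R).
  { apply (Rmult_le_reg_r ((3 / 2) ^ S n)); [exact h32|].
    rewrite Rmult_assoc, (Rmult_comm ((2 / 3) ^ S n)), hinv, Rmult_1_r. exact HMp. }
  rewrite Rmult_assoc. apply Rmult_le_compat; try apply Cmod_ge_0; [exact HMQ|].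
  eapply Rle_trans; [exact h|]. apply Rmult_le_compat_l; [exact HMp0|]. cbn [pow]. lra. }
(* The sum is -Q_0 = -1 - F(t), which is the claimed formula for F(t). *)
exists (- Q 0%nat). split; [split|].
- apply C_is_series_eps. intros eps Heps.
  destruct (pow_lt_1_zero (2 / 3)) with (y := (eps / (MQ * Mp + 1))%R) as [N HN].
  + rewrite Rabs_pos_eq; lra.
  + apply Rdiv_lt_0_compat; nra.
  + exists N. intros n Hn. eapply Rle_lt_trans; [apply Herr|].
    specialize (HN n Hn). rewrite Rabs_pos_eq in HN by (apply pow_le; lra).
    assert (h23 : (0 < (2 / 3) ^ n)%R) by (apply pow_lt; lra).
    assert (hM : (0 <= MQ * Mp)%R) by (apply Rmult_le_pos; assumption).
    apply Rle_lt_trans with ((MQ * Mp + 1) * (2 / 3) ^ n)%R; [nra|].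
    apply (Rmult_lt_compat_l (MQ * Mp + 1)) in HN; [|lra].
    replace ((MQ * Mp + 1) * (eps / (MQ * Mp + 1)))%R with eps in HN by (field; lra). exact HN.
- exists (MQ * Mp)%R, (2 / 3)%R. split; [lra | exact Herr].
- unfold Q. rewrite div_bpow_0. replace (RtoC (-1)) with (- RtoC 1) by (rewrite <- RtoC_opp; reflexivity). ring.
Qed.

(** Both sides are power series in [t], the product by Cauchy's rule, and [egf_recurrence] equates
    their coefficients. *)
Lemma egf_functional_equation b A K t :
  digit_set b A -> (1 < length A < b)%nat -> restricted_dirichlet b A K -> ~ In 0%nat A ->
  in_disc (egf_coeff K) t ->
  disc_sum (egf_coeff K) (t / bpow b 1) =
  alpha A (t / bpow b 1) + alpha A (t / bpow b 1) * disc_sum (egf_coeff K) t.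
Proof.
intros HA HN HK H0 Ht. assert (Hb : (0 < b)%nat) by lia.
assert (Hb' : RtoC (INR b) <> 0) by (apply RtoC_neq_0, not_0_INR; lia).
assert (H1 := disc_sum_series _ _ (in_disc_div _ b 1 t Hb Ht)).
assert (H2 := disc_sum_series _ _ Ht). assert (H3 := alpha_series b A t Hb).
apply (C_is_series_unique _ _ _ H1).
destruct (in_disc_summable _ _ Ht) as [S HS].
assert (Ha : ex_series (fun j => Cmod (alpha_coeff b A j * Cpow t j))).
{ apply (ex_series_le (V := R_CompleteNormedModule) _ (fun j => INR (length A) * (Cmod t ^ j / INR (fact j)))%R).
  - intros j. unfold norm; cbn. rewrite Rabs_pos_eq by apply Cmod_ge_0.
    unfold alpha_coeff. rewrite Cmod_mult, Cmod_pow, Cmod_div by apply INR_fact_neq_0_C.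
    rewrite (Cmod_RtoC_pos (INR (fact j))) by apply pos_INR.
    assert (h := Cmod_gamma_le b A j ltac:(lia) HA). fold (bpow b j) in h.
    assert (hd := digit_ratio b ltac:(lia)).
    assert (hp : (((INR b - 1) / INR b) ^ j <= 1)%R).
    { eapply Rle_trans; [apply (pow_incr _ 1); lra | rewrite pow1; lra]. }
    assert (hl := pos_INR (length A)).
    assert (hx : (0 <= Cmod t ^ j / INR (fact j))%R)
      by (apply Rdiv_le_0_compat; [apply pow_le, Cmod_ge_0 | apply INR_fact_lt_0]).
    replace (Cmod (RtoC (INR (gamma A j)) / bpow b j) / INR (fact j) * Cmod t ^ j)%R
      with (Cmod (RtoC (INR (gamma A j)) / bpow b j) * (Cmod t ^ j / INR (fact j)))%R by (unfold Rdiv; ring).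
    apply Rmult_le_compat_r; [exact hx|]. eapply Rle_trans; [exact h|].
    rewrite <- (Rmult_1_r (INR (length A))) at 2. apply Rmult_le_compat_l; assumption.
  - apply (ex_series_scal (K := R_AbsRing) (V := R_NormedModule) (INR (length A))).
    eexists. apply is_series_exp. }
destruct Ha as [T HT].
assert (H4 : C_is_series (cauchy_prod (fun j => alpha_coeff b A j * Cpow t j) (fun m => egf_coeff K m * Cpow t m))
   (alpha A (t / bpow b 1) * disc_sum (egf_coeff K) t)).
{ apply (C_is_series_mult _ _ _ _ T S H3 H2 HT).
  revert HS. apply is_series_ext. intros m. rewrite Cmod_mult, Cmod_pow. reflexivity. }
generalize (C_is_series_plus _ _ _ _ H3 H4). apply C_is_series_ext. intros m.
rewrite cauchy_prod_pow, <- Cmult_plus_distr_r, <- egf_recurrence by assumption.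
assert (Hbp : forall j, bpow b j = Cpow (RtoC (INR b)) j) by (intros j; unfold bpow; apply RtoC_pow).
rewrite !Hbp. cbn [Cpow]. rewrite Cmult_1_r. unfold Cdiv. rewrite Cpow_mult_l, Cpow_inv by exact Hb'. ring.
Qed.

Lemma egf_radius_pos b A K :
  digit_set b A -> (1 < length A < b)%nat -> restricted_dirichlet b A K ->
  Rbar_lt 0%R (C_radius (egf_coeff K)).
Proof.
intros HA HN HK.
(* The coefficient bound 2 3^m allows any radius below 1/3; 1/6 gives the ratio 1/2. *)
destruct (is_series_R_le (fun m => Cmod (egf_coeff K m) * (/ 6) ^ m)%R (fun m => 2 * (/ 2) ^ m)%R (2 * / (1 - / 2))%R)
  as [T [_ HT]].
- intros m. assert (h : (0 < (/ 6) ^ m)%R) by (apply pow_lt; lra). split.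
  + apply Rmult_le_pos; [apply Cmod_ge_0 | lra].
  + eapply Rle_trans; [apply Rmult_le_compat_r; [lra | apply (Cmod_egf_coeff_le b A K HA HN HK)]|].
    rewrite Rmult_assoc, <- Rpow_mult_distr. replace (3 * / 6)%R with (/ 2)%R by field. lra.
- apply (is_series_scal (K := R_AbsRing) (V := R_NormedModule)), is_series_geom. lra.
- apply Rbar_lt_le_trans with (/ 6)%R; [cbn; lra|].
  apply (CV_radius_summable _ (fun m => Cmod (egf_coeff K m)) _ T); [|lra|exact HT].
  intros k. rewrite Rabs_pos_eq by apply Cmod_ge_0. lra.
Qed.

Theorem proposition8p1 :
  forall (b : nat) (A : list nat) (K : C -> C),
  (1 < b)%nat ->
  digit_set b A ->
  (1 < length A < b)%nat ->
  restricted_dirichlet b A K ->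
  let N := length A in
  let N1 := length (nonzero_digits A) in
  (forall m : nat, exists p q : Z,
      q <> 0%Z /\ K (RtoC (- INR m)) = RtoC (IZR p / IZR q)) /\
  K 0 = RtoC (- (INR N1 / (INR N - 1))) /\
  (forall m : nat, (1 <= m)%nat ->
      (/ bpow b m - RtoC (INR N)) * K (RtoC (- INR m)) =
      RtoC (INR (gamma A m)) / bpow b m +
      sum_n_m (G := C_AbelianGroup)
        (fun j => RtoC (Binomial.C m j) * (RtoC (INR (gamma A j)) / bpow b j)
                  * K (RtoC (- INR m + INR j))) 1 m) /\
  (In 0%nat A <-> K 0 = RtoC (-1)) /\
  (In 0%nat A -> forall m : nat, (1 <= m)%nat -> K (RtoC (- INR m)) = 0) /\
  (~ In 0%nat A <-> N1 = N) /\
  (~ In 0%nat A <-> (Im (K 0) = 0%R /\ (Re (K 0) < -1)%R)) /\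
  (~ In 0%nat A ->
     Rbar_lt 0%R (C_radius (egf_coeff K)) /\
     exists F : C -> C,
       (forall t : C, Rbar_lt (Cmod t) (C_radius (egf_coeff K)) ->
          C_is_pseries (egf_coeff K) t (F t) /\
          F (t / bpow b 1) =
          alpha A (t / bpow b 1) + alpha A (t / bpow b 1) * F t) /\
       meromorphic_with_poles_in F (alpha_singular b A) /\
       (forall t : C, ~ alpha_singular b A t ->
          F (t / bpow b 1) =
          alpha A (t / bpow b 1) + alpha A (t / bpow b 1) * F t) /\
       (forall t : C, ~ alpha_singular b A t ->
          exists S : C,
            converges_geometrically (fun k => / alpha_prod b A t (k + 1)) S /\
            F t = RtoC (-1) - S)).
Proof.
intros b A K Hb HA HN HK N N1.
assert (HK0 : K 0 = RtoC (- (INR N1 / (INR N - 1)))) by exact (dirichlet_at_0 b A K HA HN HK).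
assert (HN' : (1 < INR N)%R) by (apply (lt_INR 1); unfold N; lia).
assert (HL := length_nonzero_digits A (proj1 HA)). fold N N1 in HL.
assert (Hin : In 0%nat A -> K 0 = RtoC (-1)).
{ intros h. rewrite HK0. f_equal. destruct (in_dec Nat.eq_dec 0%nat A) as [_|h']; [|contradiction].
  rewrite <- HL, plus_INR, INR_1. rewrite <- HL, plus_INR, INR_1 in HN'. field. lra. }
assert (Hout : ~ In 0%nat A -> N1 = N).
{ intros h. destruct (in_dec Nat.eq_dec 0%nat A); [contradiction | lia]. }
assert (Hlt : ~ In 0%nat A -> Im (K 0) = 0%R /\ (Re (K 0) < -1)%R).
{ intros h. rewrite HK0, (Hout h). split; [reflexivity|]. cbn.
  replace (INR N / (INR N - 1))%R with (1 + / (INR N - 1))%R by (field; lra).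
  assert (0 < / (INR N - 1))%R by (apply Rinv_0_lt_compat; lra). lra. }
split; [exact (K_rational b A K HA HN HK)|].
split; [exact HK0|].
split; [intros m Hm; exact (dirichlet_recurrence b A K m HA HN HK Hm)|].
split; [|split; [|split; [|split]]].
(* The converse is by contraposition: without the digit 0 the value at 0 is strictly below -1. *)
- split; [exact Hin|]. intros h. apply NNPP. intros h'. destruct (Hlt h') as [_ h2].
  rewrite h in h2. cbn in h2. lra.
- intros h. apply (K_neg_zero b A K HA HN HK), Hin, h.
- split; [exact Hout|]. intros h h'. destruct (in_dec Nat.eq_dec 0%nat A); [lia | contradiction].
- split; [exact Hlt|]. intros [_ h] h'. rewrite (Hin h') in h. cbn in h. lra.
- intros H0. assert (Hrad := egf_radius_pos b A K HA HN HK). split; [exact Hrad|].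
  destruct (extend_exists b A (egf_coeff K) Hb Hrad) as [F [HF1 HF2]].
  assert (Hdisc : forall t, in_disc (egf_coeff K) t ->
     F (t / bpow b 1) = alpha A (t / bpow b 1) + alpha A (t / bpow b 1) * F t).
  { intros t Ht. rewrite (HF1 t Ht), HF1 by (apply in_disc_div; [lia | exact Ht]).
    apply (egf_functional_equation b A K t); assumption. }
  (* Inside the disc this is the identity between power series; outside, it is the defining relation
     of [F] with the denominator cleared. *)
  assert (Hfe : forall t, alpha A (t / bpow b 1) <> 0 ->
     F (t / bpow b 1) = alpha A (t / bpow b 1) + alpha A (t / bpow b 1) * F t).
  { intros t Ht. destruct (classic (in_disc (egf_coeff K) t)) as [h|h]; [apply Hdisc, h|].
    rewrite (HF2 t h). field. exact Ht. }
  assert (Hdiv : forall t, alpha A (t / bpow b 1) <> 0 -> F t = - (1) + F (t / bpow b 1) / alpha A (t / bpow b 1)).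
  { intros t Ht. rewrite (Hfe t Ht). field. exact Ht. }
  assert (HF0 : analytic_at F 0).
  { assert (Hd0 : in_disc (egf_coeff K) 0) by (unfold in_disc; rewrite Cmod_0; exact Hrad).
    apply (analytic_at_ext (disc_sum (egf_coeff K))); [|apply analytic_at_disc_sum, Hd0].
    destruct (in_disc_near _ 0 Hd0) as [r [Hr H]]. exists r. split; [exact Hr|].
    intros w Hw. symmetry. apply HF1, H, Hw. }
  exists F. split; [|split; [split|split]].
  + intros t Ht. split; [|apply Hdisc, Ht]. rewrite (HF1 t Ht).
    apply C_is_pseries_alt, disc_sum_series, Ht.
  + intros z. destruct (in_disc_eventually b _ z Hb Hrad) as [n Hn].
    apply meromorphic_germ_at. apply (continuation_meromorphic b A (egf_coeff K) F) with n; try assumption; lia.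
  + intros z Hz. destruct (in_disc_eventually b _ z Hb Hrad) as [n Hn].
    apply (continuation_analytic b A (egf_coeff K) F) with n; try assumption; lia.
  + intros t Ht. apply Hfe. apply (alpha_neq_0 b A t 0); [lia | exact Ht].
  + intros t Ht. apply continuation_series; try assumption; lia.
Qed.
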